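(* Let $k$ be an algebraically closed field and let $F\in A=k^{[2]}$ be a generally rational polynomial in $A$. Then $$t-1=\sum_{\lambda\in k}(n_\lambda-1),$$ where $t$ is the number of dicriticals of $F$ and $n_\lambda$ is the number of irreducible components of the closed subset $V(F-\lambda)$ of $\operatorname{Spec}A$ (the sum has only finitely many nonzero terms).
   Context: $k^{[2]}$ is a polynomial ring in two variables over $k$. $F$ is a generally rational polynomial in $A$ if, for all but finitely many $\lambda\in k$, $F-\lambda$ is irreducible in $A$ and $\operatorname{Frac}(A/(F-\lambda))$ is a purely transcendental extension of $k$ of transcendence degree $1$. For $F\in A\setminus k$, let $\mathcal A=S^{-1}A$ with $S=k[F]\setminus\{0\}$; the dicriticals of $F$ are the valuation rings $\mathcal O$ of $\operatorname{Frac}A$ with $k(F)\subseteq\mathcal O\ne\operatorname{Frac}A$ and $\mathcal A\not\subseteq\mathcal O$; their number $t$ is a positive integer. *)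

(* Defs.v *)
From HB Require Import structures.
From mathcomp Require Import all_boot all_order all_algebra.
From Stdlib Require List.
Set Implicit Arguments. Unset Strict Implicit. Unset Printing Implicit Defensive.
Import Order.TTheory GRing.Theory Num.Theory.
Local Open Scope ring_scope.

Definition card_upto (T : Type) (eqv : T -> T -> Prop) (X : T -> Prop)
    (n : nat) : Prop :=
  exists l : list T,
    List.length l = n /\ (forall x, List.In x l -> X x) /\
    List.ForallOrdPairs (fun x y => ~ eqv x y) l /\
    (forall x, X x -> exists2 y, List.In y l & eqv x y).

Definition set_eq (T : Type) (U V : T -> Prop) : Prop := forall x, U x <-> V x.
Definition subset (T : Type) (U V : T -> Prop) : Prop := forall x, U x -> V x.

Definition poly2 (k : closedFieldType) := {poly {poly k}}.
Definition cst2 (k : closedFieldType) (c : k) : poly2 k := (c%:P)%:P.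
Definition evalF (k : closedFieldType) (F : poly2 k) (p : {poly k}) : poly2 k :=
  (map_poly (@cst2 k) p).[F].

Definition ring_irreducible (R : idomainType) (a : R) : Prop :=
  a != 0 /\ a \isn't a GRing.unit /\
  forall b c : R, a = b * c -> b \is a GRing.unit \/ c \is a GRing.unit.

(* Frac(A/(g)) is a purely transcendental extension of k of transcendence
   degree 1, i.e. k-isomorphic to k(T) = {fraction {poly k}}.  Unfolded via the
   universal property of the fraction field: there is a k-algebra morphism
   A -> k(T) whose kernel is exactly the ideal (g) and whose image generates
   k(T) as a field. *)
Definition frac_quot_rational (k : closedFieldType) (g : poly2 k) : Prop :=
  exists psi : {rmorphism poly2 k -> {fraction {poly k}}},
    (forall c : k, psi (cst2 c) = FracField.tofrac (c%:P)) /\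
    (forall a : poly2 k, psi a = 0 <-> exists b, a = b * g) /\
    (forall z : {fraction {poly k}},
        exists a b : poly2 k, psi b != 0 /\ z = psi a / psi b).

Definition generally_rational (k : closedFieldType) (F : poly2 k) : Prop :=
  exists E : seq k, forall lam : k, lam \notin E ->
    ring_irreducible (F - cst2 lam) /\ frac_quot_rational (F - cst2 lam).

Definition fracA (k : closedFieldType) := {fraction (poly2 k)}.
Definition inK (k : closedFieldType) (a : poly2 k) : fracA k := FracField.tofrac a.

Definition valuation_ring (K : fieldType) (O : K -> Prop) : Prop :=
  O 1 /\ (forall x y, O x -> O y -> O (x - y)) /\
  (forall x y, O x -> O y -> O (x * y)) /\
  (forall x, x != 0 -> O x \/ O x^-1).

Definition kF (k : closedFieldType) (F : poly2 k) (x : fracA k) : Prop :=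
  exists p q : {poly k}, q != 0 /\ x = inK (evalF F p) / inK (evalF F q).

Definition locA (k : closedFieldType) (F : poly2 k) (x : fracA k) : Prop :=
  exists (a : poly2 k) (s : {poly k}), s != 0 /\ x = inK a / inK (evalF F s).

Definition dicritical (k : closedFieldType) (F : poly2 k) (O : fracA k -> Prop)
  : Prop :=
  valuation_ring O /\ (forall x, kF F x -> O x) /\ (exists x, ~ O x) /\
  (exists x, locA F x /\ ~ O x).

Definition prime_ideal (R : comRingType) (P : R -> Prop) : Prop :=
  P 0 /\ (forall x y, P x -> P y -> P (x + y)) /\
  (forall a x, P x -> P (a * x)) /\ ~ P 1 /\
  (forall x y, P (x * y) -> P x \/ P y).

Definition Spec (R : comRingType) := {P : R -> Prop | prime_ideal P}.

Definition zclosed (R : comRingType) (Z : Spec R -> Prop) : Prop :=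
  exists E : R -> Prop, forall p : Spec R, Z p <-> (forall x, E x -> proj1_sig p x).

Definition zV (R : comRingType) (g : R) : Spec R -> Prop :=
  fun p => proj1_sig p g.

Definition zirreducible (R : comRingType) (Y : Spec R -> Prop) : Prop :=
  (exists p, Y p) /\
  forall Z1 Z2, zclosed Z1 -> zclosed Z2 -> (forall p, Y p -> Z1 p \/ Z2 p) ->
    subset Y Z1 \/ subset Y Z2.

Definition irr_component (R : comRingType) (Z Y : Spec R -> Prop) : Prop :=
  subset Y Z /\ zirreducible Y /\
  forall Y', zirreducible Y' -> subset Y Y' -> subset Y' Z -> subset Y' Y.

(* Main.v *)
Require Import Defs.
From HB Require Import structures.
From mathcomp Require Import all_boot all_order all_algebra.
From mathcomp Require Import generic_quotient ring_quotient closed_field.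
From mathcomp Require Import boolp classical_sets functions filter ring zify.
Set Implicit Arguments. Unset Strict Implicit. Unset Printing Implicit Defensive.
Import Order.TTheory GRing.Theory Num.Theory.
Local Open Scope ring_scope.

(* Almost all fibers F = lambda have a rational function field, and they are parametrized by
   rational functions whose degree is bounded in terms of F.  An ultraproduct of these
   parametrizations, followed by a specialization, parametrizes the generic fiber over an algebraic
   closure L of k(F): E = Frac A embeds into L(T) over k(F), and L(T) is algebraic over E.  Hence
   the valuation rings of E over k(F) are the restrictions of the points of the projective line
   over L, and the dicriticals are the finitely many classes of points that restrict to the same
   ring and are poles of an element of the localization.

   The units of the localization modulo k(F)^* form a group of rank t - 1: principal divisors of the
   line have degree 0, every divisor of degree 0 is principal, and the norm of a function on the
   line is an element of E with proportional valuations; a unit without zeros and poles is algebraic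
   over k(F), hence in k(F), because the general member of the pencil is irreducible.

   On the other hand these units are generated by k(F)^* and the prime factors of the polynomials
   F - lambda, subject only to the relations that F - lambda lies in k(F); so the rank is
   the sum of the n_lambda - 1. *)

(** The hypothesis gives one parametrization for each general value of F, with no link between
    different values. The degree bound turns each of them into a number of elements of [k] that does
    not depend on the value, subject to algebraic conditions; such data pass to an ultraproduct. The
    ultrapower of [k] is far larger than an algebraic closure of k(F), whence the specialization. It
    need not preserve birationality, but it can keep a given element nonzero, and the nonconstancy
    of one coordinate is all that is used afterwards: it already makes L(T) algebraic over Frac A.

    The extension L(T) of Frac A may be infinite and inseparable, so conjugates, ramification
    indices and residue degrees are avoided. The norm becomes the constant coefficient of a minimal
    polynomial, and the size of a class of points enters only through positive rational weights.
    Ranks are compared over the rationals, because fibers may have multiple components: after one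
    component of a fiber is left out, the others recover it only up to a root. *)

Section FractionLift.
Variables (R : idomainType) (K : fieldType) (f : {rmorphism R -> K}).
Hypothesis injf : forall x, f x = 0 -> x = 0.

Lemma fraction_ratio (z : {fraction R}) :
  exists a b : R, b != 0 /\ z = FracField.tofrac a / FracField.tofrac b.
Proof.
elim/quotW: z => x; exists \n_x, \d_x; have dx := denom_ratioP x.
split=> //; apply: (mulIf (x := FracField.tofrac \d_x)).
  by rewrite tofrac_eq0.
rewrite divfK ?tofrac_eq0 //.
unlock FracField.tofrac; rewrite -[LHS]FracField.pi_mul; apply/eqmodP => /=.
by rewrite FracField.equivfE /FracField.mulf !numden_Ratio ?mulr1 ?mul1r ?oner_eq0 // mulrC.
Qed.

Lemma fraction_lift :
  exists g : {rmorphism {fraction R} -> K}, forall a, g (FracField.tofrac a) = f a.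
Proof.
have fne a : a != 0 -> f a != 0 by apply: contra_neq => /injf.
pose g0 (z : {fraction R}) (w : K) :=
  exists a b : R, [/\ b != 0, z = FracField.tofrac a / FracField.tofrac b & w = f a / f b].
have g0ex z : exists w, g0 z w.
  have [a [b [nb ez]]] := fraction_ratio z.
  by exists (f a / f b), a, b.
have [g gP] := choice g0ex.
have gE a b : b != 0 -> g (FracField.tofrac a / FracField.tofrac b) = f a / f b.
  move=> nb; have [c [d [nd e ->]]] := gP (FracField.tofrac a / FracField.tofrac b).
  move/eqP: e; rewrite eqr_div ?tofrac_eq0 // -!tofracM tofrac_eq => /eqP e.
  by apply/eqP; rewrite eqr_div ?fne // -!rmorphM -e mulrC eq_sym mulrC.
have gA : zmod_morphism g.
  move=> x y; have [a [b [nb ->]]] := fraction_ratio x.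
  have [c [d [nd ->]]] := fraction_ratio y.
  rewrite -mulNr addf_div ?tofrac_eq0 // -tofracN -!tofracM -tofracD !gE ?mulf_neq0 //.
  by rewrite -mulNr addf_div ?fne // rmorphD !rmorphM rmorphN.
have gM : monoid_morphism g.
  split; first by rewrite -[1]divr1 -tofrac1 gE ?oner_eq0 // divff // fne ?oner_eq0.
  move=> x y; have [a [b [nb ->]]] := fraction_ratio x.
  have [c [d [nd ->]]] := fraction_ratio y.
  by rewrite mulf_div -!tofracM !gE ?mulf_neq0 // mulf_div !rmorphM.
pose mA := GRing.isZmodMorphism.Build _ _ g gA.
pose mM := GRing.isMonoidMorphism.Build _ _ g gM.
pose g' : {rmorphism {fraction R} -> K} := HB.pack g mA mM.
exists g' => a.
by rewrite -[X in g' X]divr1 -tofrac1 /= gE ?oner_eq0 // rmorph1 divr1.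
Qed.

End FractionLift.

Definition subring (M : fieldType) (R : M -> Prop) : Prop :=
  R 1 /\ (forall x y, R x -> R y -> R (x - y)) /\ (forall x y, R x -> R y -> R (x * y)).

(** * Valuation rings *)

Section SubringTheory.
Variables (M : fieldType) (R : M -> Prop).
Hypothesis sR : subring R.

Lemma subring1 : R 1. Proof. by case: sR. Qed.
Lemma subringB x y : R x -> R y -> R (x - y). Proof. by case: sR => _ [h _]; apply: h. Qed.
Lemma subringM x y : R x -> R y -> R (x * y). Proof. by case: sR => _ [_ h]; apply: h. Qed.
Lemma subring0 : R 0. Proof. by rewrite -(subrr 1); apply: subringB; apply: subring1. Qed.
Lemma subringN x : R x -> R (- x).
Proof. by move=> Rx; rewrite -sub0r; apply: subringB => //; apply: subring0. Qed.
Lemma subringD x y : R x -> R y -> R (x + y).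
Proof. by move=> Rx Ry; rewrite -[y]opprK; apply: subringB => //; apply: subringN. Qed.
Lemma subringX x n : R x -> R (x ^+ n).
Proof.
by move=> Rx; elim: n => [|n IH]; rewrite ?expr0 ?exprS; [apply: subring1 | apply: subringM].
Qed.
Lemma subring_sum I (r : seq I) (P : pred I) (G : I -> M) :
  (forall i, P i -> R (G i)) -> R (\sum_(i <- r | P i) G i).
Proof. by move=> h; apply: (big_ind R) => //; [apply: subring0 | apply: subringD]. Qed.
Lemma subring_horner (p : {poly M}) x : (forall i, R p`_i) -> R x -> R p.[x].
Proof.
move=> Rp Rx; rewrite horner_coef; apply: subring_sum => i _.
by apply: subringM => //; apply: subringX.
Qed.
Lemma subring_coefM (p q : {poly M}) :
  (forall i, R p`_i) -> (forall i, R q`_i) -> forall i, R (p * q)`_i.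
Proof.
by move=> Rp Rq i; rewrite coefM; apply: subring_sum => j _; apply: subringM.
Qed.

Lemma subring_adjoin x :
  subring (fun w => exists2 p : {poly M}, (forall i, R p`_i) & w = p.[x]).
Proof.
split; [|split].
- exists 1; rewrite ?hornerE // => i; rewrite coef1.
  by case: (i == 0%N); [apply: subring1 | apply: subring0].
- move=> _ _ [p Rp ->] [q Rq ->]; exists (p - q); rewrite ?hornerE // => i.
  by rewrite coefB; apply: subringB.
- move=> _ _ [p Rp ->] [q Rq ->]; exists (p * q); rewrite ?hornerM // => i.
  exact: subring_coefM.
Qed.

Lemma subring_adjoin_base x w : R w -> exists2 p : {poly M}, (forall i, R p`_i) & w = p.[x].
Proof.
move=> Rw; exists w%:P; rewrite ?hornerC // => i; rewrite coefC.
by case: (i == 0%N) => //; apply: subring0.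
Qed.

Lemma subring_adjoin_gen x : exists2 p : {poly M}, (forall i, R p`_i) & x = p.[x].
Proof.
exists 'X; rewrite ?hornerX // => i; rewrite coefX.
by case: (i == 1%N); [apply: subring1 | apply: subring0].
Qed.

End SubringTheory.

Lemma valuation_subring (M : fieldType) (V : M -> Prop) : valuation_ring V -> subring V.
Proof. by case=> h1 [hB [hM _]]; split. Qed.

Lemma valuation_cases (M : fieldType) (V : M -> Prop) x :
  valuation_ring V -> V x \/ (x != 0 /\ V x^-1).
Proof.
move=> [h1 [hB [hM h]]]; have [->|nx] := eqVneq x 0; last by case: (h x nx); auto.
by left; rewrite -(subrr 1); apply: hB.
Qed.

Lemma exprV_mul (M : fieldType) (x : M) m n : x != 0 -> (n <= m)%N ->
  x^-1 ^+ n * x ^+ m = x ^+ (m - n).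
Proof.
by move=> nx nm; rewrite -{1}(subnK nm) exprD mulrCA exprVn mulVf ?mulr1 // expf_neq0.
Qed.

Section MaximalSubring.
Variables (M : fieldType) (V : M -> Prop) (z : M).
Hypotheses (sV : subring V) (Vy : V z^-1) (Vz : ~ V z).
Hypothesis maxV : forall B, subring B -> (forall w, V w -> B w) -> ~ B z ->
  forall w, B w -> V w.

Let nz : z != 0.
Proof. by apply/eqP => z0; apply: Vz; rewrite z0; apply: subring0. Qed.

(** The ring V[x] is strictly larger than [V], so maximality forces it to contain [z]. *)
Lemma adjoin_notin x : ~ V x -> exists2 p : {poly M}, (forall i, V p`_i) & z = p.[x].
Proof.
move=> nVx; apply: contrapT => nz'; apply: nVx.
apply: (maxV (subring_adjoin sV x) _ nz'); first by move=> w; apply: subring_adjoin_base.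
exact: subring_adjoin_gen.
Qed.

Lemma max_subring_unit v : V v -> V (1 - z^-1 * v)^-1.
Proof.
move=> Vv; set s := 1 - _.
have Vs : V s by apply: subringB => //; [apply: subring1 | apply: subringM].
have [s0|ns] := eqVneq s 0.
  by rewrite s0 invr0; apply: subring0.
apply: contrapT => nVs; have [p Vp ez] := adjoin_notin nVs.
(* Powers of [s] are congruent to 1 modulo z^-1 V. Clearing denominators in z = p(1/s) therefore
   gives z - w in [V]. *)
have pow n : exists2 w, V w & s ^+ n = 1 - z^-1 * w.
  elim: n => [|n [w Vw IH]]; first by exists 0; [apply: subring0 | rewrite expr0 mulr0 subr0].
  exists (v + w - z^-1 * v * w).
    by apply: subringB => //; [apply: subringD | apply: subringM => //; apply: subringM].
  by rewrite exprS IH /s; ring.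
have [w Vw ew] := pow (size p).
have Vq : V (s ^+ size p * z).
  rewrite ez horner_coef mulr_sumr; apply: subring_sum => // i _.
  rewrite mulrCA; apply: subringM => //.
  have -> : s ^+ size p * s^-1 ^+ i = s ^+ (size p - i).
    by rewrite mulrC exprV_mul // ltnW.
  exact: subringX.
apply: Vz; move: Vq; rewrite ew mulrBl mul1r mulrAC mulVf // mul1r => Vq.
by rewrite -(subrK w z); apply: subringD.
Qed.

(* the classical minimal-degree argument: a relation for x and one for 1/x
   with coefficients in zV cannot coexist *)
Lemma max_subring_descent N x (p q : {poly M}) : x != 0 ->
  (size p + size q <= N)%N ->
  (forall i, V (z * p`_i)) -> (forall i, V (z * q`_i)) ->
  p.[x] = 1 -> q.[x^-1] = 1 -> False.
Proof.
elim: N x p q => [|N IH] x p q nx.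
  rewrite leqn0 addn_eq0 size_poly_eq0 => /andP[/eqP p0 _] _ _ p1 _.
  by move: p1; rewrite p0 horner0 => /esym/eqP; rewrite oner_eq0.
have Vc c : V (z * c) -> V c.
  by move=> h; rewrite -(mulKf nz c); apply: subringM.
wlog le_qp : x p q nx / (size q <= size p)%N => [W|] sN Vp Vq ep eq1.
  case: (leqP (size q) (size p)) => h; first exact: (W x p q).
  by apply: (W x^-1 q p); rewrite ?invr_eq0 ?invrK ?(ltnW h) // addnC.
have sp1 : (1 < size p)%N.
  rewrite ltnNge; apply/negP => /size1_polyC pc; apply: Vz.
  by have := Vp 0%N; move: ep; rewrite pc hornerC coefC eqxx => ->; rewrite mulr1.
pose n := (size p).-1.
have spn : size p = n.+1 by rewrite /n; case: (size p) sp1.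
have n0 : (0 < n)%N by move: sp1; rewrite spn.
pose s := 1 - q`_0.
have Vs : V s^-1.
  by rewrite /s -(mulKf nz q`_0); apply: max_subring_unit.
have ns : s != 0.
  apply/eqP => s0; apply: Vz; have := Vq 0%N.
  by move/eqP: s0; rewrite subr_eq0 => /eqP <-; rewrite mulr1.
have es : s * x ^+ n = \sum_(j < n) q`_j.+1 * x ^+ (n - j.+1).
  have e1 : \sum_(j < n) q`_j.+1 * x^-1 ^+ j.+1 = s.
    have := eq1; rewrite (@horner_coef_wide _ n.+1) -?spn // spn big_ord_recl expr0 mulr1.
    by rewrite /s => <-; rewrite addrAC subrr add0r.
  rewrite -e1 mulr_suml; apply: eq_bigr => j _; rewrite -mulrA; congr (_ * _).
  exact: exprV_mul.
(* The relation for 1/x, multiplied by x^n and solved with the unit [s], writes x^n as a polynomial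
   of degree below n. Substituting it for the leading power in [p] shortens the relation for x. *)
pose r := \poly_(i < n) (s^-1 * q`_(n - i)).
have er : r.[x] = x ^+ n.
  rewrite horner_poly; apply: (mulfI ns); rewrite es mulr_sumr.
  rewrite [RHS](reindex_inj rev_ord_inj) /=; apply: eq_bigr => i _.
  by rewrite subnSK // subKn ?(ltnW (ltn_ord i)) // mulrA mulVKf.
pose p' := \poly_(i < n) (p`_i) + p`_n *: r.
have ep' : p'.[x] = 1.
  by rewrite /p' hornerD hornerZ er horner_poly -ep horner_coef spn big_ord_recr.
have sp' : (size p' <= n)%N.
  apply: leq_trans (size_polyD _ _) _; rewrite geq_max size_poly.
  by apply: leq_trans (size_scale_leq _ _) _; apply: size_poly.
apply: (IH x p' q) => //.
  by move: sN; rewrite spn addSn ltnS; apply: leq_trans; rewrite leq_add2r.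
move=> i; rewrite coefD coefZ mulrDr; apply: subringD => //.
  by rewrite coef_poly; case: ifP => _ //; rewrite mulr0; apply: subring0.
rewrite mulrA; apply: subringM => //; rewrite coef_poly.
case: ifP => _; last by apply: subring0.
by apply: subringM => //; apply: Vc.
Qed.

Lemma max_subring_valuation : valuation_ring V.
Proof.
case: (sV) => V1 [VB VM]; split=> //; split=> //; split=> // x nx.
apply: contrapT => /not_orP[nVx nVi].
have [p Vp ep] := adjoin_notin nVx; have [q Vq eq] := adjoin_notin nVi.
(* Both expressions of [z] are divided by [z]: this gives two relations with value 1 and
   coefficients in z^-1 V. *)
apply: (@max_subring_descent (size (z^-1 *: p) + size (z^-1 *: q)) x (z^-1 *: p) (z^-1 *: q)) => //.
- by move=> i; rewrite coefZ mulVKf.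
- by move=> i; rewrite coefZ mulVKf.
- by rewrite hornerZ -ep mulVf.
- by rewrite hornerZ -eq mulVf.
Qed.

End MaximalSubring.

(** By Zorn's lemma there is a subring maximal among those that contain [R] and omit [z]; it is a
    valuation ring by the preceding result. *)
Lemma exists_valuation_omitting (M : fieldType) (R : M -> Prop) (z : M) :
  subring R -> R z^-1 -> ~ R z ->
  exists V, [/\ valuation_ring V, forall w, R w -> V w & ~ V z].
Proof.
move=> sR Rz nRz.
(* [Zorn_bigcup] also asks for the union of the empty chain, which contains nothing; adjoining [R]
   inside the condition covers that case. *)
pose P (A : set M) := subring (fun w => A w \/ R w) /\ ~ A z.
have [A [[sA nAz] maxA]] : exists A, P A /\ forall B, (A `<` B)%classic -> ~ P B.
  apply: Zorn_bigcup => G GP tot.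
  pose U w := (\bigcup_(X in G) X)%classic w \/ R w.
  have pair x y : U x -> U y -> (R x /\ R y) \/ exists X, [/\ G X, X x \/ R x & X y \/ R y].
    move=> [[X GX Xx]|Rx] [[Y GY Yy]|Ry]; last by left.
    - right; case: (tot X Y GX GY) => h.
        by exists Y; split=> //; left=> //; apply: h.
      by exists X; split=> //; left=> //; apply: h.
    - by right; exists X; split; auto.
    - by right; exists Y; split; auto.
  split; last by move=> [X GX Xz]; case: (GP _ GX).
  split; first by right; apply: subring1.
  split=> x y Ux Uy; case: (pair x y Ux Uy) => [[Rx Ry]|[X [GX Xx Xy]]].
  - by right; apply: subringB.
  - case: (GP _ GX) => sX _; case: (subringB sX Xx Xy); last by right.
    by left; exists X.
  - by right; apply: subringM.
  - case: (GP _ GX) => sX _; case: (subringM sX Xx Xy); last by right.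
    by left; exists X.
exists (fun w => A w \/ R w); split; last by case.
- apply: (@max_subring_valuation _ _ z) => //; [by right | by case | ].
  move=> B sB VB nBz w Bw; apply: contrapT => /not_orP[nAw nRw].
  apply: (maxA B); first by split; [move=> t At; apply: VB; left | move=> h; apply/nAw/h].
  split=> //; suff -> : (fun w => B w \/ R w) = B by [].
  apply/funext => t; apply/propext; split; [case=> // Rt; apply: VB|]; auto.
- by right.
Qed.

(** Valuation rings are integrally closed: if [x] is outside [V], its inverse is inside, and the
    equation divided by a power of [x] writes [x] as a polynomial in that inverse. *)
Lemma valuation_root (M : fieldType) (V : M -> Prop) (p : {poly M}) x :
  valuation_ring V -> p \is monic -> (forall i, V p`_i) -> root p x -> V x.
Proof.
move=> vV mp Vp /rootP px; have sV := valuation_subring vV.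
case: (valuation_cases x vV) => // -[nx Vi].
have sp : size p = (size p).-1.+1 by rewrite prednK // size_poly_gt0 monic_neq0.
move: px; rewrite horner_coef sp big_ord_recr /= -lead_coefE (monicP mp) mul1r.
set n := (size p).-1; case En: n => [|m].
  by rewrite big_ord0 add0r expr0 => /eqP; rewrite oner_eq0.
move=> /eqP; rewrite addrC addr_eq0 => /eqP e.
have -> : x = - \sum_(i < m.+1) p`_i * x^-1 ^+ (m - i).
  apply: (mulIf (expf_neq0 m nx)); rewrite -exprS e mulNr mulr_suml; congr (- _).
  apply: eq_bigr => i _; rewrite -mulrA; congr (_ * _).
  by rewrite exprV_mul ?leq_subr // subKn // -ltnS.
apply: subringN => //; apply: subring_sum => // i _; apply: subringM => //.
exact: subringX.
Qed.

(** If [f] belonged to R[1/f], multiplying the expression by a power of [f] would give an integral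
    equation. So [f] is outside R[1/f], and some valuation ring above it omits [f]. *)
Lemma integral_closure_valuation (M : fieldType) (R : M -> Prop) (f : M) :
  subring R -> f != 0 ->
  (forall p : {poly M}, p \is monic -> (forall i, R p`_i) -> ~ root p f) ->
  exists V, [/\ valuation_ring V, forall w, R w -> V w & ~ V f].
Proof.
move=> sR nf nint.
have sA := subring_adjoin sR f^-1.
have [||V [vV sub nV]] := exists_valuation_omitting (z := f) sA.
- exact: subring_adjoin_gen.
- move=> [p Rp ef].
  pose n := size p; pose q := 'X^(n.+1) - \poly_(i < n.+1) p`_(n - i).
  apply: (nint q).
  + by rewrite monicE lead_coefDl ?lead_coefXn // size_polyXn size_polyN ltnS size_poly.
  + move=> i; rewrite coefB coefXn coef_poly; apply: subringB => //.
      by case: (i == _); [apply: subring1 | apply: subring0].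
    by case: ifP => // _; apply: subring0.
  + rewrite rootE hornerD hornerN hornerXn horner_poly subr_eq0 {1}exprS {1}ef.
    rewrite (@horner_coef_wide _ n.+1) ?leqnSn // mulr_suml.
    rewrite [X in _ == X](reindex_inj rev_ord_inj) /=; apply/eqP/eq_bigr => i _.
    have im : (i <= n)%N by rewrite -ltnS.
    by rewrite subSS subKn // -mulrA exprV_mul.
exists V; split=> // w Rw; apply: sub.
exact: subring_adjoin_base.
Qed.

(** * Norms and valuation rings *)

Section GaussValuation.
Variables (E : fieldType) (V : E -> Prop).
Hypothesis vV : valuation_ring V.
Let sV := valuation_subring vV.

(** The maximal ideal of [V]. Membership in [V] need not be required: a nonzero element whose
    inverse is outside [V] lies in [V]. *)
Let nonunit w := w = 0 \/ ~ V w^-1.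

Let nonunitM a w : V a -> nonunit w -> nonunit (a * w).
Proof.
move=> Va uw; have [->|n0] := eqVneq (a * w) 0; first by left.
have /andP[na nw] : (a != 0) && (w != 0) by rewrite -negb_or -mulf_eq0.
right => Vi; case: uw => [w0|]; first by rewrite w0 eqxx in nw.
apply; have -> : w^-1 = a * (a * w)^-1 by rewrite invfM mulrA divff // mul1r.
exact: subringM.
Qed.

Let nonunitD v w : nonunit v -> nonunit w -> nonunit (v + w).
Proof.
have half a b : b != 0 -> nonunit b -> V (a / b) -> nonunit (a + b).
  move=> nb ub Vab; have -> : a + b = (a / b + 1) * b by rewrite mulrDl divfK // mul1r.
  by apply: nonunitM => //; apply: subringD => //; apply: subring1.
have [->|nv] := eqVneq v 0; first by rewrite add0r.
have [->|nw] := eqVneq w 0; first by rewrite addr0.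
move=> uv uw; case: (valuation_cases (v / w) vV) => [h|[_ h]]; first exact: half.
by rewrite addrC; apply: half => //; move: h; rewrite invf_div.
Qed.

(** A term of least value. Terms are compared through their quotients, since [V] comes without a
    value group. *)
Let dominant n (p : nat -> E) : (exists2 j, (j < n)%N & p j != 0) ->
  exists i, [/\ (i < n)%N, p i != 0 & forall j, (j < n)%N -> V (p j / p i)].
Proof.
elim: n => [|n IH] [j //]; rewrite ltnS leq_eqVlt => jn pj.
case: (pselect (exists2 j, (j < n)%N & p j != 0)) => [/IH [i [ni pi h]]|none].
  case: (valuation_cases (p n / p i) vV) => [Vn|[nz Vn]].
    exists i; split=> // [|l]; first exact: ltnW.
    by rewrite ltnS leq_eqVlt => /orP[/eqP ->|]; auto.
  move: Vn; rewrite invf_div => Vn.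
  have pn : p n != 0 by move: nz; rewrite mulf_eq0 negb_or => /andP[].
  exists n; split=> // l; rewrite ltnS leq_eqVlt => /orP[/eqP ->|ln].
    by rewrite divff //; apply: subring1.
  have -> : p l / p n = (p l / p i) * (p i / p n) by rewrite mulrA divfK.
  by apply: subringM => //; apply: h.
have zero l : (l < n)%N -> p l = 0.
  by move=> ln; apply/eqP; apply: contrapT => /negP pl; apply: none; exists l.
have jE : j = n.
  by case/orP: jn => [/eqP //|jn]; rewrite zero ?eqxx in pj.
exists n; split=> //; first by rewrite -jE.
move=> l; rewrite ltnS leq_eqVlt => /orP[/eqP ->|ln].
  by rewrite -{1}jE -jE divff //; apply: subring1.
by rewrite zero // mul0r; apply: subring0.
Qed.

Let first_dominant (p : {poly E}) : p != 0 ->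
  exists i, [/\ p`_i != 0, forall j, V (p`_j / p`_i)
                & forall j, (j < i)%N -> nonunit (p`_j / p`_i)].
Proof.
move=> np; pose P i := p`_i != 0 /\ forall j, V (p`_j / p`_i).
have [i Pi] : exists i, P i.
  have [|i [ni pi h]] := @dominant (size p) (fun i => p`_i).
    by exists (size p).-1; rewrite ?lead_coef_eq0 // prednK // size_poly_gt0.
  exists i; split=> // j; case: (ltnP j (size p)) => [/h //|sj].
  by rewrite nth_default // mul0r; apply: subring0.
have exP : exists i, `[< P i >] by exists i; apply/asboolP.
have [i0 /asboolP [p0 h0] m] := ex_minnP exP.
exists i0; split=> // j ji.
have [->|pj] := eqVneq p`_j 0; first by left; rewrite mul0r.
right; rewrite invf_div => Vj.
have : (i0 <= j)%N.
  apply: m; apply/asboolP; split=> // l.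
  have -> : p`_l / p`_j = (p`_l / p`_i0) * (p`_i0 / p`_j) by rewrite mulrA divfK.
  exact: subringM.
by rewrite leqNgt ji.
Qed.

(** Gauss's lemma over an arbitrary valuation ring. With i and j the first indices of coefficients
    of least value, the coefficient of the product at i + j is p_i q_j up to a unit, the other terms
    being smaller. As [q] is monic, 1/q_j lies in [V], hence so does p_i, and with it every
    coefficient of [p]. *)
Lemma valuation_gauss (p q : {poly E}) : p \is monic -> q \is monic ->
  (forall i, V (p * q)`_i) -> forall i, V p`_i.
Proof.
move=> mp mq Vpq.
have [i [pi hi hi']] := first_dominant (monic_neq0 mp).
have [j [qj hj hj']] := first_dominant (monic_neq0 mq).
have Vj : V (q`_j)^-1 by have := hj (size q).-1; rewrite -lead_coefE (monicP mq) mul1r.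
pose s := (p * q)`_(i + j)%N / (p`_i * q`_j).
have nus : ~ nonunit s.
  move=> us; have : nonunit 1.
    have -> : 1 = s + - \sum_(l < (i + j).+1 | l != i :> nat) (p`_l / p`_i) * (q`_(i + j - l)%N / q`_j).
      apply/eqP; rewrite eq_sym subr_eq; apply/eqP; rewrite /s coefM mulr_suml.
      have li : (i < (i + j).+1)%N by rewrite ltnS leq_addr.
      rewrite (bigD1 (Ordinal li)) //= addKn divff ?mulf_neq0 //; congr (_ + _).
      by apply: eq_bigr => l _; rewrite mulf_div.
    apply: nonunitD => //; rewrite -mulN1r; apply: nonunitM.
      by apply: subringN => //; apply: subring1.
    apply: (big_ind nonunit) => [||l nl]; [by left | exact: nonunitD | ].
    case: (ltngtP l i) => [li|il|e]; last by rewrite e eqxx in nl.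
      by rewrite mulrC; apply: nonunitM; [apply: hj | apply: hi'].
    apply: nonunitM => //; apply: hj'.
    by rewrite ltn_subLR ?ltn_add2r // -ltnS.
  case=> [/eqP|]; first by rewrite oner_eq0.
  by apply; rewrite invr1; apply: subring1.
have ns : s != 0 by apply/eqP => s0; apply: nus; left.
have Vs : V s^-1 by apply: contrapT => h; apply: nus; right.
have npq : (p * q)`_(i + j)%N != 0 by move: ns; rewrite mulf_eq0 negb_or => /andP[].
have Vi : V p`_i.
  have -> : p`_i = (p * q)`_(i + j)%N * s^-1 * (q`_j)^-1.
    by rewrite /s invf_div mulrA [_ * (p`_i * _)]mulrC mulfK // mulfK.
  by apply: subringM => //; apply: subringM.
by move=> l; have := subringM sV (hi l) Vi; rewrite divfK.
Qed.

(** Division by a monic polynomial stays in [V]: the leading coefficient of the quotient is that of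
    the product, and subtracting its term lowers the degree. *)
Lemma valuation_monic_quotient (p q : {poly E}) : p \is monic ->
  (forall i, V p`_i) -> (forall i, V (q * p)`_i) -> forall i, V q`_i.
Proof.
move=> mp Vp; have [n] := ubnP (size q); elim: n q => // n IH q sq Vqp.
have [->|nq] := eqVneq q 0; first by move=> i; rewrite coef0; apply: subring0.
have Vl : V (lead_coef q) by rewrite -(lead_coef_Mmonic q mp) lead_coefE; apply: Vqp.
pose m := (size q).-1; pose r := q - lead_coef q *: 'X^m.
have Vr : forall i, V r`_i.
  apply: IH.
    rewrite -ltnS (leq_trans _ sq) // ltnS /r.
    have sz : size q = m.+1 by rewrite prednK // size_poly_gt0.
    rewrite sz; apply/leq_sizeP => l; rewrite leq_eqVlt => /orP[/eqP <-|ml].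
      by rewrite coefB coefZ coefXn eqxx mulr1 subrr.
    by rewrite coefB coefZ coefXn gtn_eqF // mulr0 subr0 nth_default // sz.
  move=> i; rewrite /r mulrBl coefB; apply: subringB => //.
  rewrite -scalerAl coefZ; apply: subringM => //; rewrite coefXnM.
  by case: ifP => // _; apply: subring0.
move=> i; rewrite -(subrK (lead_coef q *: 'X^m) q) coefD; apply: subringD => //.
rewrite coefZ coefXn; apply: subringM => //.
by case: (i == m); [apply: subring1 | apply: subring0].
Qed.

End GaussValuation.

Lemma map_poly_poly (R S : nzRingType) (f : {rmorphism R -> S}) n (e : nat -> R) :
  map_poly f (\poly_(i < n) e i) = \poly_(i < n) f (e i).
Proof.
by apply/polyP => i; rewrite coef_map /= !coef_poly; case: (i < n)%N => //; rewrite rmorph0.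
Qed.

Section MinimalPolynomial.
Variables (E M : fieldType) (Theta : {rmorphism E -> M}).

Definition integral_for (V : E -> Prop) (h : M) : Prop :=
  exists p : {poly E}, [/\ p \is monic, forall i, V p`_i & root (map_poly Theta p) h].

(** Integrality of [h] puts its minimal polynomial [mu] in V[X] by Gauss's lemma. Integrality of 1/h
    gives a multiple of [mu] in V[X] with constant coefficient 1, so the constant coefficient of
    [mu] divides 1 in [V]. *)
Lemma minpoly_constant_unit (V : E -> Prop) (mu : {poly E}) (h : M) :
  valuation_ring V -> h != 0 -> mu \is monic -> root (map_poly Theta mu) h ->
  (forall r, root (map_poly Theta r) h -> (size r < size mu)%N -> r = 0) ->
  integral_for V h -> integral_for V h^-1 -> V mu`_0 /\ V (mu`_0)^-1.
Proof.
move=> vV nh mmu rmu minmu [p [mp Vp rp]] [p' [mp' Vp' rp']].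
have sV := valuation_subring vV.
have dvd r : root (map_poly Theta r) h -> exists q, r = q * mu.
  move=> rr; exists (r %/ mu); rewrite [LHS](divp_eq r mu).
  suff -> : r %% mu = 0 by rewrite addr0.
  apply: minmu; last by rewrite ltn_modp monic_neq0.
  move: rr; rewrite [X in map_poly _ X](divp_eq r mu) rmorphD rmorphM /= !rootE hornerD hornerM.
  by rewrite (rootP rmu) mulr0 add0r.
have [q eq] := dvd p rp.
have mq : q \is monic by move: mp; rewrite eq monicMr.
have Vmu : forall i, V mu`_i.
  apply: (valuation_gauss vV mmu mq) => i; by rewrite mulrC -eq.
split=> //.
have sp' : size p' = (size p').-1.+1 by rewrite prednK // size_poly_gt0 monic_neq0.
set n := (size p').-1 in sp'.
(* The reversed polynomial vanishes at [h], and its constant coefficient is 1 because [p'] is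
   monic. *)
pose r := \poly_(i < n.+1) p'`_(n - i).
have [|w ew] := dvd r.
  apply/eqP; apply: (mulfI (expf_neq0 n (invr_neq0 nh))); rewrite mulr0 -(rootP rp').
  rewrite map_poly_poly horner_poly mulr_sumr.
  rewrite horner_coef size_map_poly sp' (reindex_inj rev_ord_inj) /=; apply: eq_bigr => i _.
  have im : (i <= n)%N by rewrite -ltnS.
  rewrite coef_map subSS subKn // mulrCA; congr (_ * _).
  by rewrite -{1}(subnK im) exprD mulrAC -exprMn mulVf // expr1n mul1r.
have Vw : forall i, V w`_i.
  apply: (valuation_monic_quotient vV mmu Vmu) => i.
  by rewrite -ew coef_poly; case: ifP => // _; apply: subring0.
have : (w * mu)`_0 = 1 by rewrite -ew coef_poly subn0 /n -lead_coefE (monicP mp').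
rewrite coefM big_ord1 subn0 => e.
suff -> : (mu`_0)^-1 = w`_0 by [].
have nm : mu`_0 != 0 by apply/eqP => m0; move/eqP: e; rewrite m0 mulr0 eq_sym oner_eq0.
by apply: (mulIf nm); rewrite mulVf.
Qed.

(* c is, up to sign, the norm of f from E(f) to E; only its valuations matter *)
Lemma norm_like_constant (f : M) : f != 0 -> algebraicOver Theta f ->
  exists (c : E) (m : nat), [/\ (0 < m)%N, c != 0 &
    forall (V : E -> Prop) (g : E), valuation_ring V -> g != 0 ->
      integral_for V (f / Theta g) -> integral_for V (Theta g / f) ->
      V (c / g ^+ m) /\ V (g ^+ m / c)].
Proof.
move=> nf [p0 np0 rp0].
pose P n := exists2 p : {poly E}, p != 0 /\ size p = n & root (map_poly Theta p) f.
have exP : exists n, `[< P n >] by exists (size p0); apply/asboolP; exists p0.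
have [n /asboolP [mu0 [nmu0 smu0] rmu0] minn] := ex_minnP exP.
pose mu := (lead_coef mu0)^-1 *: mu0.
have nl : (lead_coef mu0)^-1 != 0 by rewrite invr_eq0 lead_coef_eq0.
have mmu : mu \is monic by rewrite monicE lead_coefZ mulVf // lead_coef_eq0.
have rmu : root (map_poly Theta mu) f.
  by rewrite map_polyZ rootZ // fmorph_eq0.
have smu : size mu = n by rewrite size_scale.
have min r : root (map_poly Theta r) f -> (size r < n)%N -> r = 0.
  move=> rr sr; apply/eqP; apply: contrapT => /negP nr.
  have : (n <= size r)%N by apply: minn; apply/asboolP; exists r.
  by rewrite leqNgt sr.
have n1 : (1 < n)%N.
  rewrite -smu ltnNge; apply/negP => /size1_polyC e; move: rmu (monic_neq0 mmu).
  by rewrite e map_polyC rootC fmorph_eq0 polyC_eq0 => ->.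
have [m em] : exists m, n = m.+2 by case: n n1 {smu0 minn smu min} => [|[|m]] // _; exists m.
have nc : mu`_0 != 0.
  apply/eqP => c0; have := min (\poly_(i < m.+1) mu`_i.+1).
  have emu : mu = (\poly_(i < m.+1) mu`_i.+1) * 'X.
    apply/polyP => -[|i]; rewrite coefMX /=; first by rewrite c0.
    by rewrite coef_poly; case: ltnP => // h; rewrite nth_default // smu em.
  have rr : root (map_poly Theta (\poly_(i < m.+1) mu`_i.+1)) f.
    by move: rmu; rewrite {1}emu rmorphM /= map_polyX rootM rootX (negPf nf) orbF.
  move=> /(_ rr); rewrite em ltnS (leq_trans (size_poly _ _)) // => /(_ isT) z.
  by move: (monic_neq0 mmu); rewrite emu z mul0r eqxx.
exists mu`_0, m.+1; split=> // V g vV ng int1 int2.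
have ntg : Theta g != 0 by rewrite fmorph_eq0.
(* The minimal polynomial of f / Theta g, obtained by rescaling the variable; its constant
   coefficient is that of [mu] divided by [g] to the degree of [mu]. *)
pose mug := \poly_(i < m.+2) (mu`_i / g ^+ (m.+1 - i)).
have lmug : mug`_m.+1 = 1.
  by rewrite coef_poly ltnSn subnn expr0 divr1 -[m.+1]/(m.+2.-1) -em -smu -lead_coefE (monicP mmu).
have smug : size mug = m.+2.
  by apply/eqP; rewrite size_poly_eq ?subnn //= expr0 divr1 -[m.+1]/(m.+2.-1) -em -smu -lead_coefE lead_coef_eq0 monic_neq0.
have := @minpoly_constant_unit V mug (f / Theta g) vV.
have -> : mug`_0 = mu`_0 / g ^+ m.+1 by rewrite coef_poly subn0.
rewrite !invf_div; apply=> //.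
- by rewrite mulf_neq0 // invr_eq0.
- by rewrite monicE lead_coefE smug lmug.
- apply/eqP; apply: (mulfI (expf_neq0 m.+1 ntg)); rewrite mulr0 -(rootP rmu).
  rewrite map_poly_poly horner_poly mulr_sumr horner_coef size_map_poly smu em.
  apply: eq_bigr => i _; rewrite coef_map /=.
  have im : (i <= m.+1)%N by rewrite -ltnS.
  rewrite rmorphM fmorphV rmorphXn /= exprMn exprVn -{1}(subnK im) exprD.
  have n1' : Theta g ^+ (m.+1 - i) != 0 by apply: expf_neq0.
  have n2' : Theta g ^+ i != 0 by apply: expf_neq0.
  by field; rewrite n1' n2'.
- move=> r rr; rewrite smug => sr.
  have e0 : \poly_(i < size r) (r`_i / g ^+ i) = 0.
    apply: min; last by rewrite em (leq_trans _ sr) // ltnS size_poly.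
    rewrite map_poly_poly rootE horner_poly.
    apply/eqP; rewrite -[RHS](rootP rr) horner_coef size_map_poly; apply: eq_bigr => i _.
    by rewrite coef_map /= rmorphM fmorphV rmorphXn /= exprMn exprVn mulrA mulrAC.
  apply/polyP => i; rewrite coef0; have := congr1 (fun p : {poly E} => p`_i) e0.
  rewrite coef_poly coef0; case: ltnP => [_|h _]; last by rewrite nth_default.
  by move=> /eqP; rewrite mulf_eq0 invr_eq0 expf_eq0 (negPf ng) andbF orbF => /eqP.
Qed.

End MinimalPolynomial.

(** * Unique factorization in k[x][y] *)

Definition divides (R : idomainType) (p a : R) : Prop := exists b, a = b * p.

Lemma divides_refl (R : idomainType) (p : R) : divides p p.
Proof. by exists 1; rewrite mul1r. Qed.
Lemma divides_mull (R : idomainType) (p a c : R) : divides p a -> divides p (c * a).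
Proof. by move=> [b ->]; exists (c * b); rewrite mulrA. Qed.
Lemma divides_mulr (R : idomainType) (p a c : R) : divides p a -> divides p (a * c).
Proof. by rewrite mulrC; apply: divides_mull. Qed.
Lemma dividesD (R : idomainType) (p a b : R) : divides p a -> divides p b -> divides p (a + b).
Proof. by move=> [c ->] [d ->]; exists (c + d); rewrite mulrDl. Qed.
Lemma dividesB (R : idomainType) (p a b : R) : divides p a -> divides p b -> divides p (a - b).
Proof. by move=> [c ->] [d ->]; exists (c - d); rewrite mulrBl. Qed.
Lemma divides_unitl (R : idomainType) (u p a : R) :
  u \is a GRing.unit -> divides (u * p) a <-> divides p a.
Proof.
move=> uu; split=> [[b ->]|[b ->]]; first by exists (b * u); rewrite mulrA.
by exists (b * u^-1); rewrite mulrA divrK.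
Qed.

Section BivariateFactorization.
Variable k : closedFieldType.
Local Notation A := {poly {poly k}}.
Implicit Types p q a b c : A.

Local Notation cst x := ((x%:P)%:P).

Lemma unit_bivariate a : reflect (exists2 c : k, c != 0 & a = cst c) (a \is a GRing.unit).
Proof.
apply: (iffP idP) => [|[c nc ->]]; last first.
  by rewrite poly_unitE coefC eqxx size_polyC polyC_eq0 nc poly_unitE coefC eqxx size_polyC nc unitfE.
rewrite poly_unitE => /andP[/size_poly1P [b nb ->]]; rewrite coefC eqxx poly_unitE.
by move=> /andP[/size_poly1P [c nc ->] _]; exists c.
Qed.

Lemma divides_linear (alpha : k) a :
  divides (('X - alpha%:P)%:P) a <-> map_poly (horner_eval alpha) a = 0.
Proof.
split=> [[b ->]|h].
  by rewrite rmorphM /= map_polyC /= /horner_eval hornerXsubC subrr mulr0.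
exists (map_poly (fun c : {poly k} => c %/ ('X - alpha%:P)) a).
apply/polyP => i; rewrite coefMC coef_map_id0 ?div0p //.
rewrite divpK // dvdp_XsubCl rootE.
by have := congr1 (fun b : {poly k} => b`_i) h; rewrite coef_map coef0 /= => e; apply/eqP.
Qed.

Lemma linear_prime (alpha : k) a b :
  divides (('X - alpha%:P)%:P) (a * b) ->
  divides (('X - alpha%:P)%:P) a \/ divides (('X - alpha%:P)%:P) b.
Proof.
move=> /divides_linear; rewrite rmorphM => /eqP; rewrite mulf_eq0.
by case/orP => /eqP h; [left | right]; apply/divides_linear.
Qed.

Lemma poly_closed_ind (P : {poly k} -> Prop) :
  (forall c : k, c != 0 -> P c%:P) ->
  (forall (alpha : k) s, s != 0 -> P s -> P (s * ('X - alpha%:P))) ->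
  forall s, s != 0 -> P s.
Proof.
move=> Pc Px s; have [n] := ubnP (size s); elim: n s => // n IH s sn ns.
have [/eqP/size_poly1P [c nc ->]|s1] := eqVneq (size s) 1%N; first exact: Pc.
have [alpha /factor_theorem [q eq]] := closed_rootP s s1.
have nq : q != 0 by apply: contra_neq ns => q0; rewrite eq q0 mul0r.
rewrite eq; apply: Px => //; apply: IH => //.
by move: sn; rewrite eq size_Mmonic ?monicXsubC // size_XsubC addn2.
Qed.

(** Over an algebraically closed field, a content is trivial exactly when no linear polynomial in
    the inner variable divides. *)
Definition primitive_in_y p := forall alpha : k, ~ divides (('X - alpha%:P)%:P) p.

(** A form of Gauss's lemma: the linear factors of [s] are prime and none divides [p], so each of
    them divides [b]. *)
Lemma primitive_cancel p (s : {poly k}) a b : s != 0 -> primitive_in_y p ->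
  s%:P * a = p * b -> divides s%:P b.
Proof.
move=> ns pp; elim/poly_closed_ind: s / ns a b => [c nc|alpha s ns IH] a b e.
  by exists (cst c^-1 * b); rewrite mulrAC -polyCM -polyCM mulVf // mul1r.
have [|/pp //|[d ed]] := @linear_prime alpha p b.
  by rewrite -e polyCM -mulrA mulrCA; apply: divides_mulr; apply: divides_refl.
have nx : ('X - alpha%:P)%:P != 0 :> A by rewrite polyC_eq0 polyXsubC_eq0.
have [|f ef] := IH a d.
  by apply: (mulfI nx); rewrite mulrA -polyCM mulrC [_ * s]mulrC [RHS]mulrCA [_ * d]mulrC -ed -e mulrC.
by exists f; rewrite ed ef -mulrA -polyCM.
Qed.

(** Each linear factor of [s] is prime, so it can be cancelled from one of the two factors on the
    right. *)
Lemma split_content (s : {poly k}) p c w : s != 0 -> s%:P * p = c * w ->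
  exists s1 s2 c1 w1, [/\ s2 != 0, c = s1%:P * c1, w = s2%:P * w1 & p = c1 * w1].
Proof.
move=> ns; elim/poly_closed_ind: s / ns c w => [x nx|alpha s ns IH] c w e.
  exists x%:P, 1, (cst x^-1 * c), w; split; rewrite ?oner_eq0 ?mul1r //.
    by rewrite mulrA -!polyCM mulfV // mul1r.
  by rewrite -mulrA -e mulrA -!polyCM mulVf // mul1r.
have nx : ('X - alpha%:P)%:P != 0 :> A by rewrite polyC_eq0 polyXsubC_eq0.
have [|[d ed]|[d ed]] := @linear_prime alpha c w.
- by rewrite -e polyCM -mulrA mulrCA; apply: divides_mulr; apply: divides_refl.
- have [|s1 [s2 [c1 [w1 [n2 e1 e2 e3]]]]] := IH d w.
    by apply: (mulfI nx); rewrite mulrA [_ * s%:P]mulrC -polyCM e ed mulrAC mulrC.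
  exists (s1 * ('X - alpha%:P)), s2, c1, w1; split=> //.
  by rewrite ed e1 polyCM mulrAC.
- have [|s1 [s2 [c1 [w1 [n2 e1 e2 e3]]]]] := IH c d.
    by apply: (mulfI nx); rewrite mulrA [_ * s%:P]mulrC -polyCM e ed mulrA mulrC.
  exists s1, (s2 * ('X - alpha%:P)), c1, w1; split=> //.
    by rewrite mulf_neq0 // polyXsubC_eq0.
  by rewrite ed e2 polyCM mulrAC.
Qed.

Lemma linear_nonunit (alpha : k) : (('X - alpha%:P)%:P : A) \isn't a GRing.unit.
Proof.
apply/negP => /unit_bivariate [c nc /polyC_inj e].
by have := size_XsubC alpha; rewrite e size_polyC nc.
Qed.

(** A nonconstant irreducible in the outer variable is primitive, and Bezout over k(x) applies: a
    least combination [w] of [p] and [a] divides both up to factors in k[x]. Either it is [p] up to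
    such factors, and then [p] divides [a], or it reduces to an element of k[x], and multiplying the
    Bezout identity by [b] shows that [p] divides [b]. *)
Lemma irreducible_prime p a b : ring_irreducible p -> divides p (a * b) ->
  divides p a \/ divides p b.
Proof.
move=> [np [nu irr]] dab.
case: (leqP (size p) 1) => sp.
  have [q eq] : exists q : {poly k}, p = q%:P by exists p`_0; apply: size1_polyC.
  have s1 : size q != 1%N.
    apply: contraNN nu => /size_poly1P [c nc e]; apply/unit_bivariate; exists c => //.
    by rewrite eq e.
  have [alpha /factor_theorem [r er]] := closed_rootP q s1.
  have ep : p = r%:P * ('X - alpha%:P)%:P by rewrite eq er polyCM.
  have ur : r%:P \is a GRing.unit by case: (irr _ _ ep) => // h; move: (linear_nonunit alpha); rewrite h.
  have [|h|h] := @linear_prime alpha a b.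
  - by rewrite -(divides_unitl _ _ ur) -ep.
  - by left; rewrite ep divides_unitl.
  - by right; rewrite ep divides_unitl.
have pp : primitive_in_y p.
  move=> alpha [c ec]; case: (irr _ _ ec) => [/unit_bivariate [x nx e]|h].
    by move: sp; rewrite ec e -polyCM size_polyC; case: (_ != 0).
  by move: (linear_nonunit alpha); rewrite h.
(* The minimum selects a greatest common divisor over k(x), without introducing denominators. *)
pose P n := exists u v, u * p + v * a != 0 /\ size (u * p + v * a) = n.
have exP : exists n, `[< P n >].
  by exists (size p); apply/asboolP; exists 1, 0; rewrite mul1r mul0r addr0.
have [n /asboolP [u [v [nw sw]]] minn] := ex_minnP exP.
set w := u * p + v * a in nw sw.
have red r : (exists u v, r = u * p + v * a) ->
    exists (s : {poly k}) c, s != 0 /\ s%:P * r = c * w.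
  move=> [u1 [v1 er]].
  exists (lead_coef w ^+ scalp r w), (r %/ w); split.
    by rewrite expf_neq0 // lead_coef_eq0.
  rewrite mul_polyC Pdiv.Idomain.divp_eq.
  suff -> : r %% w = 0 by rewrite addr0.
  apply/eqP; apply: contrapT => /negP nr.
  have : (n <= size (r %% w)%R)%N.
    apply: minn; apply/asboolP.
    exists ((lead_coef w ^+ scalp r w)%:P * u1 - r %/ w * u), ((lead_coef w ^+ scalp r w)%:P * v1 - r %/ w * v).
    suff <- : r %% w = ((lead_coef w ^+ scalp r w)%:P * u1 - r %/ w * u) * p +
       ((lead_coef w ^+ scalp r w)%:P * v1 - r %/ w * v) * a by [].
    have := Pdiv.Idomain.divp_eq r w; rewrite -mul_polyC => /eqP.
    rewrite addrC -subr_eq => /eqP <-; rewrite er.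
    move: ((_ ^+ _)%:P) (_ %/ _) => x y; rewrite /w; ring.
  by rewrite leqNgt -sw Pdiv.Idomain.ltn_modp nw.
have [|s [c [ns ec]]] := red p; first by exists 1, 0; rewrite mul1r mul0r addr0.
have [s1 [s2 [c1 [w1 [n2 e1 e2 e3]]]]] := split_content ns ec.
case: (irr _ _ e3) => [u1|u1].
- left; have [|s' [c' [ns' ec']]] := red a; first by exists 0, 1; rewrite mul1r mul0r add0r.
  have ep : w1 = c1^-1 * p by rewrite e3 mulKr.
  have [|f ef] := @primitive_cancel p s' a (c' * s2%:P * c1^-1) ns' pp.
    by rewrite ec' e2 ep; ring.
  have ns'P : s'%:P != 0 :> A by rewrite polyC_eq0.
  exists f; apply: (mulfI ns'P); rewrite ec' e2 ep.
  by rewrite !mulrA ef; ring.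
- right; case: dab => d ed.
  have [|f ef] := @primitive_cancel p s2 (w1 * b) (u * b + v * d) n2 pp.
    rewrite mulrA -e2 /w mulrDl -[v * a * b]mulrA ed; ring.
  have n2P : s2%:P != 0 :> A by rewrite polyC_eq0.
  exists (w1^-1 * f); rewrite -mulrA -[LHS](mulKr u1); congr (_ * _).
  apply: (mulfI n2P); transitivity (p * (u * b + v * d)); last by rewrite ef; ring.
  rewrite mulrA -e2 /w mulrDl -[v * a * b]mulrA ed; ring.
Qed.

End BivariateFactorization.

Section BivariateFactorization.
Variable k : closedFieldType.
Local Notation A := {poly {poly k}}.
Implicit Types p q a b : A.
Local Notation cst x := ((x%:P)%:P).

(** For a nonzero polynomial this is the sum of the two partial degrees plus 2, one for each [size];
    units are thus the elements of value 2. *)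
Definition deg2 a := (size a + size (swapXY a))%N.

Lemma deg2_mul a b : a != 0 -> b != 0 -> (deg2 (a * b)).+2 = (deg2 a + deg2 b)%N.
Proof.
move=> na nb; have na' : swapXY a != 0 by rewrite swapXY_eq0.
have nb' : swapXY b != 0 by rewrite swapXY_eq0.
rewrite /deg2 rmorphM /= !size_mul //.
move: na nb na' nb'; rewrite -!size_poly_gt0.
move: (size a) (size b) (size (swapXY a)) (size (swapXY b)) => x y z t; lia.
Qed.

Lemma deg2_unit a : a != 0 -> (deg2 a <= 2)%N -> a \is a GRing.unit.
Proof.
move=> na; have na' : swapXY a != 0 by rewrite swapXY_eq0.
move: (na) (na'); rewrite -!size_poly_gt0 /deg2 => h1 h2 le.
have s1 : size a = 1%N.
  by apply/eqP; rewrite eqn_leq h1 andbT -(leq_add2r 1) (leq_trans _ le) // leq_add2l.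
have s2 : (size (swapXY a) <= 1)%N by move: le; rewrite s1.
have [c ec] : exists c : {poly k}, a = c%:P by exists a`_0; apply: size1_polyC; rewrite s1.
move: s2; rewrite ec swapXY_polyC size_map_inj_poly //; last exact: polyC_inj.
move=> /size1_polyC ec'; apply/unit_bivariate; exists c`_0; last by rewrite -ec'.
by move: na; rewrite ec polyC_eq0 {1}ec' polyC_eq0.
Qed.

Lemma deg2_proper a b : a * b != 0 -> b \isn't a GRing.unit -> (deg2 a < deg2 (a * b))%N.
Proof.
rewrite mulf_eq0 negb_or => /andP[na nb] nu.
have h : (2 < deg2 b)%N by rewrite ltnNge; apply: contraNN nu; apply: deg2_unit.
by rewrite -(ltn_add2r 2) [X in (_ < X)%N]addn2 deg2_mul // ltn_add2l.
Qed.

Lemma exists_irreducible_factor a : a != 0 -> a \isn't a GRing.unit ->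
  exists2 p, ring_irreducible p & divides p a.
Proof.
have [n] := ubnP (deg2 a); elim: n a => // n IH a sn na nu.
case: (pselect (ring_irreducible a)) => [irr|nirr].
  by exists a => //; apply: divides_refl.
have [b [c [e nb nc]]] : exists b c, [/\ a = b * c, b \isn't a GRing.unit & c \isn't a GRing.unit].
  apply: contrapT => h; apply: nirr; split=> //; split=> // b c e.
  by case: (boolP (b \is a GRing.unit)) => ub; [left | right; apply: contrapT => /negP uc; apply: h; exists b, c].
have nbc : b != 0 by apply: contra_neq na => b0; rewrite e b0 mul0r.
have [|p ip d] := IH b _ nbc nb; first by rewrite -ltnS (leq_trans _ sn) // ltnS e deg2_proper -?e.
by exists p => //; rewrite e; apply: divides_mulr.
Qed.

Definition lead2 a : k := lead_coef (lead_coef a).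

Lemma lead2M a b : lead2 (a * b) = lead2 a * lead2 b.
Proof. by rewrite /lead2 !lead_coefM. Qed.
Lemma lead2_eq0 a : (lead2 a == 0) = (a == 0).
Proof. by rewrite /lead2 !lead_coef_eq0. Qed.
Lemma lead2_cst (c : k) : lead2 (cst c) = c.
Proof. by rewrite /lead2 !lead_coefC. Qed.

(** The condition on [lead2] selects one element in each class of associates, so that prime factors
    can be compared by equality and collected in lists. *)
Definition normal_irreducible p : Prop := ring_irreducible p /\ lead2 p = 1.

Lemma irreducible_unitl u p : u \is a GRing.unit -> ring_irreducible p -> ring_irreducible (u * p).
Proof.
move=> uu [np [nu irr]]; split; last split.
- by rewrite mulf_neq0 //; apply: contraTneq uu => ->; rewrite unitr0.
- by rewrite unitrMr.
- move=> b c e; have e' : p = (u^-1 * b) * c by rewrite -mulrA -e mulKr.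
  by case: (irr _ _ e') => h; [left | right] => //; move: h; rewrite unitrMr // unitrV.
Qed.

Lemma normalize_irreducible p : ring_irreducible p ->
  exists2 c : k, c != 0 & normal_irreducible (cst c * p).
Proof.
move=> ip; have np : lead2 p != 0 by rewrite lead2_eq0; case: ip.
exists (lead2 p)^-1; rewrite ?invr_eq0 //; split.
  by apply: irreducible_unitl => //; apply/unit_bivariate; exists (lead2 p)^-1; rewrite ?invr_eq0.
by rewrite lead2M lead2_cst mulVf.
Qed.

Lemma normal_irreducible_divides p q : normal_irreducible p -> normal_irreducible q ->
  divides p q -> p = q.
Proof.
move=> [[np [nu irr]] lp] [[nq [nuq irrq]] lq] [b e].
case: (irrq _ _ e) => [/unit_bivariate [c nc eb]|up]; last by rewrite up in nu.
have := lq; rewrite e eb lead2M lead2_cst lp mulr1 => ->.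
by rewrite mul1r.
Qed.

Definition is_factorization a (c : k) (ps : seq A) : Prop :=
  [/\ c != 0, forall p, p \in ps -> normal_irreducible p & a = cst c * \prod_(p <- ps) p].

Lemma factorization_exists a : a != 0 -> exists c ps, is_factorization a c ps.
Proof.
have [n] := ubnP (deg2 a); elim: n a => // n IH a sn na.
case: (boolP (a \is a GRing.unit)) => [/unit_bivariate [c nc ->]|nu].
  by exists c, [::]; split=> //; rewrite big_nil mulr1.
have [p0 ip0 dp0] := exists_irreducible_factor na nu.
have [c nc np] := normalize_irreducible ip0.
have [b eb] : divides (cst c * p0) a.
  by rewrite divides_unitl //; apply/unit_bivariate; exists c.
have nb : b != 0 by apply: contra_neq na => b0; rewrite eb b0 mul0r.
have [|d [ps [nd hps ed]]] := IH b _ nb.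
  rewrite -ltnS (leq_trans _ sn) // ltnS eb deg2_proper -?eb //.
  by case: np => [[_ []]].
exists d, (cst c * p0 :: ps); split=> // [p|].
  by rewrite inE => /orP[/eqP ->|]; auto.
by rewrite big_cons eb ed -mulrA; congr (_ * _); rewrite mulrC.
Qed.

Lemma normal_prime p a b : normal_irreducible p -> divides p (a * b) -> divides p a \/ divides p b.
Proof. by case=> ip _; apply: irreducible_prime. Qed.

Lemma normal_not_unit p (c : k) : normal_irreducible p -> c != 0 -> ~ divides p (cst c).
Proof.
move=> [[_ [nu _]] _] nc [b e]; move/negP: nu; apply.
have : (cst c : A) \is a GRing.unit by apply/unit_bivariate; exists c.
by rewrite e unitrM => /andP[].
Qed.

Lemma normal_divides_prod p (ps : seq A) : normal_irreducible p ->
  (forall q, q \in ps -> normal_irreducible q) -> divides p (\prod_(q <- ps) q) -> p \in ps.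
Proof.
move=> ip; elim: ps => [|q ps IH] hps.
  by rewrite big_nil => h; case: (normal_not_unit ip (oner_neq0 k)); rewrite !polyC1.
rewrite big_cons => /(normal_prime ip) [h|h].
  by rewrite (normal_irreducible_divides ip (hps _ (mem_head _ _)) h) mem_head.
by rewrite inE IH ?orbT // => r rps; apply: hps; rewrite inE rps orbT.
Qed.

Lemma factorization_divides p a (c : k) ps : normal_irreducible p -> is_factorization a c ps ->
  divides p a <-> p \in ps.
Proof.
move=> ip [nc hps ->]; split=> [/(normal_prime ip) [/normal_not_unit //|]|pin].
  by move/(_ ip nc).
  exact: normal_divides_prod.
by apply: divides_mull; rewrite (big_rem p) //=; apply: divides_mulr; apply: divides_refl.
Qed.

Lemma factorization_unique a c d ps qs :
  is_factorization a c ps -> is_factorization a d qs -> perm_eq ps qs.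
Proof.
elim: ps a c d qs => [|p ps IH] a c d qs fp fq.
  case: qs fq => // q qs fq; case: (fq) => nd hqs e.
  have iq := hqs q (mem_head _ _).
  have : divides q a by apply/(factorization_divides iq fq); rewrite mem_head.
  by move/(factorization_divides iq fp).
case: (fp) => nc hps e; have ip := hps p (mem_head _ _).
have pq : p \in qs.
  by apply/(factorization_divides ip fq)/(factorization_divides ip fp); rewrite mem_head.
rewrite perm_sym (perm_trans (perm_to_rem pq)) // perm_cons perm_sym.
have np : p != 0 by case: ip => [[]].
apply: (IH (cst c * \prod_(r <- ps) r) c d); first by split=> // r h; apply: hps; rewrite inE h orbT.
case: fq => nd hqs e'; split=> // [r /mem_rem /hqs //|].
apply: (mulfI np); move: e; rewrite big_cons [RHS]mulrCA => <-.
by rewrite e' (big_rem p) //=; exact: mulrCA.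
Qed.

Definition factors a : seq A := xget [::] [set ps : seq A | exists c, is_factorization a c ps]%classic.

Lemma factorsP a : a != 0 -> exists c, is_factorization a c (factors a).
Proof.
move=> na; have [c [ps h]] := factorization_exists na.
by apply: (xgetPex (P := [set ps | exists c, is_factorization a c ps]%classic) [::]); exists ps, c.
Qed.

Lemma mem_factors p a : normal_irreducible p -> a != 0 -> p \in factors a <-> divides p a.
Proof.
move=> ip na; have [c fa] := factorsP na.
by rewrite (factorization_divides ip fa).
Qed.

Lemma factors_normal p a : a != 0 -> p \in factors a -> normal_irreducible p.
Proof. by move=> na; have [c [_ h _]] := factorsP na; apply: h. Qed.

Definition ordA p a : nat := count_mem p (factors a).

Lemma ordA_mul p a b : a != 0 -> b != 0 -> ordA p (a * b) = (ordA p a + ordA p b)%N.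
Proof.
move=> na nb; have [c fa] := factorsP na; have [d fb] := factorsP nb.
have [e fab] := factorsP (mulf_neq0 na nb).
have f' : is_factorization (a * b) (c * d) (factors a ++ factors b).
  case: fa fb => nc ha ea [nd hb eb]; split; first exact: mulf_neq0.
    by move=> q; rewrite mem_cat => /orP[/ha|/hb].
  by rewrite big_cat /= {1}ea {1}eb !polyCM mulrACA.
by rewrite /ordA (permP (factorization_unique fab f')) count_cat.
Qed.

Lemma ordA_gt0 p a : normal_irreducible p -> a != 0 -> (0 < ordA p a)%N <-> divides p a.
Proof. by move=> ip na; rewrite -mem_factors // -has_count has_pred1. Qed.

Lemma ordA_cst p (c : k) : c != 0 -> normal_irreducible p -> ordA p (cst c) = 0%N.
Proof.
move=> nc ip; apply/eqP; rewrite -leqn0 leqNgt; apply/negP.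
by rewrite ordA_gt0 ?polyC_eq0 //; apply: normal_not_unit.
Qed.

Lemma ordA_normal p q : normal_irreducible p -> normal_irreducible q -> ordA p q = (p == q).
Proof.
move=> ip iq; have nq : q != 0 by case: iq => [[]].
have [c fq] := factorsP nq.
have f' : is_factorization q 1 [:: q].
  by split; rewrite ?oner_eq0 ?big_seq1 ?polyC1 ?mul1r // => r; rewrite inE => /eqP ->.
by rewrite /ordA (permP (factorization_unique fq f')) /= addn0 eq_sym.
Qed.

Lemma ordA_divides p a n : normal_irreducible p -> a != 0 -> (n <= ordA p a)%N <-> divides (p ^+ n) a.
Proof.
move=> ip na; elim: n a na => [|n IH] a na.
  by rewrite expr0; split=> // _; exists a; rewrite mulr1.
have np : p != 0 by case: ip => [[]].
split=> [h|[b e]].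
  have [b eb] : divides p a by apply/ordA_gt0 => //; apply: leq_ltn_trans h.
  have nb : b != 0 by apply: contra_neq na => b0; rewrite eb b0 mul0r.
  move: h; rewrite eb ordA_mul // (ordA_normal ip ip) eqxx addn1 ltnS => /(IH _ nb) [d ->].
  by exists d; rewrite exprSr mulrA.
have nb : b * p ^+ n != 0 by apply: contra_neq na => b0; rewrite e exprSr mulrA b0 mul0r.
by rewrite e exprSr mulrA ordA_mul // (ordA_normal ip ip) eqxx addn1 ltnS; apply/IH => //; exists b.
Qed.

Lemma ordA_add p a b : normal_irreducible p -> a != 0 -> b != 0 -> a + b != 0 ->
  (minn (ordA p a) (ordA p b) <= ordA p (a + b))%N.
Proof.
move=> ip na nb nab; apply/ordA_divides => //.
by apply: dividesD; apply/ordA_divides => //; [apply: geq_minl | apply: geq_minr].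
Qed.

End BivariateFactorization.

Lemma card_upto_map (I : eqType) (T : Type) (eqv : T -> T -> Prop) (X : T -> Prop)
    (s : seq I) (f : I -> T) :
  uniq s -> (forall i, i \in s -> X (f i)) ->
  (forall i j, i \in s -> j \in s -> eqv (f i) (f j) -> i = j) ->
  (forall x, X x -> exists2 i, i \in s & eqv x (f i)) ->
  card_upto eqv X (size s).
Proof.
move=> us hX inj cov; exists (map f s).
have inE' t x : List.In x (map f t) <-> exists2 i, i \in t & x = f i.
  elim: t x => [|j t IH] x /=; first by split=> // -[].
  split=> [[<-|/IH [i it ->]]|[i]].
  - by exists j; rewrite ?mem_head.
  - by exists i; rewrite // inE it orbT.
  - rewrite inE => /orP[/eqP ->|it ->]; first by left.
    by right; apply/IH; exists i.
split; first by rewrite -(size_map f s); elim: (map f s) => //= y t ->.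
split; first by move=> x /inE' [i si ->]; apply: hX.
split; last by move=> x /cov [i si e]; exists (f i) => //; apply/inE'; exists i.
suff gen t : uniq t -> {subset t <= s} ->
    List.ForallOrdPairs (fun x y => ~ eqv x y) (map f t) by apply: gen.
elim: t => [|i t IH] /=; first by constructor.
move=> /andP[nit ut] sub; constructor; last first.
  by apply: IH => // j jt; apply: sub; rewrite inE jt orbT.
apply/List.Forall_forall => x /inE' [j jt ->] e.
move: nit; rewrite (inj i j) ?jt //; first by apply: sub; rewrite mem_head.
by apply: sub; rewrite inE jt orbT.
Qed.

(** * Irreducible components of plane curves *)

Section Components.
Variable k : closedFieldType.
Local Notation A := {poly {poly k}}.
Implicit Types p q g : A.

Lemma divides_prime_ideal p : normal_irreducible p -> prime_ideal (divides p).
Proof.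
move=> ip; split; first by exists 0; rewrite mul0r.
split; first exact: dividesD.
split; first by move=> a x; apply: divides_mull.
split; last by move=> x y; apply: normal_prime.
by have := normal_not_unit ip (oner_neq0 k); rewrite !polyC1.
Qed.

Definition generic_point p (ip : normal_irreducible p) : Spec A :=
  exist _ (divides p) (divides_prime_ideal ip).

(** The generic point of V(p) is dense in it, since every prime that contains [p] contains the
    multiples of [p]. *)
Lemma generic_point_sub p (ip : normal_irreducible p) (Z : Spec A -> Prop) :
  zclosed Z -> Z (generic_point ip) -> subset (zV p) Z.
Proof.
move=> [I hI] /hI h P Pp; apply/hI => x /h [b ->].
by case: (proj2_sig P) => _ [_ [hm _]]; apply: hm.
Qed.

Lemma zclosed_zV g : zclosed (zV g).
Proof. by exists (fun x => x = g) => P; split=> [Pg x ->|]; last exact. Qed.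

Lemma zirreducible_zV p : normal_irreducible p -> zirreducible (zV p).
Proof.
move=> ip; have Vg : zV p (generic_point ip) by apply: divides_refl.
split; first by exists (generic_point ip).
move=> Z1 Z2 c1 c2 cov; case: (cov _ Vg) => h; [left | right]; exact: generic_point_sub h.
Qed.

Lemma zV_divides p q : normal_irreducible p -> normal_irreducible q ->
  subset (zV p) (zV q) -> p = q.
Proof.
move=> ip iq /(_ (generic_point ip)) h.
by apply: normal_irreducible_divides => //; apply: h; apply: divides_refl.
Qed.

(** V(g) is the finite union of the closed sets V(p); irreducibility selects one of them. *)
Lemma zirreducible_sub_factor (Y : Spec A -> Prop) g : g != 0 -> zirreducible Y ->
  subset Y (zV g) -> exists2 p, p \in factors g & subset Y (zV p).
Proof.
move=> ng [[P0 YP0] irr] sub; have [c [nc hps eg]] := factorsP ng.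
have {}sub : subset Y (zV (\prod_(p <- factors g) p)).
  move=> P /sub; rewrite /zV {1}eg; case: (proj2_sig P) => _ [_ [hm [n1 h]]] /h [u|//].
  case: n1; have -> : 1 = (c^-1%:P)%:P * (c%:P)%:P :> A by rewrite -!polyCM mulVf ?polyC1.
  exact: hm.
elim: (factors g) sub => [|p ps IH].
  by rewrite big_nil => /(_ P0 YP0); case: (proj2_sig P0) => _ [_ [_ [n1 _]]] /n1.
rewrite big_cons => sub.
have [|h|h] := irr _ _ (zclosed_zV p) (zclosed_zV (\prod_(q <- ps) q)).
- by move=> P /sub; case: (proj2_sig P) => _ [_ [_ [_ h]]] /h.
- by exists p; rewrite ?mem_head.
- by have [q qps sq] := IH h; exists q => //; rewrite inE qps orbT.
Qed.

Lemma zV_factor_sub g p : normal_irreducible p -> g != 0 -> p \in factors g ->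
  subset (zV p) (zV g).
Proof.
move=> ip ng /(mem_factors ip ng) [b ->] P Pp.
by case: (proj2_sig P) => _ [_ [hm _]]; apply: hm.
Qed.

(** Components correspond to the distinct prime factors; multiplicities are invisible in the
    spectrum, hence [undup]. *)
Lemma card_components g : g != 0 ->
  card_upto (@set_eq (Spec A)) (irr_component (zV g)) (size (undup (factors g))).
Proof.
move=> ng; apply: (@card_upto_map _ _ _ _ _ (fun p => zV p)); first exact: undup_uniq.
- move=> p; rewrite mem_undup => pg; have ip := factors_normal ng pg.
  split; first exact: zV_factor_sub.
  split; first exact: zirreducible_zV.
  move=> Y' iY sub1 sub2; have [q qg sq] := zirreducible_sub_factor ng iY sub2.
  have -> // : p = q; apply: zV_divides => //; first exact: factors_normal qg.
  by move=> P /sub1 /sq.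
- move=> p q; rewrite !mem_undup => pg qg e; apply: zV_divides.
  + exact: factors_normal pg.
  + exact: factors_normal qg.
  + by move=> P /e.
- move=> Y [sub [iY maxY]]; have [p pg sp] := zirreducible_sub_factor ng iY sub.
  have ip := factors_normal ng pg.
  exists p; rewrite ?mem_undup // => P; split; first exact: sp.
  apply: maxY => //; first exact: zirreducible_zV.
  exact: zV_factor_sub.
Qed.

End Components.

(* the value at 0 is irrelevant *)
Definition discrete_valuation (M : fieldType) (v : M -> int) : Prop :=
  (forall x y, x != 0 -> y != 0 -> v (x * y) = v x + v y) /\
  (forall x y n, x != 0 -> y != 0 -> x + y != 0 -> n <= v x -> n <= v y -> n <= v (x + y)).

Definition valuation_ring_of (M : fieldType) (v : M -> int) (x : M) : Prop :=
  x = 0 \/ 0 <= v x.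

Section DiscreteValuation.
Variables (M : fieldType) (v : M -> int).
Hypothesis dv : discrete_valuation v.

Lemma dvalM x y : x != 0 -> y != 0 -> v (x * y) = v x + v y.
Proof. by case: dv => h _; apply: h. Qed.
Lemma dval1 : v 1 = 0.
Proof. by apply: (addrI (v 1)); rewrite -dvalM ?oner_eq0 // mulr1 addr0. Qed.
Lemma dvalV x : x != 0 -> v x^-1 = - v x.
Proof.
by move=> nx; apply: (addrI (v x)); rewrite -dvalM ?invr_eq0 // mulfV // dval1 subrr.
Qed.
Lemma dval_div x y : x != 0 -> y != 0 -> v (x / y) = v x - v y.
Proof. by move=> nx ny; rewrite dvalM ?invr_eq0 // dvalV. Qed.
Lemma dvalN1 : v (-1) = 0.
Proof.
have n1 : (-1 : M) != 0 by rewrite oppr_eq0 oner_eq0.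
have := dvalM n1 n1; rewrite mulrNN mulr1 dval1; lia.
Qed.
Lemma dvalN x : x != 0 -> v (- x) = v x.
Proof. by move=> nx; rewrite -mulN1r dvalM ?oppr_eq0 ?oner_eq0 // dvalN1 add0r. Qed.
Lemma dvalX x n : x != 0 -> v (x ^+ n) = v x *+ n.
Proof.
move=> nx; elim: n => [|n IH]; first by rewrite expr0 dval1 mulr0n.
by rewrite exprS dvalM ?expf_neq0 // IH mulrS.
Qed.
Lemma dvalXz x (n : int) : x != 0 -> v (x ^ n) = v x * n.
Proof.
move=> nx; case: n => n; first by rewrite -exprnP dvalX // -mulr_natr natz.
by rewrite NegzE -invr_expz dvalV ?expfz_neq0 // -exprnP dvalX // -mulr_natr natz mulrN.
Qed.
Lemma dval_prod (I : Type) (r : seq I) (G : I -> M) : (forall i, G i != 0) ->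
  v (\prod_(i <- r) G i) = \sum_(i <- r) v (G i).
Proof.
move=> nG; elim: r => [|i r IH]; first by rewrite !big_nil dval1.
rewrite !big_cons dvalM // ?IH //.
by apply: (big_ind (fun x => x != 0)) => [|x y nx ny|//]; rewrite ?oner_eq0 ?mulf_neq0.
Qed.

Lemma dval_valuation_ring : valuation_ring (valuation_ring_of v).
Proof.
have add x y : valuation_ring_of v x -> valuation_ring_of v y -> valuation_ring_of v (x + y).
  have [->|nx] := eqVneq x 0; first by rewrite add0r.
  have [->|ny] := eqVneq y 0; first by rewrite addr0.
  case=> [x0|hx]; first by rewrite x0 eqxx in nx.
  case=> [y0|hy]; first by rewrite y0 eqxx in ny.
  have [->|nxy] := eqVneq (x + y) 0; first by left.
  by right; case: dv => _ h; apply: h.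
have opp x : valuation_ring_of v x -> valuation_ring_of v (- x).
  have [->|nx] := eqVneq x 0; first by rewrite oppr0.
  by case=> [x0|hx]; [rewrite x0 eqxx in nx | right; rewrite dvalN].
split; first by right; rewrite dval1.
split; first by move=> x y hx hy; apply: add => //; apply: opp.
split.
  move=> x y; have [->|nx] := eqVneq x 0; first by rewrite mul0r; left.
  have [->|ny] := eqVneq y 0; first by rewrite mulr0; left.
  case=> [x0|hx]; first by rewrite x0 eqxx in nx.
  case=> [y0|hy]; first by rewrite y0 eqxx in ny.
  by right; rewrite dvalM // addr_ge0.
move=> x nx; case: (leP 0 (v x)) => h; [by left; right | right; right].
by rewrite dvalV // oppr_ge0 ltW.
Qed.

Lemma valuation_ring_ofE x : x != 0 -> valuation_ring_of v x <-> 0 <= v x.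
Proof. by move=> nx; split=> [[x0|//]|]; [rewrite x0 eqxx in nx | right]. Qed.

End DiscreteValuation.

(** * Discrete valuations of a fraction field *)

Section FractionValuation.
Variables (R : idomainType) (w : R -> nat).
Hypothesis wM : forall a b, a != 0 -> b != 0 -> w (a * b) = (w a + w b)%N.
Local Notation "x %:F" := (FracField.tofrac x).

(** [w] will be an order of vanishing or a degree; its additivity makes the result independent of
    the fraction that [xget] picks. *)
Definition fracval (z : {fraction R}) : int :=
  let ab := xget (0, 1) [set ab : R * R | ab.2 != 0 /\ z = ab.1%:F / ab.2%:F]%classic in
  (w ab.1)%:Z - (w ab.2)%:Z.

Lemma fracvalE a b : a != 0 -> b != 0 -> fracval (a%:F / b%:F) = (w a)%:Z - (w b)%:Z.
Proof.
move=> na nb; rewrite /fracval; set P := [set ab : R * R | _]%classic.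
have : P (xget (0, 1) P) by apply: (@xgetI _ _ P (a, b)).
case: (xget _ _) => c d [/= nd /eqP]; rewrite eqr_div ?tofrac_eq0 //.
rewrite -!tofracM tofrac_eq => /eqP e.
have nc : c != 0.
  by apply: contra_eq_neq e => ->; rewrite mul0r mulf_neq0.
have := congr1 w e; rewrite !wM //; lia.
Qed.

Lemma fracval_embed a : a != 0 -> fracval a%:F = (w a)%:Z.
Proof.
move=> na; have := @fracvalE a 1 na (oner_neq0 _); rewrite tofrac1 divr1 => ->.
have := @wM 1 1 (oner_neq0 _) (oner_neq0 _); rewrite mulr1; lia.
Qed.

Lemma fraction_nonzero_ratio (z : {fraction R}) : z != 0 ->
  exists a b, [/\ a != 0, b != 0 & z = a%:F / b%:F].
Proof.
have [a [b [nb ->]]] := fraction_ratio z; rewrite mulf_eq0 invr_eq0 !tofrac_eq0 (negPf nb) orbF.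
by move=> na; exists a, b.
Qed.

Lemma fracvalM x y : x != 0 -> y != 0 -> fracval (x * y) = fracval x + fracval y.
Proof.
move=> /fraction_nonzero_ratio [a [b [na nb ->]]] /fraction_nonzero_ratio [c [d [nc nd ->]]].
rewrite mulf_div -!tofracM !fracvalE ?mulf_neq0 // !wM //; lia.
Qed.

Lemma fracvalD :
  (forall a b, a != 0 -> b != 0 -> a + b != 0 -> (minn (w a) (w b) <= w (a + b))%N) ->
  discrete_valuation fracval.
Proof.
move=> wD; split; first exact: fracvalM.
move=> _ _ n /fraction_nonzero_ratio [a [b [na nb ->]]] /fraction_nonzero_ratio [c [d [nc nd ->]]].
rewrite addf_div ?tofrac_eq0 // -!tofracM -tofracD mulf_eq0 invr_eq0 !tofrac_eq0 negb_or => /andP[n1 n2].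
rewrite !fracvalE ?mulf_neq0 //.
move=> h1 h2; apply: (@le_trans _ _ ((minn (w (a * d)) (w (c * b)))%:Z - (w (b * d))%:Z)).
  by rewrite !wM //; lia.
by rewrite lerD2r lez_nat; apply: wD; rewrite ?mulf_neq0.
Qed.

(** This is the case of a degree, which a sum bounds from above; the sign change gives the valuation
    at infinity. *)
Lemma fracval_opposite :
  (forall a b, a != 0 -> b != 0 -> a + b != 0 -> (w (a + b) <= maxn (w a) (w b))%N) ->
  discrete_valuation (fun z => - fracval z).
Proof.
move=> wD; split; first by move=> x y nx ny; rewrite fracvalM // opprD.
move=> _ _ n /fraction_nonzero_ratio [a [b [na nb ->]]] /fraction_nonzero_ratio [c [d [nc nd ->]]].
rewrite addf_div ?tofrac_eq0 // -!tofracM -tofracD mulf_eq0 invr_eq0 !tofrac_eq0 negb_or => /andP[n1 n2].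
rewrite !fracvalE ?mulf_neq0 //.
move=> h1 h2; apply: (@le_trans _ _ (- ((maxn (w (a * d)) (w (c * b)))%:Z - (w (b * d))%:Z))).
  by rewrite !wM //; lia.
by rewrite lerN2 lerD2r lez_nat; apply: wD; rewrite ?mulf_neq0.
Qed.

End FractionValuation.

Lemma fraction_coprime (F : fieldType) (z : {fraction {poly F}}) :
  exists p q : {poly F}, [/\ coprimep p q, q != 0 & z = FracField.tofrac p / FracField.tofrac q].
Proof.
have [a [b [nb ->]]] := fraction_ratio z.
have ng : gcdp a b != 0 by rewrite gcdp_eq0 (negPf nb) andbF.
have nq : b %/ gcdp a b != 0 by rewrite dvdp_div_eq0 ?dvdp_gcdr.
exists (a %/ gcdp a b), (b %/ gcdp a b); split=> //.
  by apply: coprimep_div_gcd; rewrite nb orbT.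
apply/eqP; rewrite eqr_div ?tofrac_eq0 // -!tofracM tofrac_eq; apply/eqP.
by rewrite divp_mulA ?dvdp_gcdr // divp_mulAC ?dvdp_gcdl.
Qed.

(* two elements of V that differ by a unit cannot both be nonunits *)
Lemma valuation_invert_shift (M : fieldType) (V : M -> Prop) (y z c : M) : valuation_ring V -> y != 0 -> z != 0 ->
  V c -> V c^-1 -> c != 0 -> z = y + c -> ~ V y^-1 -> V z^-1.
Proof.
move=> vV ny nz Vc Vci nc ez nVy; have sV := valuation_subring vV.
case: (valuation_cases (y / z) vV) => [h|[_]].
  have -> : z^-1 = (1 - y / z) * c^-1.
    by apply: (mulfI nz); rewrite mulfV // mulrA mulrBr mulr1 mulrCA mulfV // mulr1 ez addrAC subrr add0r mulfV.
  by apply: subringM => //; apply: subringB => //; apply: subring1.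
rewrite invf_div ez mulrDl mulfV // => h; case: nVy.
have -> : y^-1 = (1 + c / y - 1) * c^-1 by rewrite addrAC subrr add0r mulrAC mulfV // mul1r.
by apply: subringM => //; apply: subringB => //; apply: subring1.
Qed.

Lemma split_quotient (M : fieldType) (u w p q : M) : u != 0 -> w != 0 ->
  p / q = p / w * (u * w / q) / u.
Proof.
move=> nu nw; rewrite [u * w]mulrC mulrA [p / w * _]mulrA divfK // mulrAC mulfK //.
Qed.

(** * Points of the projective line *)

Section Places.
Variable L : closedFieldType.
Local Notation M := {fraction {poly L}}.
Local Notation "x %:F" := (FracField.tofrac x).
Implicit Types (a : option L) (z : M).

Definition constant_fun (c : L) : M := (c%:P)%:F.

(** [option L] is the projective line, with [None] as the point at infinity, where the valuation is
    minus the degree. *)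
Definition place_val a : M -> int :=
  match a with
  | Some x => fracval (mup x)
  | None => fun z => - fracval (fun p : {poly L} => (size p).-1) z
  end.

Let pred_sizeM (p q : {poly L}) : p != 0 -> q != 0 ->
  (size (p * q)).-1 = ((size p).-1 + (size q).-1)%N.
Proof. by move=> np nq; rewrite size_mul //; move: np nq; rewrite -!size_poly_gt0; move: (size p) (size q) => m n; lia. Qed.

Lemma place_dval a : discrete_valuation (place_val a).
Proof.
case: a => [x|] /=.
  apply: fracvalD => [p q np nq|p q np nq npq]; first exact: mupM.
  by rewrite mup_geq // dvdp_add // -mup_geq // ?geq_minl ?geq_minr.
apply: fracval_opposite => // p q np nq npq.
apply: (@leq_trans (maxn (size p) (size q)).-1); first by rewrite -!subn1 leq_sub2r // size_polyD.
by move: np nq; rewrite -!size_poly_gt0; move: (size p) (size q) => m n; lia.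
Qed.

Lemma place_some (x : L) (p q : {poly L}) : p != 0 -> q != 0 ->
  place_val (Some x) (p%:F / q%:F) = (mup x p)%:Z - (mup x q)%:Z.
Proof. by move=> np nq; rewrite /place_val fracvalE // => ? ? ? ?; apply: mupM. Qed.

Lemma place_none (p q : {poly L}) : p != 0 -> q != 0 ->
  place_val None (p%:F / q%:F) = (size q)%:Z - (size p)%:Z.
Proof.
move=> np nq; rewrite /place_val fracvalE //.
by move: np nq; rewrite -!size_poly_gt0; move: (size p) (size q) => m n; lia.
Qed.

Lemma place_const a (c : L) : c != 0 -> place_val a (constant_fun c) = 0.
Proof.
move=> nc; have nP : c%:P != 0 by rewrite polyC_eq0.
rewrite /constant_fun -[_%:F]divr1 -tofrac1; case: a => [x|].
  have n1 : ~~ root (1 : {poly L}) x by rewrite -polyC1 rootC oner_eq0.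
  have n2 : ~~ root c%:P x by rewrite rootC.
  by rewrite place_some ?oner_eq0 // (mupNroot n1) (mupNroot n2) subrr.
by rewrite place_none ?oner_eq0 // size_poly1 size_polyC nc subrr.
Qed.

Lemma place_linear a (x : L) : place_val a ('X - x%:P)%:F =
  (a == Some x)%:Z - (a == None)%:Z.
Proof.
have nX : 'X - x%:P != 0 by rewrite polyXsubC_eq0.
rewrite -[_%:F]divr1 -tofrac1; case: a => [y|].
  rewrite place_some ?oner_eq0 //= -[X in mup y X]expr1 mup_XsubCX.
  rewrite mupNroot; last by rewrite -polyC1 rootC oner_eq0.
  by rewrite (inj_eq Some_inj) eq_sym; case: (y == x).
by rewrite place_none ?oner_eq0 // size_poly1 size_XsubC.
Qed.

Lemma rational_function_ind (P : M -> Prop) :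
  (forall c, c != 0 -> P (constant_fun c)) -> (forall x : L, P ('X - x%:P)%:F) ->
  (forall y z, y != 0 -> z != 0 -> P y -> P z -> P (y * z)) ->
  (forall z, z != 0 -> P z -> P z^-1) -> forall z, z != 0 -> P z.
Proof.
move=> Pc Px PM PV.
have Pp (p : {poly L}) : p != 0 -> P p%:F.
  move=> np; have [r ->] := closed_field_poly_normal p.
  have nl : lead_coef p != 0 by rewrite lead_coef_eq0.
  rewrite -mul_polyC tofracM; elim: r => [|x r IH].
    by rewrite big_nil tofrac1 mulr1; apply: Pc.
  rewrite big_cons tofracM mulrCA; apply: PM => //.
    by rewrite tofrac_eq0 polyXsubC_eq0.
  by rewrite -tofracM tofrac_eq0 mulf_neq0 ?polyC_eq0 // monic_neq0 // monic_prod_XsubC.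
move=> z /fraction_nonzero_ratio [p [q [np nq ->]]].
by apply: PM; rewrite ?invr_eq0 ?tofrac_eq0 //; [apply: Pp|apply: PV; rewrite ?tofrac_eq0 //; apply: Pp].
Qed.

Let finite_sum z : z != 0 -> exists S0 : seq (option L),
  (forall a, a \notin S0 -> place_val a z = 0) /\
  (forall S, uniq S -> {subset S0 <= S} -> \sum_(a <- S) place_val a z = 0).
Proof.
elim/rational_function_ind: z / => [c nc|x|y z ny nz [S1 [h1 s1]] [S2 [h2 s2]]|z nz [S1 [h1 s1]]].
- exists [::]; split=> [a _|S _ _]; first exact: place_const.
  by apply: big1 => a _; apply: place_const.
(* X - x has one zero, at x, and one pole, at infinity. *)
- exists [:: Some x; None]; split=> [a|S uS sub].
    by rewrite !inE place_linear negb_or => /andP[/negPf -> /negPf ->].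
  under eq_bigr => a _ do rewrite place_linear.
  rewrite sumrB; apply/eqP; rewrite subr_eq0; apply/eqP.
  have cnt b : b \in S -> \sum_(a <- S) (a == b)%:Z = 1.
    move=> bS; rewrite (bigD1_seq b) //= eqxx big1 ?addr0 // => a /negPf -> //.
  by rewrite !cnt // sub // !inE eqxx ?orbT.
- exists (S1 ++ S2); split=> [a|S uS sub].
    rewrite mem_cat negb_or => /andP[/h1 e1 /h2 e2].
    by rewrite (dvalM (place_dval a) ny nz) e1 e2.
  under eq_bigr => a _ do rewrite (dvalM (place_dval a) ny nz).
  by rewrite big_split /= s1 ?s2 // => a ha; apply: sub; rewrite mem_cat ha ?orbT.
- exists S1; split=> [a /h1 e|S uS sub]; first by rewrite (dvalV (place_dval a) nz) e oppr0.
  under eq_bigr => a _ do rewrite (dvalV (place_dval a) nz).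
  by rewrite sumrN s1 // oppr0.
Qed.

Lemma place_support z : z != 0 -> exists S0 : seq (option L),
  forall a, a \notin S0 -> place_val a z = 0.
Proof. by move=> /finite_sum [S0 [h _]]; exists S0. Qed.

Lemma place_sum0 z (S : seq (option L)) : z != 0 -> uniq S ->
  (forall a, a \notin S -> place_val a z = 0) -> \sum_(a <- S) place_val a z = 0.
Proof.
move=> nz uS hS; have [S0 [_ h]] := finite_sum nz.
have := h (S ++ [seq a <- undup S0 | a \notin S]).
rewrite big_cat /= [X in _ + X]big1_seq ?addr0.
  apply=> [|a aS0]; last by rewrite mem_cat mem_filter mem_undup aS0 andbT orbN.
  rewrite cat_uniq uS filter_uniq ?undup_uniq // andbT; apply/hasPn => a.
  by rewrite mem_filter => /andP[].
by move=> a /andP[_]; rewrite mem_filter => /andP[/hS].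
Qed.

(** The function is a product of powers of X - x over the finite points only. Its order at infinity
    is then the required one because the prescribed orders add up to 0. *)
Lemma place_prescribed (m : option L -> int) (S : seq (option L)) : uniq S ->
  \sum_(a <- S) m a = 0 ->
  exists2 f : M, f != 0 & forall a, place_val a f = if a \in S then m a else 0.
Proof.
move=> uS s0; pose g a : M := if a is Some x then ('X - x%:P)%:F ^ (m a) else 1.
have ng a : g a != 0.
  by case: a => [x|] /=; rewrite ?oner_eq0 // expfz_neq0 // tofrac_eq0 polyXsubC_eq0.
have nf : \prod_(a <- S) g a != 0 by rewrite prodf_seq_neq0; apply/allP => a _; exact: ng.
have gv b a : place_val b (g a) = (if a is Some _ then ((b == a)%:Z - (b == None)%:Z) * m a else 0).
  case: a => [x|] /=; last by rewrite (dval1 (place_dval b)).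
  by rewrite (dvalXz (place_dval b)) ?tofrac_eq0 ?polyXsubC_eq0 // place_linear.
exists (\prod_(a <- S) g a) => // b.
rewrite (dval_prod (place_dval b)) //.
have pick c : \sum_(a <- S) (c == a)%:Z * m a = if c \in S then m c else 0.
  case: ifP => cS.
    rewrite (bigD1_seq c) //= eqxx mul1r big1 ?addr0 // => a.
    by rewrite eq_sym => /negPf ->; rewrite mul0r.
  by rewrite big1_seq // => a /andP[_ aS]; case: eqP => [e|_]; rewrite ?mul0r //; rewrite e aS in cS.
rewrite -pick; under eq_bigr => a _ do rewrite gv.
case: b => [x|].
  by apply: eq_bigr => -[y|] _ //=; rewrite ?mul0r // subr0.
transitivity (\sum_(a <- S) ((None == a)%:Z * m a - m a)); last by rewrite sumrB s0 subr0.
by apply: eq_bigr => -[y|] _ /=; rewrite ?mul0r ?sub0r ?mulN1r // mul1r subrr.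
Qed.

(** Without finite poles the reduced denominator has no root, so it is constant; without a pole at
    infinity the numerator is constant too. *)
Lemma place_regular_constant z : z != 0 -> (forall a, 0 <= place_val a z) ->
  exists2 c, c != 0 & z = constant_fun c.
Proof.
have [p [q [cpq nq ->]]] := fraction_coprime z.
rewrite mulf_eq0 invr_eq0 !tofrac_eq0 (negPf nq) orbF => np h.
have [c nc eq] : exists2 c, c != 0 & q = c%:P.
  apply/size_poly1P; apply: contrapT => /negP sq.
  have [x rx] := closed_rootP q sq.
  have := h (Some x); rewrite place_some // mupNroot; last first.
    by apply: coprimep_root rx; rewrite coprimep_sym.
  have m : (0 < mup x q)%N by rewrite -XsubC_dvd // dvdp_XsubCl.
  by rewrite sub0r oppr_ge0 lez_nat leqNgt m.
have := h None; rewrite place_none // eq size_polyC nc => sp.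
have [d nd ep] : exists2 d, d != 0 & p = d%:P.
  apply/size_poly1P; move: sp; rewrite subr_ge0 lez_nat => sp.
  by rewrite eqn_leq sp size_poly_gt0 np.
exists (d / c); first by rewrite mulf_neq0 ?invr_eq0.
apply: (mulIf (x := (c%:P)%:F)); first by rewrite tofrac_eq0 polyC_eq0.
rewrite divfK ?tofrac_eq0 ?polyC_eq0 // /constant_fun -tofracM -polyCM.
by rewrite divfK // ep.
Qed.

Lemma place_residue a z : 0 <= place_val a z -> exists c : L,
  z = constant_fun c \/ 0 < place_val a (z - constant_fun c).
Proof.
have [->|nz] := eqVneq z 0.
  by exists 0; left; rewrite /constant_fun polyC0 tofrac0.
have [p [q [cpq nq ez]]] := fraction_coprime z.
have np : p != 0 by apply: contra_neq nz => p0; rewrite ez p0 tofrac0 mul0r.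
have diff c : z - constant_fun c = (p - c *: q)%:F / q%:F.
  rewrite tofracB mulrBl -ez; congr (_ - _).
  by rewrite -mul_polyC tofracM mulfK ?tofrac_eq0.
move=> h; suff [c hc] : exists c, p - c *: q = 0 \/ (p - c *: q != 0 /\ 0 < place_val a ((p - c *: q)%:F / q%:F)).
  exists c; rewrite diff; case: hc => [hc|[_ hc]]; [left|by right].
  by apply/eqP; rewrite -subr_eq0 diff hc tofrac0 mul0r.
case: a h => [x|] h.
  have qx : ~~ root q x.
    apply/negP => rx; move: h; rewrite ez place_some // mupNroot; last first.
      by apply: coprimep_root rx; rewrite coprimep_sym.
    have m : (0 < mup x q)%N by rewrite -XsubC_dvd // dvdp_XsubCl.
    by rewrite sub0r oppr_ge0 lez_nat leqNgt m.
  exists (p.[x] / q.[x]); have [->|n0] := eqVneq (p - (p.[x] / q.[x]) *: q) 0; first by left.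
  right; split=> //; rewrite place_some // (mupNroot qx) subr0 ltz_nat -XsubC_dvd //.
  by rewrite dvdp_XsubCl rootE !hornerE divfK ?subrr.
move: h; rewrite ez place_none // => h.
pose n := (size q).-1; have sq : size q = n.+1 by rewrite prednK // size_poly_gt0.
(* The value at infinity is the quotient of the coefficients in the degree of the denominator; it is
   0 when the numerator has smaller degree. *)
exists (p`_n / lead_coef q); have [->|n0] := eqVneq (p - (p`_n / lead_coef q) *: q) 0; first by left.
right; split=> //; rewrite place_none // subr_gt0 ltz_nat sq ltnS.
apply/leq_sizeP => j; rewrite leq_eqVlt => /orP[/eqP <-|nj]; rewrite coefB coefZ.
  by rewrite {2}/n -lead_coefE divfK ?subrr // lead_coef_eq0.
have qj : q`_j = 0 by apply: nth_default; rewrite sq.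
have pj : p`_j = 0.
  by apply: nth_default; apply: leq_trans nj; move: h; rewrite sq subr_ge0 lez_nat.
by rewrite pj qj mulr0 subr0.
Qed.

(** A power of an element of negative value absorbs the pole of any other element, so a ring that
    strictly contains the valuation ring is the whole field. *)
Lemma place_val_maximal a (V : M -> Prop) : valuation_ring V ->
  (forall z, valuation_ring_of (place_val a) z -> V z) -> (exists z, ~ V z) ->
  forall z, V z -> valuation_ring_of (place_val a) z.
Proof.
move=> vV sub [y nVy] z Vz; apply: contrapT => nz; apply: nVy.
have sV := valuation_subring vV; have dv := place_dval a.
have nz0 : z != 0 by apply/eqP => z0; apply: nz; left.
have hz : place_val a z <= -1.
  by case: (leP 0 (place_val a z)) => h; [case: nz; right | lia].
have [->|ny] := eqVneq y 0; first exact: subring0.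
pose n := `|place_val a y|%N.
rewrite -(divfK (expf_neq0 n nz0) y); apply: subringM => //; last exact: subringX.
apply: sub; right; rewrite (dval_div dv ny (expf_neq0 n nz0)) (dvalX dv _ nz0).
rewrite -mulr_natr natz /n; move: (place_val a y) (place_val a z) hz => u v; nia.
Qed.

Lemma place_some_denominator (x : L) (p q : {poly L}) : coprimep p q -> p != 0 -> q != 0 ->
  0 <= place_val (Some x) (p%:F / q%:F) -> ~~ root q x.
Proof.
move=> cpq np nq h; apply/negP => rx; move: h; rewrite place_some // mupNroot; last first.
  by apply: coprimep_root rx; rewrite coprimep_sym.
have m : (0 < mup x q)%N by rewrite -XsubC_dvd // dvdp_XsubCl.
by rewrite sub0r oppr_ge0 lez_nat leqNgt m.
Qed.

(** If the coordinate T lies in [V], some T - x is a nonunit and [V] contains the local ring at x.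
    Otherwise 1/T is a nonunit and [V] contains the local ring at infinity. Maximality of these
    rings turns the inclusion into equality. *)
Lemma valuation_ring_place (V : M -> Prop) : valuation_ring V ->
  (forall c, V (constant_fun c)) -> (exists z, ~ V z) ->
  exists a, forall z, V z <-> valuation_ring_of (place_val a) z.
Proof.
move=> vV Vc nV; have sV := valuation_subring vV.
suff [a sub] : exists a, forall z, valuation_ring_of (place_val a) z -> V z.
  by exists a => z; split; [exact: place_val_maximal|exact: sub].
have V0 : V 0 by apply: subring0.
have Vci c : V (constant_fun c)^-1.
  have [->|nc] := eqVneq c 0; first by rewrite /constant_fun polyC0 tofrac0 invr0.
  have -> : (constant_fun c)^-1 = constant_fun c^-1.
    apply: (mulIf (x := constant_fun c)); first by rewrite tofrac_eq0 polyC_eq0.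
    by rewrite mulVf ?tofrac_eq0 ?polyC_eq0 // -tofracM -polyCM mulVf // tofrac1.
  exact: Vc.
have nlin x : ('X - x%:P)%:F != 0 :> M by rewrite tofrac_eq0 polyXsubC_eq0.
case: (pselect (V 'X%:F)) => [VT|nVT].
  have Vlin x : V ('X - x%:P)%:F by rewrite tofracB; apply: subringB => //; apply: Vc.
  have Vp (p : {poly L}) : V p%:F.
    have [->|np] := eqVneq p 0; first by rewrite tofrac0.
    elim/poly_closed_ind: p / np => [c _|x p _ IH]; first exact: Vc.
    by rewrite tofracM; apply: subringM.
  have [x nVx] : exists x, ~ V ('X - x%:P)%:F^-1.
    apply: contrapT => h; case: nV => z; apply.
    have [p [q [nq ->]]] := fraction_ratio z; apply: subringM => //.
    elim/poly_closed_ind: q / nq => [c _|x q _ IH]; first exact: Vci.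
    rewrite tofracM invfM; apply: subringM => //.
    by apply: contrapT => h'; apply: h; exists x.
  (* For y different from x, T - y differs from the nonunit T - x by a nonzero constant, so its
     inverse lies in [V]. *)
  have Vq (q : {poly L}) : q != 0 -> ~~ root q x -> V q%:F^-1.
    move=> nq; elim/poly_closed_ind: q / nq => [c _ _|y q _ IH]; first exact: Vci.
    rewrite rootM negb_or root_XsubC => /andP[/IH hq yx].
    rewrite tofracM invfM; apply: subringM => //.
    apply: (@valuation_invert_shift _ V ('X - x%:P)%:F _ (constant_fun (x - y))) => //.
      by rewrite tofrac_eq0 polyC_eq0 subr_eq0.
    by rewrite -tofracD polyCB addrA subrK.
  exists (Some x) => z [->//|hz].
  have [->|nz] := eqVneq z 0; first by [].
  have [p [q [cpq nq ez]]] := fraction_coprime z.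
  have np : p != 0 by apply: contra_neq nz => p0; rewrite ez p0 tofrac0 mul0r.
  rewrite ez; apply: subringM => //; apply: Vq => //.
  by apply: place_some_denominator cpq np nq _; rewrite -ez.
have VS : V 'X%:F^-1 by case: (valuation_cases ('X%:F : M) vV) => // -[].
have nT : 'X%:F != 0 :> M by rewrite tofrac_eq0 polyX_eq0.
(* Divided by T to its degree, a polynomial becomes a unit of [V]: a factor T - x turns into 1 -
   x/T. *)
have Vq (q : {poly L}) : q != 0 -> V (q%:F / 'X%:F ^+ (size q).-1) /\ V ('X%:F ^+ (size q).-1 / q%:F).
  move=> nq; elim/poly_closed_ind: q / nq => [c nc|x q nq [IH1 IH2]].
    by rewrite size_polyC nc expr0 divr1 div1r; split; [apply: Vc | apply: Vci].
  have -> : (size (q * ('X - x%:P))).-1 = (size q).-1.+1.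
    rewrite size_Mmonic ?monicXsubC // size_XsubC addn2 /= prednK //.
    by rewrite size_poly_gt0.
  rewrite tofracM exprSr -!mulf_div; split; apply: subringM => //.
    by rewrite tofracB mulrBl mulfV //; apply: subringB; [|apply: subring1|apply: subringM => //; apply: Vc].
  have [->|nx] := eqVneq x 0; first by rewrite polyC0 subr0 mulfV //; apply: subring1.
  have w0 : ('X - x%:P)%:F / 'X%:F = 1 - constant_fun x / 'X%:F :> M by rewrite tofracB mulrBl mulfV.
  rewrite -invf_div w0.
  have nc : constant_fun x != 0 by rewrite tofrac_eq0 polyC_eq0.
  have V1 : V 1 by apply: subring1.
  have nS : 'X%:F^-1 != 0 :> M := invr_neq0 nT.
  have ny : - (constant_fun x / 'X%:F) != 0 by rewrite oppr_eq0; apply: mulf_neq0 nc nS.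
  have nz : 1 - constant_fun x / 'X%:F != 0 by rewrite -w0; exact: mulf_neq0 (nlin x) nS.
  have V1i : V 1^-1 by rewrite invr1.
  apply: (valuation_invert_shift vV ny nz V1 V1i (oner_neq0 _) (addrC _ _)).
  rewrite invrN invf_div => h; apply: nVT.
  rewrite -[X in V X](mulfK nc) -[X in V X]mulrAC -[X in V (X * _)]opprK mulNr.
  by apply: subringN => //; apply: subringM.
exists None => z [->//|hz].
have [->|nz] := eqVneq z 0; first by [].
have [p [q [np nq ez]]] := fraction_nonzero_ratio nz.
move: hz; rewrite ez place_none // subr_ge0 lez_nat => spq.
have [Vp _] := Vq _ np; have [_ Vq'] := Vq _ nq.
have -> : p%:F / q%:F = (p%:F / 'X%:F ^+ (size p).-1) * ('X%:F ^+ (size q).-1 / q%:F) *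
    'X%:F^-1 ^+ ((size q).-1 - (size p).-1) :> M.
  have le : ((size p).-1 <= (size q).-1)%N by rewrite -!subn1 leq_sub2r.
  rewrite -{1}(subnK le) exprD exprVn.
  move: (expf_neq0 ((size q).-1 - (size p).-1) nT) (expf_neq0 (size p).-1 nT).
  exact: split_quotient.
by apply: subringM; [|apply: subringM|apply: subringX].
Qed.

End Places.

(** The rational root argument: [p] divides the nonzero term of least index, and being coprime to
    [q] it divides the coefficient of that term. *)
Lemma homogeneous_relation_size (F : fieldType) (p q : {poly F}) (m N : nat) (a : nat -> {poly F}) :
  coprimep p q -> (exists2 j, (j <= m)%N & a j != 0) -> (forall j, (size (a j) <= N)%N) ->
  \sum_(j < m.+1) a j * p ^+ j * q ^+ (m - j) = 0 -> (size p <= N)%N.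
Proof.
move=> cpq [j1 j1m nj1] sa e.
have [->|np] := eqVneq p 0; first by rewrite size_poly0.
have exj : exists j, (j <= m)%N && (a j != 0) by exists j1; rewrite j1m.
have [j0 /andP[j0m nj0] minj] := ex_minnP exj.
have zero j : (j < j0)%N -> a j = 0.
  move=> jj; apply/eqP; apply: contraTT jj => nj; rewrite -leqNgt.
  case: (leqP j m) => jm; first by apply: minj; rewrite jm.
  by rewrite ltnW // (leq_ltn_trans j0m).
have e' : \sum_(j < m.+1 | (j0 <= j)%N) a j * p ^+ (j - j0) * q ^+ (m - j) = 0.
  apply: (mulfI (expf_neq0 j0 np)); rewrite mulr0 -[RHS]e mulr_sumr [RHS](bigID (fun j : 'I__ => (j0 <= j)%N)) /=.
  rewrite [X in _ = _ + X]big1 ?addr0 => [|j]; last by rewrite -ltnNge => /zero ->; rewrite !mul0r.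
  apply: eq_bigr => j jj; have -> : p ^+ j = p ^+ j0 * p ^+ (j - j0) by rewrite -exprD subnKC.
  by rewrite !mulrA [_ * a j]mulrC.
have lj : (j0 < m.+1)%N by rewrite ltnS.
have dv : p %| a j0 * q ^+ (m - j0).
  move/eqP: e'; rewrite (bigD1 (Ordinal lj)) //= subnn expr0 mulr1 addr_eq0 => /eqP ->.
  rewrite dvdpNr; apply: (big_ind (fun r => p %| r)) => [|r s|j]; first exact: dvdp0.
    exact: dvdp_add.
  move=> /andP[jj nj]; rewrite dvdp_mulr // dvdp_mull // -(subnKC jj).
  have : (j0 < j)%N by rewrite ltn_neqAle jj andbT; apply: contra nj => /eqP h; apply/eqP/val_inj.
  by rewrite addKn -subn_gt0; case: (j - j0)%N => // n _; rewrite exprS dvdp_mulr.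
move: dv; rewrite Gauss_dvdpl; last by rewrite coprimep_expr.
by move=> /dvdp_leq h; apply: leq_trans (h nj0) (sa _).
Qed.

Lemma homogeneous_relation_sizes (F : fieldType) (p q : {poly F}) (m N : nat) (a : nat -> {poly F}) :
  coprimep p q -> (exists2 j, (j <= m)%N & a j != 0) -> (forall j, (size (a j) <= N)%N) ->
  \sum_(j < m.+1) a j * p ^+ j * q ^+ (m - j) = 0 -> (size p <= N)%N /\ (size q <= N)%N.
Proof.
move=> cpq ex sa e; split; first exact: homogeneous_relation_size e.
apply: (@homogeneous_relation_size _ q p m N (fun j => a (m - j)%N)) => //.
- by rewrite coprimep_sym.
- by case: ex => j jm nj; exists (m - j)%N; rewrite ?leq_subr ?subKn.
- rewrite -[RHS]e [RHS](reindex_inj rev_ord_inj) /=; apply: eq_bigr => j _.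
  have jm : (j <= m)%N by rewrite -ltnS.
  by rewrite subSS subKn // mulrAC.
Qed.

(** There are [size G] monomials in [a] and [b], while modulo [G] they lie in a space of dimension
    one less over the fraction field of [R]. *)
Lemma dependent_powers (R : idomainType) (G a b : {poly R}) : G != 0 ->
  exists2 c : nat -> R, (exists2 i, (i < size G)%N & c i != 0) &
    exists w, \sum_(i < size G) (c i)%:P * a ^+ i * b ^+ ((size G).-1 - i) = w * G.
Proof.
move=> nG; set N := size G.
have N0 : (0 < N)%N by rewrite size_poly_gt0.
pose u i := a ^+ i * b ^+ (N.-1 - i).
pose Mx : 'M[R]_N := \matrix_(i, j) ((u i %% G)`_j).
have sr i : (size (u i %% G)%R <= N.-1)%N.
  by rewrite -ltnS prednK // Pdiv.Idomain.ltn_modp.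
(* Remainders modulo [G] are too short to reach the last column. *)
have dM : \det Mx = 0.
  have lN : (N.-1 < N)%N by rewrite prednK.
  rewrite (expand_det_col _ (Ordinal lN)) big1 // => i _.
  by rewrite mxE nth_default ?mul0r.
have /det0P [v nv ev] : \det Mx == 0 by rewrite dM.
(* Pseudo-division multiplies the i-th monomial by this power of the leading coefficient; the
   coefficients of the relation absorb it. *)
pose lc i := lead_coef G ^+ scalp (u i) G.
pose c i := if insub i is Some j then v 0 j * lc i else 0.
have cE (i : 'I_N) : c i = v 0 i * lc i by rewrite /c valK.
have nlc i : lc i != 0 by rewrite expf_neq0 // lead_coef_eq0.
exists c.
  have [i ni] : exists i, v 0 i != 0 by apply/rV0Pn.
  by exists i; rewrite // cE mulf_neq0.
exists (\sum_(i < N) (v 0 i)%:P * (u i %/ G)).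
rewrite mulr_suml.
have z : \sum_(i < N) (v 0 i)%:P * (u i %% G) = 0.
  apply/polyP => j; rewrite coef0 coef_sum; case: (ltnP j N) => jN.
    have := congr1 (fun w : 'rV__ => w 0 (Ordinal jN)) ev; rewrite !mxE => h; rewrite -[RHS]h.
    by apply: eq_bigr => i _; rewrite coefCM mxE.
  apply: big1 => i _; rewrite coefCM nth_default ?mulr0 //.
  by apply: leq_trans (sr i) _; apply: leq_trans jN; rewrite leq_pred.
rewrite -[RHS]addr0 -[X in _ = _ + X]z -big_split /=; apply: eq_bigr => i _.
rewrite cE polyCM -!mulrA -mulrDr; congr (_ * _).
by rewrite mul_polyC Pdiv.Idomain.divp_eq.
Qed.

Lemma mulr_reverse3 (R : comNzRingType) (x y z : R) : x * (y * z) = z * (y * x).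
Proof. by ring. Qed.

(** * Parametrizations of bounded degree *)

Section DegreeBound.
Variable k : closedFieldType.
Local Notation A := {poly {poly k}}.
Local Notation M := {fraction {poly k}}.
Local Notation "x %:F" := (FracField.tofrac x).
Variable psi : {rmorphism A -> M}.
Hypothesis psi_cst : forall c : k, psi ((c%:P)%:P) = (c%:P)%:F.

Let psi_poly (p q : {poly k}) (c : {poly k}) m : q != 0 -> psi (('X)%:P) = p%:F / q%:F ->
  (size c <= m.+1)%N ->
  psi c%:P * q%:F ^+ m = (\sum_(j < m.+1) (c`_j)%:P * p ^+ j * q ^+ (m - j))%:F.
Proof.
move=> nq ex sc; rewrite -[in LHS](coefK c) poly_def !rmorph_sum mulr_suml.
have nqF : q%:F != 0 by rewrite tofrac_eq0.
rewrite (big_ord_widen m.+1 (fun i => psi ((c`_i *: 'X^i)%:P) * q%:F ^+ m)) //.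
rewrite [RHS](bigID (fun i : 'I_m.+1 => (i < size c)%N)) /= [X in _ + X]big1 ?addr0.
  apply: eq_bigr => i ic; rewrite -mul_polyC polyCM rmorphM /= psi_cst polyC_exp rmorphXn /= ex.
  rewrite !rmorphM !rmorphXn /= -!mulrA; congr (_ * _).
  have im : (i <= m)%N by rewrite -ltnS.
  by rewrite exprMn -mulrA (exprV_mul nqF im).
by move=> i; rewrite -leqNgt => h; rewrite nth_default // polyC0 !mul0r rmorph0.
Qed.

(** The bound does not depend on [psi]. In field terms, a nonconstant psi X has degree
    [k(T) : k(psi X)], which is at most the degree of [G] in the outer variable. Concretely,
    [dependent_powers] gives a relation for T of degree below [size G] over k[psi X]; regrouped by
    powers of psi X = p/q, its coefficients have size at most [size G], and the rational root
    argument bounds [p] and [q]. *)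
Lemma coordinate_degree_bound (G a b : A) : G != 0 -> psi G = 0 -> psi b != 0 ->
  'X%:F = psi a / psi b ->
  exists p q : {poly k}, [/\ q != 0, psi (('X)%:P) = p%:F / q%:F,
    (size p <= size G)%N & (size q <= size G)%N].
Proof.
move=> nG G0 nb eT; have [p [q [cpq nq ex]]] := fraction_coprime (psi 'X%:P).
set N := size G.
suff [h1 h2] : (size p <= N)%N /\ (size q <= N)%N by exists p, q.
have [c [i0 i0N nc] [w ew]] := dependent_powers a b nG; rewrite -/N in i0N ew.
pose m := \max_(i < N) size (c i).
have cm i : (i < N)%N -> (size (c i) <= m.+1)%N.
  by move=> iN; apply: leqW; apply: (@leq_bigmax _ (fun i : 'I_N => size (c i)) (Ordinal iN)).
pose d j : {poly k} := \poly_(i < N) (c i)`_j.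
apply: (@homogeneous_relation_sizes _ p q m N d) => //.
- exists (size (c i0)).-1.
    by rewrite -subn1 leq_subLR add1n; apply: cm.
  apply/eqP => /polyP/(_ i0); rewrite coef_poly i0N coef0 -lead_coefE => /eqP.
  by rewrite lead_coef_eq0 (negPf nc).
- by move=> j; apply: size_poly.
have T0 : \sum_(i < N) psi (c i)%:P * 'X%:F ^+ i = 0.
  have nbN : psi b ^+ N.-1 != 0 by apply: expf_neq0.
  apply: (mulfI nbN); rewrite mulr0.
  have : psi (w * G) = 0 by rewrite rmorphM G0 mulr0.
  rewrite -ew rmorph_sum /= => h; rewrite -[RHS]h mulr_sumr; apply: eq_bigr => i _.
  rewrite !rmorphM !rmorphXn /= eT -!mulrA mulrCA; congr (_ * _).
  have iN : (i <= N.-1)%N by rewrite -ltnS prednK // size_poly_gt0.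
  by rewrite mulrC exprMn -mulrA (exprV_mul nb iN).
apply/eqP; rewrite -tofrac_eq0; apply/eqP.
have nqF : q%:F != 0 :> M by rewrite tofrac_eq0.
have nqm := expf_neq0 m nqF.
have : q%:F ^+ m * \sum_(i < N) psi (c i)%:P * 'X%:F ^+ i = 0 by rewrite T0 mulr0.
rewrite mulr_sumr => h; rewrite -[RHS]h.
transitivity (\sum_(i < N) (('X ^+ i) * \sum_(j < m.+1) ((c i)`_j)%:P * p ^+ j * q ^+ (m - j))%:F).
  rewrite -rmorph_sum /=; congr (_ %:F).
  under [RHS]eq_bigr => i _ do rewrite mulr_sumr.
  rewrite exchange_big /=; apply: eq_bigr => j _.
  rewrite /d poly_def -mulrA mulr_suml; apply: eq_bigr => i _.
  by rewrite -mul_polyC !mulrA ['X^i * _]mulrC.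
apply: eq_bigr => i _; rewrite rmorphM rmorphXn /= -(psi_poly nq ex (cm i (ltn_ord i))).
exact: mulr_reverse3.
Qed.

End DegreeBound.

(** * Evaluation of bivariate polynomials and substitution of fractions *)

Section Evaluation.
Variables (k : fieldType) (B : comNzRingType).

Definition eval2 (j : k -> B) (x y : B) (a : {poly {poly k}}) : B :=
  (map_poly (fun c => (map_poly j c).[x]) a).[y].

Section Morphism.
Variables (j : {rmorphism k -> B}) (x y : B).
HB.instance Definition _ := GRing.RMorphism.copy (eval2 j x y)
  (horner_eval y \o map_poly (horner_eval x \o map_poly j)).
End Morphism.

Lemma eval2E (j : {rmorphism k -> B}) x y (a : {poly {poly k}}) n : (size a <= n)%N ->
  (forall i, (size (a`_i)%R <= n)%N) ->
  eval2 j x y a = \sum_(i < n) \sum_(l < n) j a`_i`_l * x ^+ l * y ^+ i.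
Proof.
move=> sa sai; rewrite /eval2 (@horner_coef_wide _ n); last first.
  exact: leq_trans (size_poly _ _) sa.
apply: eq_bigr => i _; rewrite coef_map_id0; last by rewrite map_poly0 horner0.
rewrite (@horner_coef_wide _ n) ?mulr_suml; last exact: leq_trans (size_poly _ _) (sai i).
by apply: eq_bigr => l _; rewrite coef_map_id0 ?rmorph0.
Qed.

Lemma eval2_cst (j : {rmorphism k -> B}) x y c : eval2 j x y (c%:P)%:P = j c.
Proof.
rewrite -[LHS]/((horner_eval y \o map_poly (horner_eval x \o map_poly j)) _) /=.
by rewrite map_polyC /= /horner_eval hornerC map_polyC /= hornerC.
Qed.
Lemma eval2_X (j : {rmorphism k -> B}) x y : eval2 j x y ('X%:P) = x.
Proof.
rewrite -[LHS]/((horner_eval y \o map_poly (horner_eval x \o map_poly j)) _) /=.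
by rewrite map_polyC /= /horner_eval hornerC map_polyX hornerX.
Qed.
Lemma eval2_Y (j : {rmorphism k -> B}) x y : eval2 j x y 'X = y.
Proof.
rewrite -[LHS]/((horner_eval y \o map_poly (horner_eval x \o map_poly j)) _) /=.
by rewrite map_polyX /horner_eval hornerX.
Qed.

Lemma eval2_unique (j : {rmorphism k -> B}) (psi : {rmorphism {poly {poly k}} -> B}) a :
  (forall c, psi ((c%:P)%:P) = j c) -> psi a = eval2 j (psi 'X%:P) (psi 'X) a.
Proof.
move=> h; pose n := maxn (size a) (\max_(i < size a) size (a`_i)%R).
have sai i : (size (a`_i)%R <= n)%N.
  case: (ltnP i (size a)) => hi; last by rewrite nth_default // size_poly0.
  by apply: leq_trans (leq_maxr _ _); apply: (@leq_bigmax _ (fun i : 'I_(size a) => size (a`_i)%R) (Ordinal hi)).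
rewrite (eval2E _ _ _ (leq_maxl _ _ : (size a <= n)%N) sai).
rewrite -[in LHS](coefK a) poly_def rmorph_sum /=.
rewrite (big_ord_widen n (fun i => psi (a`_i *: 'X^i))) ?leq_maxl // [RHS](bigID (fun i : 'I_n => (i < size a)%N)) /=.
rewrite [X in _ + X]big1 ?addr0 => [|i]; last first.
  rewrite -leqNgt => hi; have -> : a`_i = 0 by apply: nth_default.
  by apply: big1 => l _; rewrite coef0 rmorph0 !mul0r.
apply: eq_bigr => i _; rewrite -mul_polyC rmorphM rmorphXn /= -mulr_suml; congr (_ * _).
rewrite -[in LHS](coefK a`_i) poly_def rmorph_sum rmorph_sum /=.
rewrite (big_ord_widen n (fun l => psi (a`_i`_l *: 'X^l)%:P)) // [RHS](bigID (fun l : 'I_n => (l < size (a`_i)%R)%N)) /=.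
rewrite [X in _ + X]big1 ?addr0 => [|l]; last first.
  by rewrite -leqNgt => hi; rewrite nth_default // rmorph0 !mul0r.
by apply: eq_bigr => l _; rewrite -mul_polyC polyCM rmorphM polyC_exp rmorphXn /= h.
Qed.

(* R ^ n * S ^ n * a (P / R, Q / S), without denominators *)
Definition homogenize (j : k -> B) n (a : {poly {poly k}}) (P R Q S : B) : B :=
  \sum_(i < n) \sum_(l < n) j a`_i`_l * (P ^+ l * R ^+ (n - l)) * (Q ^+ i * S ^+ (n - i)).

End Evaluation.

Lemma homogenize_morph (k : fieldType) (B C : comNzRingType) (g : {rmorphism B -> C})
    (j : k -> B) (j' : k -> C) n a P R Q S : (forall c, g (j c) = j' c) ->
  g (homogenize j n a P R Q S) = homogenize j' n a (g P) (g R) (g Q) (g S).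
Proof.
move=> h; rewrite rmorph_sum; apply: eq_bigr => i _; rewrite rmorph_sum; apply: eq_bigr => l _ /=.
by rewrite !rmorphM !rmorphXn /= h.
Qed.

Lemma homogenizeE (k M : fieldType) (j : {rmorphism k -> M}) n (a : {poly {poly k}}) (P R Q S : M) :
  (size a <= n)%N -> (forall i, (size (a`_i)%R <= n)%N) -> R != 0 -> S != 0 ->
  homogenize j n a P R Q S = eval2 j (P / R) (Q / S) a * (R ^+ n * S ^+ n).
Proof.
move=> sa sai nR nS; rewrite (eval2E j _ _ sa sai) mulr_suml; apply: eq_bigr => i _.
rewrite mulr_suml; apply: eq_bigr => l _.
rewrite -(exprV_mul nR (ltnW (ltn_ord l))) -(exprV_mul nS (ltnW (ltn_ord i))) !exprMn.
move: (_ ^+ _) (_ ^+ _) (_ ^+ _) (_ ^+ _) (_ ^+ _) (_ ^+ _) => a1 a2 a3 a4 a5 a6; ring.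
Qed.

(** A nonzero minor of size 2 expresses that P/R is not constant by one polynomial inequality in the
    coefficients, which a specialization can be asked to preserve. *)
Definition nonproportional (B : nzRingType) (P R : {poly B}) (n : nat) : Prop :=
  exists i l : 'I_n, P`_i * R`_l - P`_l * R`_i != 0.

Lemma morph_mulK (R : comNzRingType) (M : fieldType) (g : {rmorphism R -> M}) c r :
  g r != 0 -> g (c * r) / g r = g c.
Proof. by move=> nr; rewrite rmorphM mulfK. Qed.

Section FiberParametrization.
Variable k : closedFieldType.
Local Notation A := {poly {poly k}}.
Local Notation M := {fraction {poly k}}.
Local Notation "x %:F" := (FracField.tofrac x).
Variable F : A.

(** The added 1 absorbs the subtraction of a constant from [F], so one number serves for all
    values. *)
Definition param_degree := (maxn (size F).+1 (size (swapXY F)).+1).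

Lemma param_degree_coef i : (size (F`_i)%R <= param_degree)%N.
Proof.
have := max_size_coefXY F i; rewrite sizeYE => h; apply: leq_trans h _.
by rewrite /param_degree; apply: leq_trans (leq_maxr _ _); apply: leqnSn.
Qed.

(** This is F(P/R, Q/S) = lam with denominators cleared; it makes sense over any commutative ring
    and is preserved by ring morphisms. *)
Definition is_parametrization (B : comNzRingType) (j : k -> B) (lam : B) (P R Q S : {poly B}) :=
  homogenize (fun c => (j c)%:P) param_degree F P R Q S = lam%:P * (R ^+ param_degree * S ^+ param_degree).

Lemma nonproportional_or_constant (P R : {poly k}) n : R != 0 -> (size P <= n)%N -> (size R <= n)%N ->
  nonproportional P R n \/ exists c : k, P = c *: R.
Proof.
move=> nR sP sR; case: (pselect (nonproportional P R n)) => [|h]; [by left | right].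
have ln : ((size R).-1 < n)%N by apply: leq_trans sR; rewrite prednK // size_poly_gt0.
exists (P`_(size R).-1 / lead_coef R); apply/polyP => i; rewrite coefZ.
have nl : lead_coef R != 0 by rewrite lead_coef_eq0.
case: (ltnP i n) => hi; last first.
  by rewrite (nth_default _ (leq_trans sP hi)) (nth_default _ (leq_trans sR hi)) mulr0.
apply: (mulIf nl); rewrite mulrAC divfK // lead_coefE.
apply/eqP; rewrite -subr_eq0; apply: contrapT => /negP hne; apply: h.
by exists (Ordinal hi), (Ordinal ln).
Qed.

(** The degree bound is applied to both coordinates, to the second after exchanging the variables.
    The coordinates cannot both be constant: all values of [psi] would then be constant, although T
    is a quotient of two of them. *)
Lemma fiber_parametrization (lam : k) : F - cst2 lam != 0 -> frac_quot_rational (F - cst2 lam) ->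
  exists P R Q S : {poly k}, [/\ R != 0, S != 0, is_parametrization id lam P R Q S &
    [/\ (size P <= param_degree)%N, (size R <= param_degree)%N,
        (size Q <= param_degree)%N, (size S <= param_degree)%N &
    nonproportional P R param_degree \/ nonproportional Q S param_degree]].
Proof.
move=> nG [psi [hc [hker gen]]].
have G0 : psi (F - cst2 lam) = 0 by apply/hker; exists 1; rewrite mul1r.
have [a [b [nb eT]]] := gen 'X%:F.
have [P [R [nR eX sP sR]]] := coordinate_degree_bound hc nG G0 nb eT.
pose psi' : {rmorphism A -> M} := psi \o swapXY.
have hc' c : psi' ((c%:P)%:P) = (c%:P)%:F.
  by rewrite /= swapXY_polyC map_polyC /= hc.
have nG' : swapXY (F - cst2 lam) != 0 by rewrite swapXY_eq0.
have G0' : psi' (swapXY (F - cst2 lam)) = 0 by rewrite /= swapXYK.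
have nb' : psi' (swapXY b) != 0 by rewrite /= swapXYK.
have eT' : 'X%:F = psi' (swapXY a) / psi' (swapXY b) by rewrite /= !swapXYK.
have [Q [S [nS eY sQ sS]]] := coordinate_degree_bound hc' nG' G0' nb' eT'.
have eY' : psi 'X = Q%:F / S%:F by rewrite -eY /= swapXY_polyC map_polyX.
pose j : {rmorphism k -> M} := @FracField.tofrac {poly k} \o @polyC k.
have hj c : psi ((c%:P)%:P) = j c by apply: hc.
have nRF : R%:F != 0 by rewrite tofrac_eq0.
have nSF : S%:F != 0 by rewrite tofrac_eq0.
have sF : (size F <= param_degree)%N by apply: leq_trans (leq_maxl _ _); apply: leqnSn.
have size_cst (G : A) : (size (G - cst2 lam)%R <= (size G).+1)%N.
  apply: leq_trans (size_polyD _ _) _; rewrite size_polyN geq_max leqnSn /=.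
  exact: leq_trans (size_polyC_leq1 _) _.
have sG : (size (F - cst2 lam)%R <= param_degree)%N.
  exact: leq_trans (size_cst _) (leq_maxl _ _).
have sG' : (size (swapXY (F - cst2 lam)) <= param_degree)%N.
  have -> : swapXY (F - cst2 lam) = swapXY F - cst2 lam.
    have e1 : swapXY (cst2 lam) = cst2 lam by rewrite /cst2 swapXY_polyC map_polyC.
    by rewrite -[in RHS]e1; exact: (raddfB (@swapXY k) F (cst2 lam)).
  exact: leq_trans (size_cst _) (leq_maxr _ _).
exists P, R, Q, S; split=> //; last first.
  split; try by [apply: leq_trans sG | apply: leq_trans sG'].
  case: (@nonproportional_or_constant P R param_degree nR) => [||h|[c eP]].
  - exact: leq_trans sG.
  - exact: leq_trans sG.
  - by left.
  case: (@nonproportional_or_constant Q S param_degree nS) => [||h|[d eQ]].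
  - exact: leq_trans sG'.
  - exact: leq_trans sG'.
  - by right.
  exfalso.
  have ePX : psi 'X%:P = j c by rewrite eX eP -mul_polyC; exact: morph_mulK nRF.
  have eQY : psi 'X = j d by rewrite eY' eQ -mul_polyC; exact: morph_mulK nSF.
  have val z : psi z = j (eval2 idfun c d z).
    rewrite (eval2_unique _ hj) ePX eQY.
    pose phi : {rmorphism A -> M} := j \o eval2 idfun c d.
    have hphi e : phi ((e%:P)%:P) = j e by rewrite /phi /= eval2_cst.
    by rewrite -[RHS]/(phi z) (eval2_unique _ hphi) /phi /= eval2_X eval2_Y.
  have : 'X%:F = j (eval2 idfun c d a / eval2 idfun c d b) by rewrite eT !val fmorph_div.
  move=> /eqP; rewrite tofrac_eq => /eqP /(congr1 (fun p : {poly k} => size p)).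
  by rewrite size_polyX size_polyC; case: (_ != 0).
rewrite /is_parametrization; apply/eqP; rewrite -tofrac_eq; apply/eqP.
rewrite (@homogenize_morph _ _ _ _ _ j) //.
rewrite (@homogenizeE _ _ j _ _ _ _ _ _ sF param_degree_coef nRF nSF) -eX -eY' -(eval2_unique F hj).
have -> : psi F = j lam.
  by apply/eqP; rewrite -subr_eq0 -hj -rmorphB; apply/eqP.
by rewrite !rmorphM !rmorphXn.
Qed.

End FiberParametrization.

Record ultrafilter_on (I : Type) :=
  UltrafilterOn { ultra_sets : set_system I; ultra_sets_ultra : UltraFilter ultra_sets }.

Definition index_function (I : pointedType) (k : closedFieldType) : Type := I -> k.
HB.instance Definition _ I k := GRing.ComNzRing.copy (index_function I k) (I -> k).

(** * Ultrapowers and specialization *)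

Section Ultrapower.
Variables (I : pointedType) (k : closedFieldType) (U : ultrafilter_on I).
Local Notation R := (index_function I k).

Let UF := ultra_sets_ultra U.
Let FU : Filter (ultra_sets U). Proof. exact: (@filter_filter _ _ (@ultra_proper _ _ UF)). Qed.
Local Existing Instance FU.

Lemma ultra_contrary (P : I -> Prop) : ~ ultra_sets U [set i | P i]%classic <-> ultra_sets U [set i | ~ P i]%classic.
Proof.
split=> [h|h h']; first by case: (in_ultra_setVsetC [set i | P i]%classic UF).
have UPP : ultra_sets U ([set i | P i] `&` [set i | ~ P i])%classic by apply: filterI.
by have [i [/= Pi nPi]] := @filter_ex _ _ (@ultra_proper _ _ UF) _ UPP.
Qed.

Definition ultra_ideal : {pred R} := fun f => `[< ultra_sets U [set i | f i = 0]%classic >].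

Lemma ultra_ideal_closed : idealr_closed ultra_ideal.
Proof.
split; rewrite ?unfold_in.
- by apply/asboolP; apply: filterE.
- apply/asboolP/ultra_contrary; apply: filterE => i; apply/eqP; exact: oner_neq0.
- move=> a f g; rewrite !unfold_in => /asboolP Uf /asboolP Ug; apply/asboolP.
  apply: filterS2 Uf Ug => i /= fi gi.
  by rewrite /GRing.add /GRing.mul /= fi gi mulr0 addr0.
Qed.

HB.instance Definition _ := isIdealr.Build R ultra_ideal ultra_ideal_closed.

Definition ultrapower := {ideal_quot ultra_ideal}.
HB.instance Definition _ := GRing.ComNzRing.on ultrapower.

Definition ultra_class : R -> ultrapower := \pi_ultrapower%qT.
HB.instance Definition _ := GRing.RMorphism.copy ultra_class (\pi_ultrapower%qT : R -> ultrapower).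

Lemma ultra_class_eq0 (f : R) : ultra_class f = 0 <-> ultra_sets U [set i | f i = 0]%classic.
Proof.
rewrite -(rmorph0 ultra_class); split=> [/eqP|h]; last apply/eqP.
  by rewrite -Quotient.idealrBE subr0 => /asboolP.
by rewrite -Quotient.idealrBE subr0; apply/asboolP.
Qed.

Lemma ultra_class_eq (f g : R) : ultra_class f = ultra_class g <-> ultra_sets U [set i | f i = g i]%classic.
Proof.
have e : ultra_class (f - g) = ultra_class f - ultra_class g by exact: rmorphB.
have e0 : ultra_class f = ultra_class g <-> ultra_class (f - g) = 0.
  by rewrite e; split=> [->|/eqP]; rewrite ?subrr // subr_eq0 => /eqP.
split=> [/e0/ultra_class_eq0|h]; last apply/e0/ultra_class_eq0.
  by apply: filterS => i /= /eqP; rewrite subr_eq0 => /eqP.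
by apply: filterS h => i /= fg; apply/eqP; rewrite subr_eq0; apply/eqP.
Qed.

Lemma ultra_class_surj (z : ultrapower) : exists f, z = ultra_class f.
Proof. by exists (repr z); rewrite /ultra_class reprK. Qed.

Definition ultra_inv (z : ultrapower) : ultrapower := ultra_class (fun i => (repr z i)^-1).

Lemma ultra_mulVf z : z != 0 -> ultra_inv z * z = 1.
Proof.
move=> nz; have ez : z = ultra_class (repr z) by rewrite /ultra_class reprK.
rewrite [X in _ * X]ez -rmorphM -(rmorph1 ultra_class); apply/ultra_class_eq.
have : ~ ultra_sets U [set i | repr z i = 0]%classic.
  by move=> h; move/eqP: nz; apply; rewrite ez; apply/ultra_class_eq0.
by move/ultra_contrary; apply: filterS => i /= /eqP ni; rewrite /GRing.mul /= mulVf.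
Qed.

Lemma ultra_inv0 : ultra_inv 0 = 0.
Proof.
apply/ultra_class_eq0; have : ultra_class (repr (0 : ultrapower)) = 0 by rewrite /ultra_class reprK.
by move/ultra_class_eq0; apply: filterS => i /= ->; rewrite invr0.
Qed.

HB.instance Definition _ := GRing.ComNzRing_isField.Build ultrapower ultra_mulVf ultra_inv0.

(** Roots are chosen in [k] index by index, and the equation then holds at every index. *)
Lemma ultra_closed : GRing.closed_field_axiom ultrapower.
Proof.
move=> n P n0; have [p hp] := choice (fun i => ultra_class_surj (P i)).
have [x hx] := choice (fun i : I => solve_monicpoly (fun l => p l i) n0).
exists (ultra_class x); rewrite -rmorphXn.
under eq_bigr => l _ do rewrite hp -rmorphXn -rmorphM.
rewrite -rmorph_sum; apply/ultra_class_eq; apply: filterE => i /=.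
have pw m : (x ^+ m : R) i = x i ^+ m by elim: m => [|m IH]; rewrite ?expr0 // !exprS -IH.
rewrite pw hx fct_sumE; apply: eq_bigr => l _.
by rewrite -[RHS]/(p l i * (x ^+ l : R) i) pw.
Qed.

HB.instance Definition _ := Field_isAlgClosed.Build ultrapower ultra_closed.

End Ultrapower.

(** * Algebraic closure of a subfield inside an algebraically closed field *)

Section RelativeAlgebraicClosure.
Variables (K : fieldType) (Omega : closedFieldType) (iota : {rmorphism K -> Omega}).

Definition algebraic_elements : {pred Omega} := fun w => `[< algebraicOver iota w >].

Lemma algebraic_elements_divring : divring_closed algebraic_elements.
Proof.
split; rewrite ?unfold_in.
- by apply/asboolP; apply: algebraic1.
- by move=> x y; rewrite !unfold_in => /asboolP hx /asboolP hy; apply/asboolP/algebraic_sub.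
- by move=> x y; rewrite !unfold_in => /asboolP hx /asboolP hy; apply/asboolP/algebraic_div.
Qed.
HB.instance Definition _ := GRing.isDivringClosed.Build Omega algebraic_elements
  algebraic_elements_divring.

Definition relative_closure := {w : Omega | w \in algebraic_elements}.
HB.instance Definition _ := SubChoice.on relative_closure.
HB.instance Definition _ := [SubChoice_isSubIntegralDomain of relative_closure by <:].
HB.instance Definition _ := [SubIntegralDomain_isSubField of relative_closure by <:].
Lemma relative_closure_algebraic (z : relative_closure) : algebraicOver iota (val z).
Proof. by have := valP z; rewrite unfold_in => /asboolP. Qed.

Lemma relative_closure_closed : GRing.closed_field_axiom relative_closure.
Proof.
move=> n P n0; have [x hx] := solve_monicpoly (fun i => val (P i)) n0.
have ax : x \in algebraic_elements.
  rewrite unfold_in; apply/asboolP/integral_algebraic.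
  pose p : {poly Omega} := 'X^n - \poly_(i < n) val (P i).
  have mp : p \is monic.
    by rewrite monicE lead_coefDl ?lead_coefXn // size_polyXn size_polyN ltnS size_poly.
  apply: (integral_root_monic mp).
    by rewrite rootE hornerD hornerN hornerXn horner_poly hx subrr.
  apply/integral_poly => i; rewrite coefB coefXn coef_poly; apply: integral_sub.
    by case: (i == n); [apply: integral1 | apply: integral0].
  case: ifP => _; last exact: integral0.
  exact/integral_algebraic/relative_closure_algebraic.
pose z : relative_closure := exist _ x ax; have vz : val z = x by [].
pose v : {rmorphism relative_closure -> Omega} := val.
exists z; apply: val_inj; rewrite -[LHS]/(v (z ^+ n)) -[RHS]/(v _).
rewrite (rmorphXn v) (rmorph_sum v) -[v z]/x hx; apply: eq_bigr => i _.
by rewrite (rmorphM v) (rmorphXn v).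
Qed.

HB.instance Definition _ := Field_isAlgClosed.Build relative_closure relative_closure_closed.

Lemma relative_closure_lift : exists j : {rmorphism K -> relative_closure},
  (forall c, val (j c) = iota c) /\ forall z, algebraicOver j z.
Proof.
have mem c : iota c \in algebraic_elements.
  by rewrite unfold_in; apply/asboolP; apply: algebraic_id.
pose f c : relative_closure := exist _ (iota c) (mem c).
have fA : zmod_morphism f by move=> x y; apply: val_inj; rewrite /= rmorphB.
have fM : monoid_morphism f.
  by split=> [|x y]; apply: val_inj; rewrite /= ?rmorph1 ?rmorphM.
pose mA := GRing.isZmodMorphism.Build _ _ f fA.
pose mM := GRing.isMonoidMorphism.Build _ _ f fM.
pose j : {rmorphism K -> relative_closure} := HB.pack f mA mM.
exists j; split=> // z; have [p np rp] := relative_closure_algebraic z.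
exists p => //; rewrite -(fmorph_root (val : {rmorphism relative_closure -> Omega})).
by rewrite -map_poly_comp.
Qed.

End RelativeAlgebraicClosure.

Lemma closed_field_infinite (L : closedFieldType) (s : seq L) : exists x, x \notin s.
Proof.
have /closed_nonrootP [x] : \prod_(z <- s) ('X - z%:P) != 0 :> {poly L}.
  by rewrite monic_neq0 // monic_prod_XsubC.
by rewrite root_prod_XsubC; exists x.
Qed.

(** A Nullstellensatz with a prescribed inequality: the image of [ev] has an [L]-point where the
    image of [d] is nonzero. The algebra is given through a map to [Omega] and not as a subring, so
    that adjoining a generator just replaces [C] by [{poly C}]. *)
Definition specializable (L : closedFieldType) (Omega : fieldType) (C : comNzRingType)
    (iota : {rmorphism L -> C}) (ev : {rmorphism C -> Omega}) : Prop :=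
  forall d, ev d != 0 -> exists phi : {rmorphism C -> L},
    [/\ forall c, phi (iota c) = c, forall g, ev g = 0 -> phi g = 0 & phi d != 0].

Section SpecializationStep.
Variables (L : closedFieldType) (Omega : fieldType) (C : comNzRingType).
Variables (iota : {rmorphism L -> C}) (ev : {rmorphism C -> Omega}).
Hypothesis spec : specializable iota ev.
Variable b : Omega.
Let evb : {rmorphism {poly C} -> Omega} := horner_eval b \o map_poly ev.
Local Notation red := (map_poly ev).

Let evbE p : evb p = (red p).[b]. Proof. by []. Qed.

(** [ev] need not be injective, so the coefficients beyond the degree of the reduction are dropped;
    pseudo-division then works with a leading coefficient that survives in [Omega]. *)
Let truncate (p : {poly C}) : exists q : {poly C},
  [/\ red q = red p, size q = size (red p) & red p != 0 -> ev (lead_coef q) != 0].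
Proof.
pose q := \poly_(i < size (red p)) p`_i.
have rq : red q = red p.
  apply/polyP => i; rewrite !coef_map coef_poly /=; case: ltnP => // h.
  by rewrite rmorph0 -coef_map nth_default.
have sq : size q = size (red p).
  by apply/eqP; rewrite eqn_leq size_poly -{1}rq size_poly.
exists q; split=> // nr.
by rewrite lead_coefE sq -coef_map rq -lead_coefE lead_coef_eq0.
Qed.

Let pseudo (p q : {poly C}) : q != 0 -> exists n d r,
  lead_coef q ^+ n *: p = d * q + r /\ (size r < size q)%N.
Proof.
move=> nq; exists (Pdiv.Ring.rscalp p q), (Pdiv.Ring.rdivp p q), (Pdiv.Ring.rmodp p q).
by rewrite Pdiv.ComRing.rdivp_eq Pdiv.Ring.ltn_rmodp.
Qed.

Let evbZ c p : evb (c *: p) = ev c * evb p.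
Proof. by rewrite -mul_polyC rmorphM /= map_polyC /= /horner_eval hornerC. Qed.

Let evb_constant c : evb c%:P = ev c.
Proof. by rewrite /= map_polyC /= /horner_eval hornerC. Qed.

Let size_red p : (size (red p) <= size p)%N. Proof. exact: size_poly. Qed.

Let extend (phi : {rmorphism C -> L}) (x : L) : {rmorphism {poly C} -> L} :=
  horner_eval x \o map_poly phi.

Let extendC phi x c : extend phi x c%:P = phi c.
Proof. by rewrite /= map_polyC /= /horner_eval hornerC. Qed.

Let red0_extend (phi : {rmorphism C -> L}) x p : (forall g, ev g = 0 -> phi g = 0) ->
  red p = 0 -> extend phi x p = 0.
Proof.
move=> hphi rp; have -> : extend phi x p = (map_poly phi p).[x] by [].
suff -> : map_poly phi p = 0 by rewrite horner0.
apply/polyP => i; rewrite coef_map coef0 /=; apply: hphi.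
by rewrite -coef_map rp coef0.
Qed.

Let minimal_element (P : {poly C} -> Prop) :
  (exists p, P p) -> (forall p q, red q = red p -> P p -> P q) ->
  (forall p, P p -> red p != 0) ->
  exists q, [/\ P q, ev (lead_coef q) != 0, size q = size (red q) &
     forall p, P p -> (size q <= size p)%N].
Proof.
move=> [p0 Pp0] Pcong Pnz.
pose S n := exists2 p, P p & size (red p) = n.
have exS : exists n, `[< S n >] by exists (size (red p0)); apply/asboolP; exists p0.
have [n /asboolP [p Pp sp] minn] := ex_minnP exS.
have [q [rq sq lq]] := truncate p.
exists q; split.
- exact: Pcong Pp.
- exact: lq (Pnz _ Pp).
- by rewrite rq.
- move=> r Pr; rewrite sq sp; apply: leq_trans (size_red r).
  by apply: minn; apply/asboolP; exists r.
Qed.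

(** If [b] satisfies no relation, a point of [C] that keeps the leading coefficient of [d] is
    extended by any non-root of the specialized [d]. Otherwise let [q] be a relation of least
    degree. A multiple of [d] is congruent to some c in [C] that is nonzero in [Omega]; a point that
    keeps c and the leading coefficient of [q] is extended by a root of [q]. *)
Lemma specializable_adjoin :
  specializable (polyC \o iota : {rmorphism L -> {poly C}}) evb.
Proof.
move=> d nd.
case: (pselect (exists p, evb p = 0 /\ red p != 0)) => [exq|transc]; last first.
  have nrd : red d != 0 by apply: contra_neq nd => h; rewrite evbE h horner0.
  have nl : ev d`_(size (red d)).-1 != 0 by rewrite -coef_map -lead_coefE lead_coef_eq0.
  have [phi [h1 h2 h3]] := spec nl.
  have /closed_nonrootP [x nx] : map_poly phi d != 0.
    by apply/eqP => /polyP /(_ (size (red d)).-1); rewrite coef_map coef0 => /eqP; rewrite (negPf h3).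
  exists (extend phi x); split=> // [c|g g0]; first by rewrite extendC.
  apply: red0_extend => //; apply/eqP; apply: contrapT => /negP ng; apply: transc.
  by exists g.
have [q [[q0 nrq] lq sq minq]] : exists q, [/\ evb q = 0 /\ red q != 0, ev (lead_coef q) != 0,
    size q = size (red q) & forall p, evb p = 0 /\ red p != 0 -> (size q <= size p)%N].
  apply: minimal_element => // [p r e [h1 h2]|p []//].
  by rewrite evbE e -evbE.
have nq : q != 0 by apply: contra_neq nrq => ->; rewrite rmorph0.
have small r : evb r = 0 -> (size r < size q)%N -> red r = 0.
  move=> r0 sr; apply/eqP; apply: contrapT => /negP nr.
  by have := minq r (conj r0 nr); rewrite leqNgt sr.
(* Multiples of [d] that do not vanish at [b], modulo the relations. A constant member plays the
   role of a resultant of [d] and [q]. *)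
pose J w := evb w != 0 /\ exists s, evb (w - s * d) = 0.
have [w [[nw [s ws]] lw sw minw]] : exists w, [/\ J w, ev (lead_coef w) != 0,
    size w = size (red w) & forall p, J p -> (size w <= size p)%N].
  apply: minimal_element.
  - by exists d; split=> //; exists 1; rewrite mul1r subrr rmorph0.
  - by move=> p r e [h1 [s hs]]; split; [rewrite evbE e -evbE|exists s; move: hs; rewrite !rmorphB /= e].
  - by move=> p [h _]; apply: contra_neq h => e; rewrite evbE e horner0.
have nw0 : w != 0 by apply: contra_neq nw => ->; rewrite rmorph0.
have swq : (size w < size q)%N.
  have [n [a [r [e sr]]]] := pseudo d nq.
  apply: leq_ltn_trans sr; apply: minw.
  have er : evb r = ev (lead_coef q) ^+ n * evb d.
    by rewrite -rmorphXn -evbZ e rmorphD rmorphM q0 mulr0 add0r.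
  split; first by rewrite er mulf_neq0 // expf_neq0.
  exists ((lead_coef q ^+ n)%:P).
  by rewrite rmorphB er rmorphM evb_constant rmorphXn subrr.
(* If [w] had positive degree, the remainder of [q] by [w] would vanish at [b] by minimality of [w],
   hence reduce to 0. The quotient would then be a relation for [b] of smaller degree than [q]. *)
have sw1 : size w = 1%N.
  apply/eqP; rewrite eqn_leq size_poly_gt0 nw0 andbT leqNgt; apply/negP => sw2.
  have [n [a [r [e sr]]]] := pseudo q nw0.
  have er : evb r = - (evb a * evb w).
    apply/eqP; rewrite -addr_eq0 addrC -rmorphM -rmorphD -e evbZ q0 mulr0 //.
  have r0 : evb r = 0.
    apply/eqP; apply: contrapT => /negP nr.
    have : (size w <= size r)%N.
      apply: minw; split=> //; exists (- a * s).
      rewrite rmorphB er -mulrA mulNr rmorphN opprK rmorphM.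
      have := ws; rewrite rmorphB => /eqP; rewrite subr_eq0 => /eqP ->.
      by rewrite addNr.
    by rewrite leqNgt sr.
  have rr : red r = 0 by apply: small => //; apply: ltn_trans swq.
  have ea : evb a = 0.
    move/eqP: er; rewrite r0 eq_sym oppr_eq0 mulf_eq0 (negPf nw) orbF => /eqP //.
  have e' : ev (lead_coef w ^+ n) *: red q = red a * red w.
    by rewrite -map_polyZ e rmorphD rmorphM /= rr addr0.
  have nl : ev (lead_coef w ^+ n) != 0 by rewrite rmorphXn expf_neq0.
  have nra : red a != 0.
    apply/eqP => a0; move/eqP: e'; rewrite a0 mul0r scaler_eq0 (negPf nl) (negPf nrq) //.
  have nrw : red w != 0 by rewrite -size_poly_gt0 -sw; apply: ltn_trans sw2.
  have [a' [ra sa _]] := truncate a.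
  have : (size q <= size a')%N by apply: minq; rewrite evbE ra -evbE.
  have := congr1 (fun p : {poly Omega} => size p) e'.
  rewrite size_scale // -sq size_mul // -sa -sw.
  by move: sw2; move: (size w) (size q) (size a') => x y z; clear; lia.
have [c ew] : exists c, w = c%:P by exists w`_0; apply: size1_polyC; rewrite sw1.
have nc : ev c != 0 by move: nw; rewrite ew evb_constant.
(* Keeping the leading coefficient preserves the degree of [q], so that [q] acquires a root; keeping
   [c] forces the value of [d] to be nonzero. *)
have [phi [h1 h2 h3]] := spec (d := c * lead_coef q) ltac:(by rewrite rmorphM mulf_neq0).
move: h3; rewrite rmorphM mulf_eq0 negb_or => /andP[pc pl].
have spq : size (map_poly phi q) = size q.
  by apply: size_poly_eq; rewrite -lead_coefE.
have /closed_rootP [x rx] : size (map_poly phi q) != 1%N.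
  by rewrite spq; move: swq; rewrite sw1; case: (size q) => [|[]].
have eq0 : extend phi x q = 0 by apply/rootP.
have ker g : evb g = 0 -> extend phi x g = 0.
  move=> g0; have [n [a [r [e sr]]]] := pseudo g nq.
  have r0 : evb r = 0.
    by have := congr1 evb e; rewrite evbZ g0 mulr0 rmorphD rmorphM q0 mulr0 add0r => <-.
  have er : extend phi x r = 0 by apply: red0_extend => //; apply: small.
  have := congr1 (extend phi x) e.
  rewrite rmorphD rmorphM eq0 er mulr0 addr0 -mul_polyC rmorphM extendC rmorphXn => /eqP.
  by rewrite mulf_eq0 (negPf (expf_neq0 n pl)) => /eqP.
exists (extend phi x); split=> // [y|]; first by rewrite extendC.
have := ker _ ws; rewrite rmorphB rmorphM ew extendC => /eqP; rewrite subr_eq0 => /eqP e.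
by apply: contra_neq pc => z; rewrite e z mulr0.
Qed.

End SpecializationStep.

Lemma exists_specialization (L : closedFieldType) (Omega : fieldType)
    (inc : {rmorphism L -> Omega}) (bs : seq Omega) :
  exists (C : comNzRingType) (iota : {rmorphism L -> C}) (ev : {rmorphism C -> Omega}),
    [/\ forall c, ev (iota c) = inc c, forall b, b \in bs -> exists g, ev g = b
      & specializable iota ev].
Proof.
elim: bs => [|b bs [C [iota [ev [h1 h2 h3]]]]].
  exists L, idfun, inc; split=> // d nd; exists idfun; split=> // [g /eqP|].
    by rewrite fmorph_eq0 => /eqP.
  by move: nd; rewrite fmorph_eq0.
exists {poly C}, (polyC \o iota : {rmorphism L -> {poly C}}),
  (horner_eval b \o map_poly ev : {rmorphism {poly C} -> Omega}); split.
- by move=> c; rewrite /= map_polyC /= /horner_eval hornerC.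
- move=> c; rewrite inE => /orP[/eqP ->|/h2 [g <-]].
    by exists 'X; rewrite /= map_polyX /horner_eval hornerX.
  by exists g%:P; rewrite /= map_polyC /= /horner_eval hornerC.
- exact: specializable_adjoin.
Qed.

(** * Transfer of parametrizations along ring morphisms and to the ultrapower *)

Section ParametrizationTransfer.
Variables (k : closedFieldType) (F : {poly {poly k}}).

Definition param_defect (B : comNzRingType) (j : k -> B) (lam : B) (P R Q S : {poly B}) : {poly B} :=
  homogenize (fun c => (j c)%:P) (param_degree F) F P R Q S
  - lam%:P * (R ^+ param_degree F * S ^+ param_degree F).

Lemma param_defect0 (B : comNzRingType) (j : k -> B) lam P R Q S :
  is_parametrization F j lam P R Q S <-> param_defect j lam P R Q S = 0.
Proof.
by rewrite /param_defect; split=> [->|/eqP]; rewrite ?subrr // subr_eq0 => /eqP.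
Qed.

Lemma param_defect_morph (B C : comNzRingType) (g : {rmorphism B -> C}) (j : k -> B) (j' : k -> C)
    lam P R Q S : (forall c, g (j c) = j' c) ->
  map_poly g (param_defect j lam P R Q S) =
  param_defect j' (g lam) (map_poly g P) (map_poly g R) (map_poly g Q) (map_poly g S).
Proof.
move=> h; have e c : map_poly g c%:P = (g c)%:P by exact: map_polyC.
rewrite /param_defect rmorphB !rmorphM !rmorphXn /= e; congr (_ - _).
by apply: homogenize_morph => c; rewrite -h; exact: map_polyC.
Qed.

Lemma nonproportional_map (B C : nzRingType) (g : {rmorphism B -> C}) (P R : {poly B}) n i l :
  (i < n)%N -> (l < n)%N ->
  g (P`_i * R`_l - P`_l * R`_i) != 0 -> nonproportional (map_poly g P) (map_poly g R) n.
Proof.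
move=> hi hl h; exists (Ordinal hi), (Ordinal hl); rewrite !coef_map /=.
by rewrite -!rmorphM -rmorphB.
Qed.

End ParametrizationTransfer.

Section PointEvaluation.
Variables (I : pointedType) (k : closedFieldType).
Definition point_eval (i : I) (f : index_function I k) : k := f i.
Fact point_eval_additive i : zmod_morphism (point_eval i). Proof. by []. Qed.
Fact point_eval_multiplicative i : monoid_morphism (point_eval i). Proof. by []. Qed.
HB.instance Definition _ i := GRing.isZmodMorphism.Build _ _ (point_eval i) (point_eval_additive i).
HB.instance Definition _ i := GRing.isMonoidMorphism.Build _ _ (point_eval i) (point_eval_multiplicative i).

Definition constant_function (c : k) : index_function I k := fun=> c.
Fact constant_function_additive : zmod_morphism constant_function. Proof. by []. Qed.
Fact constant_function_multiplicative : monoid_morphism constant_function. Proof. by []. Qed.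
HB.instance Definition _ := GRing.isZmodMorphism.Build _ _ constant_function constant_function_additive.
HB.instance Definition _ := GRing.isMonoidMorphism.Build _ _ constant_function constant_function_multiplicative.
End PointEvaluation.

Section UltraTransfer.
Variables (I : pointedType) (k : closedFieldType) (U : ultrafilter_on I).
Let UF := ultra_sets_ultra U.
Let FU : Filter (ultra_sets U). Proof. exact: (@filter_filter _ _ (@ultra_proper _ _ UF)). Qed.
Local Existing Instance FU.

Lemma ultra_forall_lt n (P : nat -> I -> Prop) :
  (forall i, (i < n)%N -> ultra_sets U [set x | P i x]%classic) ->
  ultra_sets U [set x | forall i, (i < n)%N -> P i x]%classic.
Proof.
elim: n => [|n IH] h; first by apply: filterE => x i.
have h1 := IH (fun i hi => h i (ltnW hi)); have h2 := h n (ltnSn n).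
apply: filterS2 h1 h2 => x /= p1 p2 i; rewrite ltnS leq_eqVlt => /orP[/eqP ->|] //.
exact: p1.
Qed.

Lemma ultra_false : ~ ultra_sets U [set x | False]%classic.
Proof. by move=> h; have [x] := @filter_ex _ _ (@ultra_proper _ _ UF) _ h. Qed.

(** Here the uniform degree bound enters: polynomials of size at most [n], one per index, become a
    single polynomial over the ring of functions. *)
Definition family_poly n (p : I -> {poly k}) : {poly index_function I k} :=
  \poly_(i < n) ((fun x => (p x)`_i) : index_function I k).

Lemma family_poly_eval n (p : I -> {poly k}) x : (size (p x) <= n)%N ->
  map_poly (point_eval x) (family_poly n p) = p x.
Proof.
move=> sp; apply/polyP => i; rewrite coef_map coef_poly /=; case: ltnP => h.
  by [].
by rewrite rmorph0 nth_default // (leq_trans sp).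
Qed.

(** Vanishing involves finitely many coefficients, and an ultrafilter is closed under finite
    intersections. *)
Lemma ultra_poly_eq0 (p : {poly index_function I k}) :
  ultra_sets U [set x | map_poly (point_eval x) p = 0]%classic <->
  map_poly (@ultra_class I k U) p = 0.
Proof.
split=> [h|h].
  apply/polyP => i; rewrite coef_map coef0 /=; apply/ultra_class_eq0.
  by apply: filterS h => x /= /polyP /(_ i); rewrite coef_map coef0.
have h' i : (i < size p)%N -> ultra_sets U [set x | (p`_i : index_function I k) x = 0]%classic.
  by move=> _; apply/ultra_class_eq0; rewrite -[LHS]coef_map h coef0.
apply: filterS (ultra_forall_lt h') => x /= hx; apply/polyP => i; rewrite coef_map coef0.
by case: (ltnP i (size p)) => hi; [apply: hx | rewrite nth_default // rmorph0].
Qed.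

End UltraTransfer.

Lemma lift_poly (C : comNzRingType) (Omega : fieldType) (ev : {rmorphism C -> Omega}) (p : {poly Omega}) :
  (forall b, b \in (p : seq Omega) -> exists g, ev g = b) -> exists q, map_poly ev q = p.
Proof.
move=> h; have ex i : exists g, ev g = p`_i.
  case: (ltnP i (size p)) => hi; first by apply: h; apply: mem_nth.
  by exists 0; rewrite rmorph0 nth_default.
have [c hc] := choice ex; exists (\poly_(i < size p) c i); apply/polyP => i.
rewrite coef_map coef_poly /=; case: ltnP => hi; first exact: hc.
by rewrite rmorph0 nth_default.
Qed.

Lemma morph_prod3_neq0 (C : comNzRingType) (L : fieldType) (phi : {rmorphism C -> L}) a b c :
  phi (a * b * c) != 0 <-> [/\ phi a != 0, phi b != 0 & phi c != 0].
Proof.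
rewrite !rmorphM !mulf_eq0 !negb_or; split=> [/andP[/andP[]]|[-> -> ->]] //.
Qed.

(** The values of F themselves index the ultraproduct; the base point is only what the pointed
    structure asks for. *)
Definition carrier (k : closedFieldType) : Type := k.
HB.instance Definition _ k := Choice.copy (carrier k) k.
HB.instance Definition _ k := isPointed.Build (carrier k) (0 : k).

(** Cofinite sets form a proper filter because [k] is infinite. They make the exceptional values
    negligible and the class of the identity different from every constant. *)
Lemma exists_cofinite_ultrafilter (k : closedFieldType) : exists U : ultrafilter_on (carrier k),
  forall s : seq k, ultra_sets U [set x : carrier k | (x : k) \notin s]%classic.
Proof.
pose G : set_system (carrier k) := [set A | exists s : seq k, forall x : k, x \notin s -> A x]%classic.
have PG : ProperFilter G.
  apply: Build_ProperFilter_ex.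
    by move=> A [s hs]; have [x xs] := closed_field_infinite s; exists x; apply: hs.
  split.
  - by exists [::].
  - move=> A B [s hs] [t ht]; exists (s ++ t) => x; rewrite mem_cat negb_or => /andP[xs xt].
    by split; [apply: hs | apply: ht].
  - by move=> A B sAB [s hs]; exists s => x /hs /sAB.
have [H [UH sGH]] := ultraFilterLemma PG.
by exists (UltrafilterOn UH) => s; apply: sGH; exists s.
Qed.

Section GenericParametrization.
Variables (k : closedFieldType) (F : {poly {poly k}}).
Local Notation K := {fraction {poly k}}.
Local Notation "x %:F" := (FracField.tofrac x).
Local Notation kp := (carrier k).
Variable U : ultrafilter_on kp.
Hypothesis cofU : forall s : seq k, ultra_sets U [set x : kp | (x : k) \notin s]%classic.
Local Notation Omega := (ultrapower k U).
Local Notation pi := (@ultra_class _ k U).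
Local Notation cst := (@constant_function (carrier k) k).
Let idf : index_function kp k := fun x => x.

Let pi_cst : {rmorphism k -> Omega} := pi \o cst.
Let base0 : {rmorphism {poly k} -> Omega} := horner_eval (pi idf) \o map_poly pi_cst.

(** The class of the identity function is transcendental over [k]: each X - alpha vanishes at a
    single index only, and every polynomial over [k] is a product of such factors. This class takes
    the place of the generic value of F. *)
Let base0_inj p : base0 p = 0 -> p = 0.
Proof.
have [//|np] := eqVneq p 0; move=> e; exfalso; move: e; apply/eqP.
elim/poly_closed_ind: p / np => [c nc|alpha p _ IH].
  rewrite /= map_polyC /= /horner_eval hornerC; apply/eqP => /ultra_class_eq0.
  have -> : [set i | cst c i = 0]%classic = [set i | False]%classic.
    by apply/predeqP => i; split=> // h; move/eqP: nc; apply.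
  exact: ultra_false.
rewrite rmorphM mulf_neq0 // rmorphB /= map_polyX map_polyC /= /horner_eval hornerX hornerC.
rewrite subr_eq0; apply/eqP => /ultra_class_eq h.
have h' := cofU [:: alpha].
apply: (@ultra_false _ U).
have FU : Filter (ultra_sets U) := @filter_filter _ _ (@ultra_proper _ _ (ultra_sets_ultra U)).
by apply: filterS2 h h' => i /= e; rewrite (e : (i : k) = alpha) inE eqxx.
Qed.

Let generic_nonproportional n (A B : kp -> {poly k}) :
  ultra_sets U [set x | nonproportional (A x) (B x) n]%classic ->
  nonproportional (map_poly pi (family_poly n A)) (map_poly pi (family_poly n B)) n.
Proof.
move=> hU; apply: contrapT => hn; apply: (@ultra_false _ U).
have FU : Filter (ultra_sets U) := @filter_filter _ _ (@ultra_proper _ _ (ultra_sets_ultra U)).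
have h i : (i < n)%N -> ultra_sets U [set x | forall l, (l < n)%N ->
    (A x)`_i * (B x)`_l - (A x)`_l * (B x)`_i = 0]%classic.
  move=> hi; apply: ultra_forall_lt => l hl.
  set a := family_poly n A in hn *; set b := family_poly n B in hn *.
  have z : pi (a`_i * b`_l - a`_l * b`_i) = 0.
    apply/eqP; apply: contrapT => /negP nz; apply: hn.
    exact: nonproportional_map nz.
  move/ultra_class_eq0: z; apply: filterS => x /=.
  by rewrite !coef_poly hi hl.
have h2 := ultra_forall_lt h.
by apply: filterS2 h2 hU => x /= z [i [l]]; rewrite z ?eqxx.
Qed.

Let generic_family (E : seq k) (P R Q S : kp -> {poly k}) :
  (forall x : k, x \notin E -> [/\ R x != 0, S x != 0, is_parametrization F id x (P x) (R x) (Q x) (S x) &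
    [/\ (size (P x) <= param_degree F)%N, (size (R x) <= param_degree F)%N,
        (size (Q x) <= param_degree F)%N, (size (S x) <= param_degree F)%N &
    nonproportional (P x) (R x) (param_degree F) \/ nonproportional (Q x) (S x) (param_degree F)]]) ->
  let n := param_degree F in
  let gen p := map_poly pi (family_poly n p) in
  [/\ gen R != 0, gen S != 0, is_parametrization F pi_cst (pi idf) (gen P) (gen R) (gen Q) (gen S) &
    nonproportional (gen P) (gen R) n \/ nonproportional (gen Q) (gen S) n].
Proof.
move=> h n gen.
have FU : Filter (ultra_sets U) := @filter_filter _ _ (@ultra_proper _ _ (ultra_sets_ultra U)).
have nz (T : kp -> {poly k}) : (forall x : k, x \notin E -> T x != 0 /\ (size (T x) <= n)%N) -> gen T != 0.
  move=> hT; apply/eqP => /ultra_poly_eq0 z; apply: (@ultra_false _ U).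
  apply: filterS2 z (cofU E) => x /= z xE; have [nT sT] := hT x xE.
  by rewrite family_poly_eval // in z; rewrite z eqxx in nT.
split.
- by apply: nz => x /h [? ? _ []].
- by apply: nz => x /h [? ? _ []].
- apply/param_defect0.
  have e := @param_defect_morph k F _ _ pi cst pi_cst idf (family_poly n P) (family_poly n R) (family_poly n Q) (family_poly n S) (fun c => erefl).
  rewrite -[LHS]e; apply/ultra_poly_eq0; apply: filterS (cofU E) => x /= /h [_ _ hx [sP sR sQ sS _]].
  rewrite (@param_defect_morph k F _ _ (point_eval x) cst id) //.
  by rewrite !family_poly_eval //; apply/param_defect0.
- have [hU|hU] : ultra_sets U [set x | nonproportional (P x) (R x) n]%classic \/
      ultra_sets U [set x | nonproportional (Q x) (S x) n]%classic.
    case: (pselect (ultra_sets U [set x | nonproportional (P x) (R x) n]%classic)) => hU; [by left | right].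
    move/ultra_contrary: hU => hU; apply: filterS2 hU (cofU E) => x /= hx /h [_ _ _ [_ _ _ _ []]] //.
  + by left; apply: generic_nonproportional.
  + by right; apply: generic_nonproportional.
Qed.

(** [L] is the algebraic closure of k(x) in the ultrapower, x being the class of the identity. The
    coefficients of the ultraproduct parametrization may lie outside [L]; they are specialized into
    [L], while the value x, already in [L], stays fixed. *)
Lemma generic_parametrization (E : seq k) :
  (forall lam : k, lam \notin E -> ring_irreducible (F - cst2 lam) /\ frac_quot_rational (F - cst2 lam)) ->
  exists (L : closedFieldType) (iota : {rmorphism K -> L}),
    (forall z, algebraicOver iota z) /\
    exists P R Q S : {poly L}, [/\ R != 0, S != 0,
      is_parametrization F (fun c => iota (c%:P)%:F) (iota 'X%:F) P R Q S &
      exists n, nonproportional P R n \/ nonproportional Q S n].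
Proof.
move=> hE.
have hfam (lam : k) : exists T : {poly k} * {poly k} * {poly k} * {poly k}, lam \notin E ->
    let P := T.1.1.1 in let R := T.1.1.2 in let Q := T.1.2 in let S := T.2 in
    [/\ R != 0, S != 0, is_parametrization F id lam P R Q S &
    [/\ (size P <= param_degree F)%N, (size R <= param_degree F)%N,
        (size Q <= param_degree F)%N, (size S <= param_degree F)%N &
    nonproportional P R (param_degree F) \/ nonproportional Q S (param_degree F)]].
  case: (boolP (lam \in E)) => lE; first by exists (0, 0, 0, 0).
  have [[nF _] rat] := hE _ lE.
  have [P [R [Q [S h]]]] := fiber_parametrization nF rat.
  by exists (P, R, Q, S).
have [T hT] := choice hfam.
pose n := param_degree F; pose gen p := map_poly pi (family_poly n p).
have := @generic_family E (fun x => (T x).1.1.1) (fun x => (T x).1.1.2) (fun x => (T x).1.2) (fun x => (T x).2).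
case=> [x /hT //|].
move: (map_poly pi _) (map_poly pi _) (map_poly pi _) (map_poly pi _) => Q P S R nR nS hp hn.
have [iota0 h0] := fraction_lift base0_inj.
pose L : closedFieldType := relative_closure iota0.
have [iota [hiota algL]] := relative_closure_lift iota0.
exists L, iota; split=> //.
pose inc : {rmorphism L -> Omega} := val.
have [C [e [ev [hev lift spec]]]] := exists_specialization inc (P ++ R ++ Q ++ S : seq Omega).
have [P' eP] : exists q, map_poly ev q = P by apply: lift_poly => b hb; apply: lift; rewrite !mem_cat hb ?orbT.
have [R' eR] : exists q, map_poly ev q = R by apply: lift_poly => b hb; apply: lift; rewrite !mem_cat hb ?orbT.
have [Q' eQ] : exists q, map_poly ev q = Q by apply: lift_poly => b hb; apply: lift; rewrite !mem_cat hb ?orbT.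
have [S' eS] : exists q, map_poly ev q = S by apply: lift_poly => b hb; apply: lift; rewrite !mem_cat hb ?orbT.
have nlR : ev R'`_(size R).-1 != 0 by rewrite -coef_map eR -lead_coefE lead_coef_eq0.
have nlS : ev S'`_(size S).-1 != 0 by rewrite -coef_map eS -lead_coefE lead_coef_eq0.
pose jC (c : k) : C := e (iota (c%:P)%:F).
have evj c : ev (jC c) = pi_cst c.
  rewrite /jC hev; transitivity (iota0 (c%:P)%:F); first exact: hiota.
  by rewrite h0 /= map_polyC /= /horner_eval hornerC.
have evX : ev (e (iota 'X%:F)) = pi idf.
  rewrite hev; transitivity (iota0 'X%:F); first exact: hiota.
  by rewrite h0 /= map_polyX /horner_eval hornerX.
have def0 : map_poly ev (param_defect F jC (e (iota 'X%:F)) P' R' Q' S') = 0.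
  by rewrite (param_defect_morph F _ _ _ _ _ evj) evX eP eR eQ eS; apply/param_defect0.
have conclude (phi : {rmorphism C -> L}) : (forall c, phi (e c) = c) ->
    (forall g, ev g = 0 -> phi g = 0) ->
    is_parametrization F (fun c => iota (c%:P)%:F) (iota 'X%:F) (map_poly phi P') (map_poly phi R')
      (map_poly phi Q') (map_poly phi S').
  move=> p1 p2; apply/param_defect0.
  have pj c : phi (jC c) = iota (c%:P)%:F by apply: p1.
  rewrite -[iota 'X%:F]p1 -(param_defect_morph F _ _ _ _ _ pj).
  by apply/polyP => i; rewrite coef_map coef0 /= p2 // -coef_map def0 coef0.
have nonzero (phi : {rmorphism C -> L}) (A : {poly C}) i : phi A`_i != 0 -> map_poly phi A != 0.
  by apply: contraNneq => /polyP /(_ i); rewrite coef_map coef0 /= => ->.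
have minor (A B : {poly C}) m : nonproportional (map_poly ev A) (map_poly ev B) m ->
    exists i l : 'I_m, ev (A`_i * B`_l - A`_l * B`_i) != 0.
  by move=> [i [l h]]; exists i, l; rewrite rmorphB !rmorphM -!coef_map.
case: hn => hn.
- have [i [l nm]] := minor P' R' n ltac:(by rewrite eP eR).
  (* A single product collects what must stay nonzero: a coefficient of each denominator and one
     minor. *)
  have [phi [p1 p2]] := spec (R'`_(size R).-1 * S'`_(size S).-1 * (P'`_i * R'`_l - P'`_l * R'`_i))
     (proj2 (morph_prod3_neq0 _ _ _ _) (And3 nlR nlS nm)).
  move=> /morph_prod3_neq0 [q1 q2 q3].
  exists (map_poly phi P'), (map_poly phi R'), (map_poly phi Q'), (map_poly phi S'); split.
  + exact: nonzero q1.
  + exact: nonzero q2.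
  + exact: conclude.
  + by exists n; left; exact: nonproportional_map q3.
- have [i [l nm]] := minor Q' S' n ltac:(by rewrite eQ eS).
  have [phi [p1 p2]] := spec (R'`_(size R).-1 * S'`_(size S).-1 * (Q'`_i * S'`_l - Q'`_l * S'`_i))
     (proj2 (morph_prod3_neq0 _ _ _ _) (And3 nlR nlS nm)).
  move=> /morph_prod3_neq0 [q1 q2 q3].
  exists (map_poly phi P'), (map_poly phi R'), (map_poly phi Q'), (map_poly phi S'); split.
  + exact: nonzero q1.
  + exact: nonzero q2.
  + exact: conclude.
  + by exists n; right; exact: nonproportional_map q3.
Qed.

End GenericParametrization.

(** * Embedding of Frac A into L(T) *)

Lemma clear_denominators (R : idomainType) (p : {poly {fraction R}}) : p != 0 ->
  exists q : {poly R}, q != 0 /\ exists2 d : {fraction R}, d != 0 & map_poly (@FracField.tofrac R) q = d *: p.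
Proof.
move=> np; have ex i : exists ab : R * R, ab.2 != 0 /\ p`_i = FracField.tofrac ab.1 / FracField.tofrac ab.2.
  by have [a [b [nb e]]] := fraction_ratio (p`_i); exists (a, b).
have [ab hab] := choice ex.
pose d := \prod_(i < size p) (ab i).2.
have nd : d != 0 by apply/prodf_neq0 => i _; case: (hab i).
pose q := \poly_(i < size p) ((ab i).1 * \prod_(l < size p | l != i :> nat) (ab l).2).
have eq : map_poly (@FracField.tofrac R) q = FracField.tofrac d *: p.
  have cm (s : {poly R}) i : (map_poly (@FracField.tofrac R) s)`_i = FracField.tofrac s`_i.
    exact: coef_map.
  apply/polyP => i; rewrite cm coefZ coef_poly; case: ltnP => hi; last first.
    by rewrite tofrac0 nth_default // mulr0.
  have [nb ->] := hab i; rewrite /d [X in _ = FracField.tofrac X * _](bigD1 (Ordinal hi)) // !tofracM.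
  by rewrite [RHS]mulrC mulrA divfK ?tofrac_eq0.
exists q; split; last by exists (FracField.tofrac d); rewrite ?tofrac_eq0.
apply: contra_neq np => q0; move: eq; rewrite q0 rmorph0 => /esym/eqP.
by rewrite scaler_eq0 tofrac_eq0 (negPf nd) => /eqP.
Qed.

Lemma poly_morph_unique (R B : comNzRingType) (f g : {rmorphism {poly R} -> B}) p :
  (forall c, f c%:P = g c%:P) -> f 'X = g 'X -> f p = g p.
Proof.
move=> hc hX; elim/poly_ind: p => [|p c IH]; first by rewrite !rmorph0.
by rewrite !rmorphD !rmorphM IH hc hX.
Qed.

Lemma eval2_swap (k : fieldType) (B : comNzRingType) (j : {rmorphism k -> B}) x y a :
  eval2 j x y a = eval2 j y x (swapXY a).
Proof.
pose psi : {rmorphism {poly {poly k}} -> B} := eval2 j y x \o swapXY.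
have h c : psi ((c%:P)%:P) = j c by rewrite /psi /= swapXY_polyC map_polyC /= eval2_cst.
rewrite -[RHS]/(psi a) (eval2_unique a h) /psi /= swapXY_polyC map_polyX swapXY_X.
by rewrite eval2_X eval2_Y.
Qed.

Definition eval_morph (k : closedFieldType) (F : poly2 k) : {rmorphism {poly k} -> poly2 k} :=
  horner_eval F \o map_poly (polyC \o polyC).

Section Embedding.
Variables (k : closedFieldType) (F : {poly {poly k}}) (L : closedFieldType).
Local Notation A := {poly {poly k}}.
Local Notation K := {fraction {poly k}}.
Local Notation E := {fraction A}.
Local Notation M := {fraction {poly L}}.
Local Notation "x %:F" := (FracField.tofrac x).
Variable iota : {rmorphism K -> L}.
Hypothesis algL : forall l, algebraicOver iota l.

Definition const_morph : {rmorphism L -> M} := @FracField.tofrac {poly L} \o @polyC L.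

Definition base_morph : {rmorphism k -> M} :=
  const_morph \o iota \o @FracField.tofrac {poly k} \o @polyC k.

Variables X Y : M.
Hypothesis hXY : eval2 base_morph X Y F = const_morph (iota 'X%:F).

(** A polynomial over [L] splits over [L], so it has no further roots in a larger field. *)
Lemma algebraic_constant (z : M) : algebraicOver const_morph z -> exists c, z = const_morph c.
Proof.
move=> [p np]; have [r ->] := closed_field_poly_normal p.
rewrite map_polyZ rootZ ?fmorph_eq0 ?lead_coef_eq0 // rmorph_prod /=.
elim: r => [|x r IH]; first by rewrite big_nil (negPf (root1 _)).
rewrite big_cons rootM => /orP[|/IH //].
have -> : map_poly const_morph ('X - x%:P) = 'X - (const_morph x)%:P.
    exact: map_polyXsubC.
by rewrite root_XsubC => /eqP ->; exists x.
Qed.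

Let eval_iota (c : {poly k}) : (map_poly base_morph c).[const_morph (iota 'X%:F)] = const_morph (iota c%:F).
Proof.
pose f : {rmorphism {poly k} -> M} := horner_eval (const_morph (iota 'X%:F)) \o map_poly base_morph.
pose g : {rmorphism {poly k} -> M} := const_morph \o iota \o @FracField.tofrac {poly k}.
apply: (@poly_morph_unique _ _ f g) => [x|].
  by rewrite /f /= map_polyC /= /horner_eval hornerC.
by rewrite /f /= map_polyX /horner_eval hornerX.
Qed.

(** Suppose a nonzero [a] vanishes at (x, y). As [x] is not constant, it is transcendental over [k],
    so [y], and with it the value lam of [G], is algebraic over k(x). Since lam is transcendental
    over [k], exchanging the roles makes [x] algebraic over k(lam), hence constant: a
    contradiction. *)
Let embedding_inj_aux (x y : M) (G a : A) : (forall c, x <> const_morph c) ->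
  eval2 base_morph x y G = const_morph (iota 'X%:F) -> eval2 base_morph x y a = 0 -> a = 0.
Proof.
move=> nc hG ha; apply/eqP; apply: contrapT => /negP na.
pose g0 : {rmorphism {poly k} -> M} := horner_eval x \o map_poly base_morph.
have g0inj p : g0 p = 0 -> p = 0.
  move=> e; apply/eqP; apply: contrapT => /negP np.
  case: (@algebraic_constant x); last by move=> c; apply: nc.
  exists (map_poly (iota \o @FracField.tofrac {poly k} \o @polyC k) p); first by rewrite map_poly_eq0.
  by rewrite -map_poly_comp; apply/eqP.
have [g hg] := fraction_lift g0inj.
have ev b : eval2 base_morph x y b = (map_poly g (map_poly (@FracField.tofrac {poly k}) b)).[y].
  rewrite -map_poly_comp /eval2; congr (_.[y]); apply: eq_map_poly => c.
  by rewrite /= hg.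
have algy : algebraicOver g y.
  exists (map_poly (@FracField.tofrac {poly k}) a); last by rewrite rootE -ev ha.
  by rewrite -size_poly_eq0 size_map_inj_poly ?size_poly_eq0 ?rmorph0 // => u v /eqP; rewrite tofrac_eq => /eqP.
have algmu : algebraicOver g (const_morph (iota 'X%:F)).
  rewrite -hG ev; apply/integral_algebraic/integral_horner; last exact/integral_algebraic.
  by apply/integral_poly => i; rewrite coef_map; apply: integral_id.
case: algmu => p np rp; have [q [nq [d nd eq]]] := clear_denominators np.
have q0 : eval2 base_morph x (const_morph (iota 'X%:F)) q = 0.
  rewrite /eval2.
  have -> : (map_poly (fun c => (map_poly base_morph c).[x]) q) = map_poly g (map_poly (@FracField.tofrac {poly k}) q).
    by rewrite -map_poly_comp; apply: eq_map_poly => c; rewrite /= hg.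
  by rewrite eq map_polyZ hornerZ (rootP rp) mulr0.
(* The relation between x and lam is now read as a polynomial in x over k(lam). *)
move: q0; rewrite eval2_swap /eval2 => /eqP rx.
case: (@algebraic_constant x); last by move=> c; apply: nc.
exists (map_poly (iota \o @FracField.tofrac {poly k}) (swapXY q)).
  rewrite map_poly_comp map_poly_eq0 -size_poly_eq0 size_map_inj_poly ?rmorph0 //.
    by rewrite size_poly_eq0 swapXY_eq0.
  by move=> u v /eqP; rewrite tofrac_eq => /eqP.
rewrite -map_poly_comp rootE; apply/eqP; rewrite -[RHS](eqP rx); congr (_.[x]).
by apply: eq_map_poly => c; apply: esym; exact: eval_iota.
Qed.

Hypothesis nonconst : (forall c, X <> const_morph c) \/ (forall c, Y <> const_morph c).

Lemma embedding_inj a : eval2 base_morph X Y a = 0 -> a = 0.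
Proof.
case: nonconst => nc; first exact: embedding_inj_aux hXY.
move=> ha; apply/eqP; rewrite -swapXY_eq0; apply/eqP.
apply: (@embedding_inj_aux Y X (swapXY F)) => //; by rewrite -eval2_swap.
Qed.

Let eval2_evalF p : eval2 base_morph X Y (evalF F p) = const_morph (iota p%:F).
Proof.
pose f : {rmorphism {poly k} -> M} := eval2 base_morph X Y \o eval_morph F.
pose g : {rmorphism {poly k} -> M} := const_morph \o iota \o @FracField.tofrac {poly k}.
apply: (@poly_morph_unique _ _ f g) => [x|].
  by rewrite /f /= map_polyC /= /horner_eval hornerC eval2_cst.
by rewrite /f /= map_polyX /horner_eval hornerX hXY.
Qed.

(** L(T) is algebraic over Frac A: constants are algebraic over k(F), and T is a root of p - z q for
    a nonconstant coordinate z = p/q, a polynomial that is nonzero precisely because z is not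
    constant. *)
Lemma exists_embedding : exists (Theta : {rmorphism E -> M}) (kappa : {rmorphism K -> E}),
  [/\ forall c, Theta (kappa c) = const_morph (iota c),
      forall z, algebraicOver Theta z,
      forall p, kappa p%:F = (evalF F p)%:F &
      (forall c, Theta ('X%:P)%:F <> const_morph c) \/ (forall c, Theta 'X%:F <> const_morph c)].
Proof.
have [Theta hT] := fraction_lift embedding_inj.
pose k0 : {rmorphism {poly k} -> E} := @FracField.tofrac A \o eval_morph F.
have Tk0 p : Theta (k0 p) = const_morph (iota p%:F) by exact: etrans (hT _) (eval2_evalF p).
have k0inj p : k0 p = 0 -> p = 0.
  move=> e; have := Tk0 p; rewrite e rmorph0 => /esym/eqP.
  by rewrite !fmorph_eq0 tofrac_eq0 => /eqP.
have [kappa hk] := fraction_lift k0inj.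
have TK c : Theta (kappa c) = const_morph (iota c).
  have [a [b [nb ->]]] := fraction_ratio c.
  by rewrite !fmorph_div; congr (_ / _); rewrite (hk _); exact: Tk0.
have TX : Theta ('X%:P)%:F = X by exact: etrans (hT _) (eval2_X _ _ _).
have TY : Theta 'X%:F = Y by exact: etrans (hT _) (eval2_Y _ _ _).
have Lalg l : algebraicOver Theta (const_morph l).
  have [p np rp] := algL l; exists (map_poly kappa p); first by rewrite map_poly_eq0.
  rewrite -map_poly_comp (eq_map_poly (g := const_morph \o iota)); last by move=> c; exact: TK.
  by rewrite map_poly_comp fmorph_root.
have Talg : algebraicOver Theta ('X%:F : M).
  have [z [e [nz hz]]] : exists z e, (forall c, z <> const_morph c) /\ z = Theta e.
    by case: nonconst => nc; [exists X, ('X%:P)%:F | exists Y, 'X%:F].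
  have [p [q [nq ez]]] := fraction_ratio z.
  pose r := map_poly const_morph p - z *: map_poly const_morph q.
  have evT (s : {poly L}) : (map_poly const_morph s).['X%:F] = s%:F.
    pose f : {rmorphism {poly L} -> M} := horner_eval 'X%:F \o map_poly const_morph.
    apply: (@poly_morph_unique _ _ f (@FracField.tofrac {poly L})) => [x|].
      by rewrite /f /= map_polyC /= /horner_eval hornerC.
    by rewrite /f /= map_polyX /horner_eval hornerX.
  have nr : r != 0.
    apply/eqP => r0; have h := congr1 (fun s : {poly M} => s`_(size q).-1) r0.
    move: h; rewrite /= coefB coefZ !coef_map coef0 /= => /eqP; rewrite subr_eq0 => /eqP h.
    have nl : lead_coef q != 0 by rewrite lead_coef_eq0.
    have nlM : const_morph (lead_coef q) != 0 by rewrite fmorph_eq0.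
    apply: (nz (p`_(size q).-1 / lead_coef q)); rewrite fmorph_div; apply: (mulIf nlM).
    by rewrite divfK.
  apply/integral_algebraic; apply: (integral_root nr).
    rewrite rootE /r hornerD hornerN hornerZ !evT subr_eq0; apply/eqP.
    by rewrite ez divfK // tofrac_eq0.
  apply/integral_poly => i; rewrite coefB coefZ !coef_map; apply: integral_sub.
    exact/integral_algebraic/Lalg.
  by apply: integral_mul; [rewrite hz; apply: integral_id | exact/integral_algebraic/Lalg].
have alg_poly (s : {poly L}) : algebraicOver Theta s%:F.
  elim/poly_ind: s => [|s c IH]; first by rewrite tofrac0; apply: algebraic0.
  have h : algebraicOver Theta (c%:P)%:F := Lalg c.
  rewrite tofracD tofracM; exact (algebraic_add (algebraic_mul IH Talg) h).
exists Theta, kappa; split; last by rewrite TX TY.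
- exact: TK.
- move=> z; have [p [q [nq ->]]] := fraction_ratio z.
  exact (algebraic_div (alg_poly p) (alg_poly q)).
- exact: hk.
Qed.

End Embedding.

Lemma nonproportional_nonconstant (L : closedFieldType) (P R : {poly L}) n (c : L) : R != 0 ->
  nonproportional P R n -> FracField.tofrac P / FracField.tofrac R <> const_morph L c.
Proof.
move=> nR [i [l]] /eqP h e; apply: h.
have nRF : FracField.tofrac R != 0 by rewrite tofrac_eq0.
have : P = c%:P * R.
  apply/eqP; rewrite -tofrac_eq tofracM; apply/eqP.
  exact: etrans (esym (divfK nRF _)) (congr1 (fun z => z * _) e).
by rewrite mul_polyC => ->; rewrite !coefZ; ring.
Qed.

Lemma geometric_embedding (k : closedFieldType) (F : poly2 k) : generally_rational F ->
  exists (L : closedFieldType) (iota : {rmorphism {fraction {poly k}} -> L})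
    (Theta : {rmorphism fracA k -> {fraction {poly L}}})
    (kappa : {rmorphism {fraction {poly k}} -> fracA k}),
  [/\ forall l, algebraicOver iota l, forall c, Theta (kappa c) = const_morph L (iota c),
      forall z, algebraicOver Theta z,
      forall p, kappa (FracField.tofrac p) = inK (evalF F p) &
      (forall c, Theta (inK 'X%:P) <> const_morph L c) \/ (forall c, Theta (inK 'X) <> const_morph L c)].
Proof.
move=> [E hE]; have [U cofU] := exists_cofinite_ultrafilter k.
have [L [iota [algL [P [R [Q [S [nR nS hp [n hn]]]]]]]]] := generic_parametrization cofU hE.
exists L, iota.
have nRF : FracField.tofrac R != 0 by rewrite tofrac_eq0.
have nSF : FracField.tofrac S != 0 by rewrite tofrac_eq0.
pose X := FracField.tofrac P / FracField.tofrac R.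
pose Y := FracField.tofrac Q / FracField.tofrac S.
have hXY : eval2 (base_morph iota) X Y F = const_morph L (iota (FracField.tofrac 'X)).
  have sF : (size F <= param_degree F)%N by apply: leq_trans (leq_maxl _ _); apply: leqnSn.
  have := @homogenizeE _ _ (base_morph iota) (param_degree F) F _ (FracField.tofrac R) _ (FracField.tofrac S)
    sF (param_degree_coef F) nRF nSF.
  move=> /(_ (FracField.tofrac P) (FracField.tofrac Q)) h.
  have e1 := @homogenize_morph k {poly L} {fraction {poly L}} (@FracField.tofrac {poly L})
    (fun c => (iota (FracField.tofrac c%:P))%:P) (base_morph iota) (param_degree F) F P R Q S (fun c => erefl).
  have nz := mulf_neq0 (expf_neq0 (param_degree F) nRF) (expf_neq0 (param_degree F) nSF).
  apply: (mulIf nz); rewrite -[LHS]h -[LHS]e1.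
  apply: (etrans (congr1 (@FracField.tofrac {poly L}) hp)).
  by rewrite tofracM tofracM !tofracXn.
have hnc : (forall c, X <> const_morph L c) \/ (forall c, Y <> const_morph L c).
  by case: hn => hn; [left | right] => c; apply: nonproportional_nonconstant hn.
have [Theta [kappa [h1 h2 h3 h4]]] := exists_embedding algL hXY hnc.
by exists Theta, kappa; split.
Qed.

(** * Points of the line as valuations of a subfield *)

(* what is needed of the projective line over L with function field M and set of points Pl *)
Record line_places (L M : fieldType) (cM : L -> M) (Pl : eqType) (v : Pl -> M -> int) : Prop := {
  lp_dval : forall a, discrete_valuation (v a);
  lp_const : forall a c, c != 0 -> v a (cM c) = 0;
  lp_proper : forall a, exists z, z != 0 /\ v a z < 0;
  lp_support : forall z, z != 0 -> exists s : seq Pl, forall a, a \notin s -> v a z = 0;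
  lp_residue : forall a z, 0 <= v a z -> exists c, z = cM c \/ 0 < v a (z - cM c);
  lp_ring : forall V, valuation_ring V -> (forall c, V (cM c)) -> (exists z, ~ V z) ->
    exists a, forall z, V z <-> valuation_ring_of (v a) z;
  lp_sum0 : forall z (S : seq Pl), z != 0 -> uniq S ->
    (forall a, a \notin S -> v a z = 0) -> \sum_(a <- S) v a z = 0;
  lp_prescribed : forall (m : Pl -> int) (S : seq Pl), uniq S -> \sum_(a <- S) m a = 0 ->
    exists2 f : M, f != 0 & forall a, v a f = if a \in S then m a else 0;
  lp_constant : forall z, z != 0 -> (forall a, 0 <= v a z) -> exists2 c, c != 0 & z = cM c
}.

Section RestrictedPlaces.
Variables (K E L M : fieldType) (cM : {rmorphism L -> M}) (Pl : eqType) (v : Pl -> M -> int).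
Hypothesis lp : line_places cM v.
Variables (iota : {rmorphism K -> L}) (Theta : {rmorphism E -> M}) (kappa : {rmorphism K -> E}).
Hypothesis Theta_kappa : forall c, Theta (kappa c) = cM (iota c).
Hypothesis algL : forall l, algebraicOver iota l.
Hypothesis algM : forall z, algebraicOver Theta z.

Let dv := lp_dval lp.

Definition place_ring (a : Pl) (z : E) : Prop := valuation_ring_of (v a) (Theta z).
Definition same_place (a b : Pl) : Prop := forall z, place_ring a z <-> place_ring b z.

Let theta_neq0 z : z != 0 -> Theta z != 0.
Proof. by rewrite fmorph_eq0. Qed.

Lemma place_valuation_ring a : valuation_ring (place_ring a).
Proof.
have [h1 [hB [hM h]]] := dval_valuation_ring (dv a); rewrite /place_ring.
split; first by rewrite rmorph1.
split; first by move=> x y; rewrite rmorphB; apply: hB.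
split; first by move=> x y; rewrite rmorphM; apply: hM.
by move=> x nx; rewrite fmorphV; apply: h; apply: theta_neq0.
Qed.

Lemma place_ringE a z : z != 0 -> place_ring a z <-> 0 <= v a (Theta z).
Proof. by move=> nz; apply: valuation_ring_ofE; apply: theta_neq0. Qed.

Let const_in a c : valuation_ring_of (v a) (cM c).
Proof.
have [->|nc] := eqVneq c 0; first by left; rewrite rmorph0.
by right; rewrite (lp_const lp).
Qed.

Lemma place_ring_base a c : place_ring a (kappa c).
Proof. by rewrite /place_ring Theta_kappa; apply: const_in. Qed.

Let V_integral (V : M -> Prop) (R : E -> Prop) z : valuation_ring V ->
  (forall x, R x -> V (Theta x)) -> integral_for Theta R z -> V z.
Proof.
move=> vV sub [p [mp Rp rp]]; apply: (valuation_root vV _ _ rp); first by rewrite monic_map.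
by move=> i; rewrite coef_map; apply: sub.
Qed.

Let V_const (V : M -> Prop) : valuation_ring V -> (forall c, V (Theta (kappa c))) -> forall c, V (cM c).
Proof.
move=> vV hV c; have /integral_algebraic [p mp rp] := algL c.
apply: (@valuation_root _ V (map_poly (cM \o iota) p)) => //; first by rewrite monic_map.
  by move=> i; rewrite coef_map /= -Theta_kappa.
by rewrite map_poly_comp fmorph_root.
Qed.

Let V_all (V : M -> Prop) : valuation_ring V -> (forall x, V (Theta x)) -> forall z, V z.
Proof.
move=> vV sub z; have /integral_algebraic [p mp rp] := algM z.
by apply: (@V_integral V (fun=> True)) => //; exists p.
Qed.

(** If the restriction were all of [E], the valuation ring above, being integrally closed, would
    contain everything algebraic over [E], that is, all of [M]. *)
Lemma place_ring_proper a : exists z, ~ place_ring a z.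
Proof.
apply: contrapT => h; have [z [nz vz]] := lp_proper lp a.
have : valuation_ring_of (v a) z.
  apply: (V_all (dval_valuation_ring (dv a))) => x.
  by apply: contrapT => nx; apply: h; exists x.
by move/(valuation_ring_ofE (v a) nz); rewrite leNgt vz.
Qed.

Lemma place_uniformizer a : exists2 g, g != 0 & 0 < v a (Theta g).
Proof.
have [z nz] := place_ring_proper a.
have z0 : z != 0 by apply/eqP => z0; apply: nz; left; rewrite z0 rmorph0.
exists z^-1; first by rewrite invr_eq0.
rewrite fmorphV (dvalV (dv a) (theta_neq0 z0)) oppr_gt0 ltNge; apply/negP => h.
by apply: nz; right.
Qed.

Lemma place_ring_maximal_among a (O : E -> Prop) : valuation_ring O ->
  (forall z, place_ring a z -> O z) -> (exists z, ~ O z) -> forall z, O z -> place_ring a z.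
Proof.
move=> vO sub [y nOy] z Oz; apply: contrapT => nz; apply: nOy.
have sO := valuation_subring vO.
have nz0 : z != 0 by apply/eqP => z0; apply: nz; left; rewrite z0 rmorph0.
have hz : v a (Theta z) <= -1.
  case: (leP 0 (v a (Theta z))) => h; first by case: nz; right.
  by move: h; lia.
have [->|ny] := eqVneq y 0; first exact: subring0.
pose n := `|v a (Theta y)|%N.
rewrite -(divfK (expf_neq0 n nz0) y); apply: subringM => //; last exact: subringX.
have nzn := theta_neq0 (expf_neq0 n nz0).
apply: sub; right; rewrite fmorph_div (dval_div (dv a) (theta_neq0 ny) nzn) rmorphXn /=.
rewrite (dvalX (dv a) _ (theta_neq0 nz0)).
rewrite -mulr_natr natz /n; move: (v a (Theta y)) (v a (Theta z)) hz; clear; move=> u w; nia.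
Qed.

(** A valuation ring of [M] above [O] is that of a point, but it was built to omit one element only,
    so this gives just an inclusion. For the converse, [O] contains the maximal ideal at the point,
    and residues are algebraic over [K]; hence each element regular at the point is integral over
    [O]. *)
Lemma valuation_ring_restricted (O : E -> Prop) : valuation_ring O -> (forall c, O (kappa c)) ->
  (exists z, ~ O z) -> exists a, forall z, O z <-> place_ring a z.
Proof.
move=> vO Ok [y nOy]; have sO := valuation_subring vO.
pose R z := exists2 x, O x & z = Theta x.
have sR : subring R.
  split; first by exists 1; rewrite ?rmorph1 //; apply: subring1.
  split=> _ _ [x Ox ->] [x' Ox' ->].
    by exists (x - x'); rewrite ?rmorphB //; apply: subringB.
  by exists (x * x'); rewrite ?rmorphM //; apply: subringM.
have [|[x Ox /fmorph_inj e]|V [vV sub nV]] := @exists_valuation_omitting M R (Theta y) sR.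
- by exists y^-1; rewrite ?fmorphV //; case: (valuation_cases y vO) => // -[].
- by apply: nOy; rewrite e.
have Vc : forall c, V (cM c).
  by apply: V_const => // c; apply: sub; exists (kappa c).
have [a ha] := lp_ring lp vV Vc (@ex_intro _ (fun z => ~ V z) _ nV).
have OP z : O z -> place_ring a z by move=> Oz; apply/ha/sub; exists z.
have nonunit w : w != 0 -> 0 < v a (Theta w) -> O w.
  move=> nw hw; case: (valuation_cases w vO) => // -[_ /OP].
  move/(place_ringE a (invr_neq0 nw)); rewrite fmorphV (dvalV (dv a) (theta_neq0 nw)).
  by rewrite oppr_ge0 leNgt hw.
exists a => z; split; first exact: OP.
move=> Pz; have [->|nz] := eqVneq z 0; first exact: subring0.
have /(place_ringE a nz) vz := Pz.
have [xi hxi] := lp_residue lp vz.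
have /integral_algebraic [p mp rp] := algL xi.
(* z is a root of the monic polynomial p - p(z) over O, since p(z) lies in the maximal ideal *)
pose q := map_poly kappa p.
have mq : q \is monic by rewrite monic_map.
have vq : q.[z] = 0 \/ (q.[z] != 0 /\ 0 < v a (Theta q.[z])).
  have [->|nqz] := eqVneq q.[z] 0; [by left | right; split=> //].
  have eq : Theta q.[z] = (map_poly cM (map_poly iota p)).[Theta z].
    rewrite -horner_map /q -!map_poly_comp /=; congr (_.[_]).
    by apply: eq_map_poly => c; exact: Theta_kappa.
  have [r er] := factor_theorem _ _ rp.
  have eq' : Theta q.[z] = (map_poly cM r).[Theta z] * (Theta z - cM xi).
    rewrite eq er rmorphM hornerM; congr (_ * _).
    by rewrite -(hornerXsubC (cM xi) (Theta z)); congr (_.[_]); exact: map_polyXsubC.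
  have := theta_neq0 nqz; rewrite eq' mulf_eq0 negb_or => /andP[n1 n2].
  rewrite (dvalM (dv a) n1 n2).
  have h1 : 0 <= v a (map_poly cM r).[Theta z].
    apply/(valuation_ring_ofE (v a) n1); apply: subring_horner => //.
      exact: valuation_subring (dval_valuation_ring (dv a)).
    by move=> i; rewrite coef_map; apply: const_in.
  case: hxi => [e|h2]; first by rewrite e subrr eqxx in n2.
  by rewrite addrC ltr_pwDl.
have Oq : O q.[z] by case: vq => [->|[n1 n2]]; [apply: subring0 | apply: nonunit].
have sq : (1 < size q)%N.
  rewrite /q size_map_poly ltnNge; apply/negP => /size1_polyC e.
  by move: rp (monic_neq0 mp); rewrite e map_polyC rootC fmorph_eq0 polyC_eq0 => ->.
apply: (@valuation_root _ O (q - q.[z]%:P)) => //.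
- by rewrite monicE lead_coefDl ?(monicP mq) // size_polyN (leq_ltn_trans (size_polyC_leq1 _)).
- move=> i; rewrite coefB coefC; apply: subringB => //; first by rewrite coef_map; apply: Ok.
  by case: (i == 0%N) => //; apply: subring0.
- by rewrite rootE hornerD hornerN hornerC subrr.
Qed.

(** A nonintegral [f] would be omitted by a valuation ring of [M] above the ring of [a]. That ring
    belongs to a point, and the maximality of restricted rings puts the point in the class of [a],
    where [f] is regular. *)
Lemma integral_over_place (a : Pl) (f : M) : f != 0 ->
  (forall b, same_place a b -> 0 <= v b f) -> integral_for Theta (place_ring a) f.
Proof.
move=> nf hf; apply: contrapT => nint.
pose R z := exists2 x, place_ring a x & z = Theta x.
have sO := valuation_subring (place_valuation_ring a).
have sR : subring R.
  split; first by exists 1; rewrite ?rmorph1 //; apply: subring1.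
  split=> _ _ [x Ox ->] [x' Ox' ->].
    by exists (x - x'); rewrite ?rmorphB //; apply: subringB.
  by exists (x * x'); rewrite ?rmorphM //; apply: subringM.
have [|V [vV sub nV]] := @integral_closure_valuation M R f sR nf.
  move=> p mp Rp rp; apply: nint.
  have ex i : exists x, place_ring a x /\ p`_i = Theta x by have [x Ox e] := Rp i; exists x.
  have [c hc] := choice ex.
  have ep : map_poly Theta (\poly_(i < size p) c i) = p.
    apply/polyP => i; rewrite coef_map coef_poly; case: ltnP => h; first by case: (hc i).
    by rewrite /= rmorph0 nth_default.
  exists (\poly_(i < size p) c i); split.
  - by rewrite -(map_monic Theta) ep.
  - move=> i; rewrite coef_poly; case: ifP => _; first by case: (hc i).
    exact: subring0.
  - by rewrite ep.
have Vc : forall c, V (cM c).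
  by apply: V_const => // c; apply: sub; exists (kappa c) => //; apply: place_ring_base.
have [b hb] := lp_ring lp vV Vc (@ex_intro _ (fun z => ~ V z) _ nV).
have OP z : place_ring a z -> place_ring b z by move=> Oz; apply/hb/sub; exists z.
have same : same_place a b.
  move=> z; split; first exact: OP.
  exact: (place_ring_maximal_among (place_valuation_ring b) OP (place_ring_proper b)).
by apply: nV; apply/hb; right; apply: hf.
Qed.

(** If [f] has the orders of [g] at all points of a class, f/g and g/f are integral over the ring of
    the class. The norm of [f] then has the same order as a power of [g], with an exponent that does
    not depend on the class. *)
Lemma norm_element (f : M) : f != 0 -> exists (c : E) (m : nat), [/\ (0 < m)%N, c != 0 &
  forall a g, g != 0 -> (forall b, same_place a b -> v b f = v b (Theta g)) ->
    v a (Theta c) = v a (Theta g) *+ m].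
Proof.
move=> nf; have [c [m [m0 nc h]]] := norm_like_constant nf (algM f).
exists c, m; split=> // a g ng hg; have ntg := theta_neq0 ng.
have [h1 h2] : place_ring a (c / g ^+ m) /\ place_ring a (g ^+ m / c).
  apply: h => //; first exact: place_valuation_ring.
    apply: integral_over_place; first by rewrite mulf_neq0 // invr_eq0.
    by move=> b sb; rewrite (dval_div (dv b) nf ntg) hg // subrr.
  apply: integral_over_place; first by rewrite mulf_neq0 // invr_eq0.
  by move=> b sb; rewrite (dval_div (dv b) ntg nf) hg // subrr.
have ngm : g ^+ m != 0 by rewrite expf_neq0.
have e : v a (Theta (g ^+ m)) = v a (Theta g) *+ m by rewrite rmorphXn (dvalX (dv a) _ ntg).
move: h1 h2.
rewrite (place_ringE a (mulf_neq0 nc (invr_neq0 ngm))) (place_ringE a (mulf_neq0 ngm (invr_neq0 nc))).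
rewrite !fmorph_div (dval_div (dv a) (theta_neq0 nc) (theta_neq0 ngm)).
rewrite (dval_div (dv a) (theta_neq0 ngm) (theta_neq0 nc)) e !subr_ge0 => h1 h2.
by apply/eqP; rewrite eq_le h1 h2.
Qed.

Lemma same_place_positive a b g : g != 0 -> same_place a b ->
  0 < v a (Theta g) -> 0 < v b (Theta g).
Proof.
move=> ng sab h; rewrite ltNge; apply/negP => h'.
have : place_ring b g^-1.
  by apply/(place_ringE b (invr_neq0 ng)); rewrite fmorphV (dvalV (dv b) (theta_neq0 ng)) oppr_ge0.
move/sab/(place_ringE a (invr_neq0 ng)); rewrite fmorphV (dvalV (dv a) (theta_neq0 ng)).
by rewrite oppr_ge0 leNgt h.
Qed.

Lemma same_place_zero a b u : u != 0 -> same_place a b -> v a (Theta u) = 0 -> v b (Theta u) = 0.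
Proof.
move=> nu sab h; apply/eqP; rewrite eq_le; apply/andP; split.
  rewrite -oppr_ge0 -(dvalV (dv b) (theta_neq0 nu)) -fmorphV; apply/(place_ringE b (invr_neq0 nu)).
  apply/sab/(place_ringE a (invr_neq0 nu)).
  by rewrite fmorphV (dvalV (dv a) (theta_neq0 nu)) h oppr0.
by apply/(place_ringE b nu)/sab/(place_ringE a nu); rewrite h.
Qed.

(** The quotient of suitable powers of [u] and [g] has order 0 at [a], hence at [b]: two points of a
    class have valuations on [E] that differ by a constant factor. *)
Lemma same_place_proportional a b u g : u != 0 -> g != 0 -> same_place a b ->
  v b (Theta u) * v a (Theta g) = v a (Theta u) * v b (Theta g).
Proof.
move=> nu ng sab; pose w := u ^ v a (Theta g) / g ^ v a (Theta u).
have nu' := expfz_neq0 (v a (Theta g)) nu; have ng' := expfz_neq0 (v a (Theta u)) ng.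
have nw : w != 0 by rewrite mulf_neq0 // invr_eq0.
have vw d : v d (Theta w) = v d (Theta u) * v a (Theta g) - v d (Theta g) * v a (Theta u).
  rewrite fmorph_div (dval_div (dv d) (theta_neq0 nu') (theta_neq0 ng')) !fmorphXz.
  by rewrite (dvalXz (dv d) _ (theta_neq0 nu)) (dvalXz (dv d) _ (theta_neq0 ng)).
have z : v a (Theta w) = 0 by rewrite vw mulrC subrr.
have := same_place_zero nw sab z; rewrite vw => /eqP; rewrite subr_eq0 => /eqP ->.
by rewrite mulrC.
Qed.

Lemma same_place_refl a : same_place a a. Proof. by []. Qed.
Lemma same_place_sym a b : same_place a b -> same_place b a.
Proof. by move=> h z; rewrite h. Qed.
Lemma same_place_trans a b c : same_place a b -> same_place b c -> same_place a c.
Proof. by move=> h h' z; rewrite h h'. Qed.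

Lemma place_constant_algebraic u : u != 0 -> (forall a, 0 <= v a (Theta u)) -> algebraicOver kappa u.
Proof.
move=> nu h; have [c nc e] := lp_constant lp (theta_neq0 nu) h.
have [p np rp] := algL c; exists p => //.
rewrite -(fmorph_root Theta) -map_poly_comp e (eq_map_poly (g := cM \o iota)) //.
by rewrite map_poly_comp fmorph_root.
Qed.

End RestrictedPlaces.

(** * The subfield k(F) is algebraically closed *)

Section Pencil.
Variable k : closedFieldType.
Local Notation A := {poly {poly k}}.
Local Notation cst x := ((x%:P)%:P).
Variables a b : A.

Definition binary_form m (h : {poly k}) : A := \sum_(i < m.+1) cst h`_i * a ^+ i * b ^+ (m - i).

Lemma binary_formS m (h : {poly k}) : (size h <= m.+1)%N -> binary_form m.+1 h = b * binary_form m h.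
Proof.
move=> sh; rewrite /binary_form big_ord_recr /= nth_default // !polyC0 !mul0r addr0 mulr_sumr.
by apply: eq_bigr => i _; rewrite subSn -1?ltnS // exprS; ring.
Qed.

Lemma binary_form_mulX m (h : {poly k}) : binary_form m.+1 (h * 'X) = a * binary_form m h.
Proof.
rewrite /binary_form big_ord_recl coefMX eqxx !polyC0 !mul0r add0r mulr_sumr.
by apply: eq_bigr => i _; rewrite lift0 subSS coefMX /= exprS; ring.
Qed.

Lemma binary_formB m (h g : {poly k}) : binary_form m (h - g) = binary_form m h - binary_form m g.
Proof.
by rewrite /binary_form -sumrB; apply: eq_bigr => i _; rewrite coefB !polyCB !mulrBl.
Qed.

Lemma binary_formZ m (x : k) (h : {poly k}) : binary_form m (x *: h) = cst x * binary_form m h.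
Proof.
by rewrite /binary_form mulr_sumr; apply: eq_bigr => i _; rewrite coefZ !polyCM !mulrA.
Qed.

Lemma binary_form_linear m (h : {poly k}) z : (size h <= m.+1)%N ->
  binary_form m.+1 (h * ('X - z%:P)) = (a - cst z * b) * binary_form m h.
Proof.
move=> sh; rewrite mulrBr binary_formB binary_form_mulX.
have -> : h * z%:P = z *: h by rewrite -mul_polyC mulrC.
by rewrite binary_formZ binary_formS // mulrBl mulrA.
Qed.

(** Over [k] the form splits into linear forms in [a] and [b], and a prime divides one of them. When
    [m] exceeds the degree of [h], the missing factors are [b]. *)
Lemma prime_divides_binary_form p m (h : {poly k}) : ring_irreducible p -> h != 0 ->
  (size h <= m.+1)%N -> divides p (binary_form m h) ->
  exists al be : k, ((al != 0) || (be != 0)) /\ divides p (cst al * a + cst be * b).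
Proof.
move=> ip nh; have [_ [nu _]] := ip.
have nunit (c : k) : c != 0 -> ~ divides p (cst c).
  move=> nc [d e]; move/negP: nu; apply.
  have : (cst c : A) \is a GRing.unit by apply/unit_bivariate; exists c.
  by rewrite e unitrM => /andP[].
elim/poly_closed_ind: h / nh m => [c nc|z h nh IH] m sh.
  rewrite /binary_form big_ord_recl coefC eqxx expr0 mulr1 subn0 big1 ?addr0; last first.
    by move=> i _; rewrite coefC lift0 /= !polyC0 !mul0r.
  move=> /(irreducible_prime ip) [/(nunit _ nc) //|].
  case: m {sh} => [|m]; first by rewrite expr0 -(polyC1 (poly_polynomial__canonical__GRing_NzSemiRing k)) => h; case: (nunit 1 (oner_neq0 _)); rewrite polyC1.
  elim: m => [|m IHm].
    by rewrite expr1 => h; exists 0, 1; rewrite oner_neq0 orbT !polyC0 mul0r add0r !polyC1 mul1r.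
  rewrite exprS => /(irreducible_prime ip) [h|//].
  by exists 0, 1; rewrite oner_neq0 orbT !polyC0 mul0r add0r !polyC1 mul1r.
have sz : size (h * ('X - z%:P)) = (size h).+1.
  by rewrite size_Mmonic ?monicXsubC // size_XsubC addn2.
move: sh; rewrite sz ltnS; case: m => [|m] sh.
  by move: nh; rewrite -size_poly_gt0 ltnNge sh.
rewrite binary_form_linear // => /(irreducible_prime ip) [h1|]; last exact: IH.
exists 1, (- z); rewrite oner_neq0 !polyC1 mul1r !polyCN mulNr; split=> //.
Qed.

End Pencil.

Lemma swapXY_cst (R : nzRingType) (x : R) : swapXY (x%:P)%:P = (x%:P)%:P.
Proof. by rewrite swapXY_polyC map_polyC. Qed.

Lemma swapXY_subC (R : nzRingType) (F : {poly {poly R}}) (x : R) :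
  swapXY (F - (x%:P)%:P) = swapXY F - (x%:P)%:P.
Proof. by apply: etrans (rmorphB _ _ _) _; congr (_ - _); apply: swapXY_cst. Qed.

(** The fractional linear equation is solved for [u]; a vanishing denominator [q] would make the
    determinant zero. *)
Lemma moebius_in_image (K E : fieldType) (kappa : {rmorphism K -> E}) (a1 b1 a2 b2 w : K) (u : E) :
  a1 * b2 - a2 * b1 != 0 -> kappa a1 * u + kappa b1 = kappa w * (kappa a2 * u + kappa b2) ->
  exists c, u = kappa c.
Proof.
move=> det e; pose q := a1 - w * a2.
have e1 : u * kappa q = kappa (w * b2 - b1).
  rewrite !rmorphB !rmorphM; have -> : u * (kappa a1 - kappa w * kappa a2) =
    (kappa a1 * u + kappa b1) - kappa w * (kappa a2 * u) - kappa b1 by ring.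
  by rewrite e; ring.
have [q0|nq] := eqVneq q 0.
  move: e1; rewrite q0 rmorph0 mulr0 => /esym/eqP; rewrite fmorph_eq0 => /eqP e2.
  move/eqP: det; case; have -> : a1 = w * a2 by apply/eqP; rewrite -subr_eq0; apply/eqP.
  have -> : b1 = w * b2 by apply/eqP; rewrite eq_sym -subr_eq0; apply/eqP.
  ring.
exists ((w * b2 - b1) / q).
by rewrite fmorph_div -e1 mulfK // fmorph_eq0.
Qed.

Lemma closed_finite_roots (k : closedFieldType) (p : {poly k}) : p != 0 ->
  exists s : seq k, forall x, x \notin s -> p.[x] != 0.
Proof.
move=> np; have [r er] := closed_field_poly_normal p; exists r => x; apply: contraNN.
by rewrite -rootE er rootZ ?lead_coef_eq0 // root_prod_XsubC.
Qed.

Lemma root_cleared (R : idomainType) (E : fieldType) (kappa : {rmorphism {fraction R} -> E})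
    (q : {poly R}) (P : {poly {fraction R}}) (d : {fraction R}) (z : E) m :
  d != 0 -> map_poly (@FracField.tofrac R) q = d *: P -> root (map_poly kappa P) z ->
  (size q <= m)%N -> \sum_(i < m) kappa (FracField.tofrac q`_i) * z ^+ i = 0.
Proof.
move=> nd eq /rootP rP sq.
have h : (map_poly (kappa \o @FracField.tofrac R) q).[z] = 0.
  by rewrite map_poly_comp eq map_polyZ hornerZ rP mulr0.
rewrite -[RHS]h (@horner_coef_wide _ m); last by apply: leq_trans sq; apply: size_poly.
apply: eq_bigr => i _; rewrite coef_map_id0 //= tofrac0; exact: rmorph0.
Qed.

Lemma homogeneous_relation (E : fieldType) m (c : nat -> E) (a b : E) : b != 0 ->
  \sum_(i < m.+1) c i * (a / b) ^+ i = 0 -> \sum_(i < m.+1) c i * a ^+ i * b ^+ (m - i) = 0.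
Proof.
move=> nb e; have := congr1 (fun z => z * b ^+ m) e; rewrite mul0r mulr_suml => e'.
apply: etrans e'; apply: eq_bigr => i _; have le : (i <= m)%N by rewrite -ltnS.
rewrite -!mulrA; congr (_ * _); have -> : b ^+ m = b ^+ i * b ^+ (m - i) by rewrite -exprD subnKC.
rewrite mulrA -exprMn divfK //.
Qed.

Lemma quotient_of_multiples (E : fieldType) (v1 v2 g1 g2 h1 h2 : E) :
  v1 = g1 * h1 -> v2 = g2 * h2 -> g1 != 0 -> g2 != 0 -> h1 / h2 = (v1 / v2) * (g2 / g1).
Proof.
move=> -> -> n1 n2; have [->|nh2] := eqVneq h2 0; first by rewrite mulr0 invr0 !mulr0 mul0r.
by field; rewrite n1 n2 nh2.
Qed.

Lemma quotient_linear (E : fieldType) (a b al1 be1 al2 be2 w : E) : b != 0 -> al2 * a + be2 * b != 0 ->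
  (al1 * a + be1 * b) / (al2 * a + be2 * b) = w ->
  al1 * (a / b) + be1 = w * (al2 * (a / b) + be2).
Proof.
move=> nb nv e; have {}e : al1 * a + be1 * b = w * (al2 * a + be2 * b) by rewrite -e divfK.
apply: (mulIf nb); rewrite mulrDl -mulrA divfK // e -!mulrA mulrDl -mulrA divfK //.
Qed.

(** This measures the descent below. Subtracting the constant can change the size only if [F] has
    degree 0 in this variable, and then the claimed drop is 0. *)
Lemma fiber_size (k : closedFieldType) (F h : {poly {poly k}}) (lam : k) : F - (lam%:P)%:P != 0 -> h != 0 ->
  (size h + (size F).-1 <= size ((F - (lam%:P)%:P) * h)%R)%N.
Proof.
move=> nF nh; rewrite size_mul //.
have h1 : ((size F).-1 <= (size (F - (lam%:P)%:P)%R).-1)%N.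
  case: (ltnP 1 (size F)) => sF; last first.
    by have -> : (size F).-1 = 0%N by move: sF; clear; case: (size F) => [|[]].
  rewrite size_polyDl // size_polyN (leq_ltn_trans _ sF) //; exact: size_polyC_leq1.
move: nF; rewrite -size_poly_gt0; move: h1.
by move: (size (F - (lam%:P)%:P)%R) (size h) (size F) => x y z; clear; lia.
Qed.

Lemma algebraic_moebius (K E : fieldType) (kappa : {rmorphism K -> E}) (a b : E) (al1 be1 al2 be2 : K) :
  b != 0 -> algebraicOver kappa (a / b) ->
  algebraicOver kappa ((kappa al1 * a + kappa be1 * b) / (kappa al2 * a + kappa be2 * b)).
Proof.
move=> nb alg; have N x y : kappa x * a + kappa y * b = (kappa x * (a / b) + kappa y) * b by field.
rewrite !N invfM mulrACA divff // mulr1; apply: algebraic_div; apply: algebraic_add;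
  try exact: algebraic_id; apply: algebraic_mul => //; exact: algebraic_id.
Qed.

Lemma evalFE (k : closedFieldType) (F : poly2 k) p : evalF F p = eval_morph F p. Proof. by []. Qed.

Lemma evalF_cst (k : closedFieldType) (F : poly2 k) (x : k) : evalF F x%:P = (x%:P)%:P.
Proof. by rewrite evalFE /= map_polyC /= /horner_eval hornerC. Qed.

Lemma evalF_linear (k : closedFieldType) (F : poly2 k) (x : k) : evalF F ('X - x%:P) = F - (x%:P)%:P.
Proof. by rewrite evalFE rmorphB /= map_polyX map_polyC /= /horner_eval hornerX hornerC. Qed.

Lemma evalF_mul (k : closedFieldType) (F : poly2 k) p q : evalF F (p * q) = evalF F p * evalF F q.
Proof. by rewrite !evalFE rmorphM. Qed.

Section AlgebraicClosure.
Variables (k : closedFieldType) (F : {poly {poly k}}).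
Local Notation A := {poly {poly k}}.
Local Notation K := {fraction {poly k}}.
Local Notation E := {fraction A}.
Local Notation cst x := ((x%:P)%:P).
Local Notation "x %:F" := (FracField.tofrac x).
Variable E0 : seq k.
Hypothesis irrF : forall lam : k, lam \notin E0 -> ring_irreducible (F - cst lam).
Variable kappa : {rmorphism K -> E}.
Hypothesis kappaE : forall p, kappa p%:F = (evalF F p)%:F.

(** Irreducible fiber equations for different values are not associated, since their difference is a
    unit; and [w] has finitely many prime factors. *)
Lemma fiber_divides_finite (w : A) : w != 0 -> exists s : seq k,
  forall lam, lam \notin s -> ring_irreducible (F - cst lam) -> ~ divides (F - cst lam) w.
Proof.
move=> nw; pose pick (p : A) : k := xget 0 [set lam | exists c : k, F - cst lam = cst c * p]%classic.
exists (map pick (factors w)) => lam /negP lams ilam dlam; apply: lams.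
have [c nc np] := normalize_irreducible ilam.
have uc : cst c \is a GRing.unit by apply/unit_bivariate; exists c.
apply/mapP; exists (cst c * (F - cst lam)).
  by apply/(mem_factors np nw)/(divides_unitl _ _ uc).
have : [set lam' | exists c' : k, F - cst lam' = cst c' * (cst c * (F - cst lam))]%classic (pick (cst c * (F - cst lam))).
  apply: xgetPex; exists lam, c^-1.
  by rewrite mulrA -!polyCM mulVf // !polyC1 mul1r.
case=> c' /=; set mu := pick _; rewrite mulrA -!polyCM => e.
have e2 : cst (lam - mu) = (cst (c' * c) - 1) * (F - cst lam).
  rewrite mulrBl -e mul1r !polyCB; ring.
apply/eqP; rewrite -subr_eq0; apply: contrapT => /negP nlm.
have : cst (lam - mu) \is a GRing.unit by apply/unit_bivariate; exists (lam - mu).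
by rewrite e2 unitrM => /andP[_ u]; case: ilam => _ [/negP].
Qed.

Lemma evalF_mod (lam : k) (c : {poly k}) :
  divides (F - cst lam) (evalF F c - cst c.[lam]).
Proof.
elim/poly_ind: c => [|c x [d e]].
  by rewrite /evalF map_poly0 !horner0 !polyC0 subrr; exists 0; rewrite mul0r.
exists (d * F + cst c.[lam]).
have -> : evalF F (c * 'X + x%:P) = evalF F c * F + cst x.
  pose f : {rmorphism {poly k} -> A} := horner_eval F \o map_poly (polyC \o polyC).
  rewrite -[LHS]/(f _) rmorphD rmorphM /= map_polyX map_polyC /= /horner_eval hornerX hornerC //.
have {}e : evalF F c = d * (F - cst lam) + cst c.[lam] by rewrite -e subrK.
rewrite hornerMXaddC !polyCD !polyCM e; ring.
Qed.

Lemma fiber_neq0 lam : lam \notin E0 -> F - cst lam != 0.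
Proof. by move=> /irrF []. Qed.

Lemma fiber_positive_degree : (0 < (size F).-1 + (size (swapXY F)).-1)%N.
Proof.
have [lam lamE0] := closed_field_infinite E0; have [nG [nuG _]] := irrF lamE0.
rewrite lt0n; apply: contraNN nuG; rewrite addn_eq0 => /andP[/eqP s1 /eqP s2].
have sF : (size F <= 1)%N by move: s1; case: (size F) => [|[]].
have [F0 eF] : exists F0, F = F0%:P by exists F`_0; apply: size1_polyC.
have : (size (swapXY F) <= 1)%N by move: s2; case: (size (swapXY F)) => [|[]].
rewrite eF swapXY_polyC; rewrite size_map_polyC => /size1_polyC eF0.
have {}eF : F = cst F0`_0 by rewrite eF {1}eF0.
move: nG; rewrite eF -!polyCB => nG; apply/unit_bivariate.
exists (F0`_0 - lam); last by rewrite {1}eF0 -polyCB.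
by apply: contra_neq nG => ->; rewrite !polyC0.
Qed.

(** A homogeneous relation between [a] and [b] over k[F] becomes, modulo F - lam, a binary form over
    [k], because F is congruent to lam. It is nonzero unless lam is a root of the leading
    coefficient, and the prime F - lam then divides one of its linear factors. *)
Lemma pencil_fiber (a b : A) : b != 0 -> algebraicOver kappa (a%:F / b%:F) ->
  exists s : seq k, forall lam, lam \notin s -> exists al be : k,
    ((al != 0) || (be != 0)) /\ divides (F - cst lam) (cst al * a + cst be * b).
Proof.
move=> nb [P nP rP]; have [q [nq [d nd eq]]] := clear_denominators nP.
have nbF : b%:F != 0 by rewrite tofrac_eq0.
pose m := (size q).-1.
have sq : size q = m.+1 by rewrite prednK // size_poly_gt0.
have h0 : \sum_(i < m.+1) evalF F q`_i * a ^+ i * b ^+ (m - i) = 0.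
  have := @homogeneous_relation E m (fun i => kappa (q`_i)%:F) a%:F b%:F nbF
    (@root_cleared _ _ kappa q P d _ m.+1 nd eq rP (eq_leq sq)) => e.
  apply/eqP; rewrite -(tofrac_eq0 (R := A)); apply/eqP; apply: etrans e; rewrite rmorph_sum.
  apply: eq_bigr => i _; rewrite kappaE; apply: etrans (tofracM _ _) _; rewrite tofracXn; congr (_ * _).
  by apply: etrans (tofracM _ _) _; rewrite tofracXn.
have nl : lead_coef q != 0 by rewrite lead_coef_eq0.
have [r hr] := closed_finite_roots nl.
exists (E0 ++ r) => lam; rewrite mem_cat negb_or => /andP[lamE lamr].
pose h := map_poly (horner_eval lam) q.
have hi i : (h`_i)%R = (q`_i).[lam] by rewrite coef_map_id0 // /horner_eval horner0.
apply: (@prime_divides_binary_form _ a b _ m h); first exact: irrF.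
- apply: contra_neq (hr _ lamr) => h0'; rewrite lead_coefE -/m -hi h0' coef0 //.
- by rewrite -sq; apply: size_poly.
have -> : binary_form a b m h = 0 - (\sum_(i < m.+1) evalF F q`_i * a ^+ i * b ^+ (m - i) - binary_form a b m h).
  by rewrite h0 !sub0r opprK.
rewrite -sumrB; apply: dividesB; first by exists 0; rewrite mul0r.
apply: (big_ind (divides (F - cst lam))) => [|x y|i _].
- by exists 0; rewrite mul0r.
- exact: dividesD.
by rewrite -!mulrBl hi -!mulrA; apply: divides_mulr; apply: evalF_mod.
Qed.

Lemma swap_fiber (lam : k) : swapXY (F - cst lam) = swapXY F - cst lam.
Proof. exact: swapXY_subC. Qed.

(** Descent on the degrees. Two independent combinations of [a] and [b] are divisible by F - lam1
    and F - lam2. The quotient of the cofactors is still algebraic and of smaller degree, hence in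
    k(F) by induction, and a/b is a Moebius transform of it times an element of k(F). *)
Let algebraically_closed_bounded n dx dy (a b : A) : (dx + dy <= n)%N -> a != 0 -> b != 0 ->
  (size a <= dy)%N -> (size b <= dy)%N -> (size (swapXY a) <= dx)%N -> (size (swapXY b) <= dx)%N ->
  algebraicOver kappa (a%:F / b%:F) -> exists c, a%:F / b%:F = kappa c.
Proof.
elim: n dx dy a b => [|n IH] dx dy a b hn na nb say sby sax sbx alg.
  move: na; rewrite -size_poly_gt0; move: hn say; case: dy {sby} => [|dy]; last by rewrite addnS.
  by move=> _; rewrite leqn0 => /eqP ->.
have nbF : b%:F != 0 by rewrite tofrac_eq0.
case: (pselect (exists al be : k, ((al != 0) || (be != 0)) /\ cst al * a + cst be * b = 0)) => [[al [be [nab e]]]|indep].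
  have nal : al != 0.
    apply: contraTneq nab => al0; move: e; rewrite al0 !polyC0 mul0r add0r eqxx /= => /eqP.
    by rewrite mulf_eq0 (negPf nb) orbF !polyC_eq0 => ->.
  exists ((- be / al)%:P)%:F; rewrite kappaE evalF_cst.
  have -> : a = cst (- be / al) * b.
    apply: (@mulfI _ (cst al)); first by rewrite !polyC_eq0.
    rewrite mulrA -!polyCM [al * _]mulrC divfK // polyCN polyCN mulNr; apply/eqP.
    by rewrite -addr_eq0 e.
  by rewrite tofracM mulfK.
have [s0 hs0] := pencil_fiber nb alg.
have [lam1 ls1] := closed_field_infinite (s0 ++ E0).
move: ls1; rewrite mem_cat negb_or => /andP[ls1 lE1].
have [al1 [be1 [nz1 [h1 e1]]]] := hs0 _ ls1.
have nv1 : cst al1 * a + cst be1 * b != 0 by apply/eqP => v0; apply: indep; exists al1, be1.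
(* With lam2 chosen outside [s1], the two combinations are independent: otherwise F - lam2 would
   divide the first one. *)
have [s1 hs1] := fiber_divides_finite nv1.
have [lam2 ls2] := closed_field_infinite (s0 ++ E0 ++ s1).
move: ls2; rewrite !mem_cat !negb_or => /andP[ls2 /andP[lE2 l12]].
have [al2 [be2 [nz2 [h2 e2]]]] := hs0 _ ls2.
have nv2 : cst al2 * a + cst be2 * b != 0 by apply/eqP => v0; apply: indep; exists al2, be2.
have det : al1 * be2 - al2 * be1 != 0.
  apply/eqP => /eqP; rewrite subr_eq0 => /eqP d0.
  have [c [c1 c2]] : exists c, al1 = c * al2 /\ be1 = c * be2.
    have [al20|nal2] := eqVneq al2 0; last first.
      by exists (al1 / al2); rewrite divfK // mulrAC d0 mulrC mulKf.
    have nbe2 : be2 != 0 by move: nz2; rewrite al20 eqxx.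
    exists (be1 / be2); rewrite divfK //; split=> //; apply: (mulIf nbe2).
    by rewrite d0 al20 mulr0 !mul0r.
  apply: (hs1 _ l12 (irrF lE2)); exists (cst c * h2).
  by rewrite -mulrA -e2 c1 c2 !polyCM mulrDr !mulrA.
have nG1 := fiber_neq0 lE1; have nG2 := fiber_neq0 lE2.
have nh1 : h1 != 0 by apply: contra_neq nv1 => h0; rewrite e1 h0 mul0r.
have nh2 : h2 != 0 by apply: contra_neq nv2 => h0; rewrite e2 h0 mul0r.
have sv (d : nat) (al be : k) (f : {rmorphism A -> A}) : (forall x : k, f (cst x) = cst x) ->
  (size (f a) <= d)%N -> (size (f b) <= d)%N -> (size (f (cst al * a + cst be * b)%R) <= d)%N.
  move=> fc s1' s2'; rewrite rmorphD !rmorphM !fc; apply: leq_trans (size_polyD _ _) _.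
  by rewrite geq_max !mul_polyC !(leq_trans (size_scale_leq _ _)).
have swc (x : k) : swapXY (cst x) = cst x := swapXY_cst x.
have sub_le (x y z : nat) : (x + y <= z)%N -> (x <= z - y)%N by clear; lia.
have red (lam : k) (h v : A) : lam \notin E0 -> h != 0 -> v = h * (F - cst lam) ->
   (size v <= dy)%N -> (size (swapXY v) <= dx)%N ->
   (size h <= dy - (size F).-1)%N /\ (size (swapXY h) <= dx - (size (swapXY F)).-1)%N.
  move=> lE nh -> s1' s2'; split.
    have := fiber_size (fiber_neq0 lE) nh; rewrite mulrC => sh; apply: sub_le; exact: leq_trans sh s1'.
  have nsF : swapXY F - cst lam != 0 by rewrite -swap_fiber swapXY_eq0 fiber_neq0.
  have nsh : swapXY h != 0 by rewrite swapXY_eq0.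
  have := fiber_size nsF nsh; rewrite mulrC -swap_fiber -(rmorphM swapXY) => sh.
  by apply: sub_le; apply: leq_trans sh s2'.
have kc (x : k) : kappa (x%:P)%:F = (cst x)%:F by rewrite kappaE evalF_cst.
have kG lam : kappa ('X - lam%:P)%:F = (F - cst lam)%:F.
  by rewrite kappaE evalF_linear.
have kv (al be : k) : (cst al * a + cst be * b)%:F = kappa (al%:P)%:F * a%:F + kappa (be%:P)%:F * b%:F.
  by rewrite !kc tofracD !tofracM.
have nGF1 : (F - cst lam1)%:F != 0 by rewrite tofrac_eq0.
have nGF2 : (F - cst lam2)%:F != 0 by rewrite tofrac_eq0.
have nvF2 : (cst al2 * a + cst be2 * b)%:F != 0 by rewrite tofrac_eq0.
have e1F : (cst al1 * a + cst be1 * b)%:F = (F - cst lam1)%:F * h1%:F by rewrite e1 mulrC tofracM.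
have e2F : (cst al2 * a + cst be2 * b)%:F = (F - cst lam2)%:F * h2%:F by rewrite e2 mulrC tofracM.
have [w ew] : exists w, h1%:F / h2%:F = kappa w.
  have [r1 r1'] := red _ _ _ lE1 nh1 e1 (sv _ _ _ idfun (fun _ => erefl) say sby) (sv _ _ _ _ swc sax sbx).
  have [r2 r2'] := red _ _ _ lE2 nh2 e2 (sv _ _ _ idfun (fun _ => erefl) say sby) (sv _ _ _ _ swc sax sbx).
  apply: (IH _ _ _ _ _ nh1 nh2 r1 r2 r1' r2').
    have nsh : swapXY h1 != 0 by rewrite swapXY_eq0.
    move: fiber_positive_degree hn nh1 nsh r1 r1'; rewrite -!size_poly_gt0.
    move: (size h1) (size (swapXY h1)) (size F).-1 (size (swapXY F)).-1 => x1 x2 x3 x4; clear; lia.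
  have -> := @quotient_of_multiples E _ _ _ _ _ _ e1F e2F nGF1 nGF2.
  apply: algebraic_mul; last by rewrite -!kG; apply: algebraic_div; apply: algebraic_id.
  exact: (eq_ind _ (algebraicOver kappa) (algebraic_moebius _ _ _ _ nbF alg) _
    (congr2 (fun x y : E => x / y) (esym (kv al1 be1)) (esym (kv al2 be2)))).
apply: (@moebius_in_image _ _ kappa (al1%:P)%:F (be1%:P)%:F (al2%:P)%:F (be2%:P)%:F
   (('X - lam1%:P)%:F / ('X - lam2%:P)%:F * w)).
  by rewrite -!tofracM -tofracB -!polyCM -polyCB tofrac_eq0 polyC_eq0.
have kw : kappa (('X - lam1%:P)%:F / ('X - lam2%:P)%:F * w) =
   (F - cst lam1)%:F / (F - cst lam2)%:F * (h1%:F / h2%:F).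
  apply: etrans (rmorphM kappa _ _) (congr2 (fun x y : E => x * y) _ (esym ew)).
  exact: etrans (fmorph_div kappa _ _) (congr2 (fun x y : E => x / y) (kG _) (kG _)).
have nv2F : kappa (al2%:P)%:F * a%:F + kappa (be2%:P)%:F * b%:F != 0.
  exact: (eq_ind _ (fun z : E => z != 0) nvF2 _ (kv al2 be2)).
apply: (@quotient_linear E _ _ _ _ _ _ _ nbF nv2F); apply: etrans (esym kw).
apply: etrans (congr2 (fun x y : E => x / y) (esym (kv al1 be1)) (esym (kv al2 be2))) _.
apply: etrans (congr2 (fun x y : E => x / y) e1F e2F) _; exact: esym (mulf_div _ _ _ _).
Qed.

Lemma algebraic_over_pencil (a b : A) : a != 0 -> b != 0 ->
  algebraicOver kappa (a%:F / b%:F) -> exists c, a%:F / b%:F = kappa c.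
Proof.
move=> na nb; apply: (@algebraically_closed_bounded _ (maxn (size (swapXY a)) (size (swapXY b)))
  (maxn (size a) (size b)) a b (leqnn _)) => //; rewrite ?leq_maxl ?leq_maxr //.
Qed.

End AlgebraicClosure.

(** * The rank of the unit group *)

Section PlaceRank.
Variables (K E L M : fieldType) (cM : {rmorphism L -> M}) (Pl : eqType) (v : Pl -> M -> int).
Hypothesis lp : line_places cM v.
Variables (iota : {rmorphism K -> L}) (Theta : {rmorphism E -> M}) (kappa : {rmorphism K -> E}).
Hypothesis Theta_kappa : forall c, Theta (kappa c) = cM (iota c).
Hypothesis algL : forall l, algebraicOver iota l.
Hypothesis algM : forall z, algebraicOver Theta z.
Local Notation same := (same_place v Theta).

Variable S : seq Pl.
Hypothesis uS : uniq S.
Hypothesis S_closed : forall a b, same a b -> a \in S -> b \in S.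

Let dv := lp_dval lp.
Let theta_neq0 z : z != 0 -> Theta z != 0. Proof. by rewrite fmorph_eq0. Qed.
Let vT a u := v a (Theta u).
Let vTM a x y : x != 0 -> y != 0 -> vT a (x * y) = vT a x + vT a y.
Proof. by move=> nx ny; rewrite /vT rmorphM (dvalM (dv a)) ?theta_neq0. Qed.
Let vTXz a x n : x != 0 -> vT a (x ^ n) = vT a x * n.
Proof. by move=> nx; rewrite /vT fmorphXz (dvalXz (dv a)) ?theta_neq0. Qed.
Let vT_kappa a c : c != 0 -> vT a (kappa c) = 0.
Proof. by move=> nc; rewrite /vT Theta_kappa (lp_const lp) // fmorph_eq0. Qed.

Definition supported (u : E) : Prop := u != 0 /\ forall a, a \notin S -> v a (Theta u) = 0.

(** The share of one restricted ring in the degree of the divisor of [u]. *)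
Definition class_sum a u := \sum_(b <- S | `[<same a b>]) v b (Theta u).

Lemma class_sum_positive a u : a \in S -> u != 0 -> 0 < v a (Theta u) -> 0 < class_sum a u.
Proof.
move=> aS nu h; rewrite /class_sum (big_rem a) //=.
have -> : `[<same a a>] by apply/asboolP; apply: same_place_refl.
rewrite ltr_wpDr //; apply: sumr_ge0 => b /asboolP sab.
exact: ltW (same_place_positive lp nu sab h).
Qed.

(* [f] has degree 0 on the two classes together, hence is principal; its norm descends to [E]. *)
Lemma separating_unit a1 a2 : a1 \in S -> a2 \in S -> ~ same a1 a2 ->
  exists c, [/\ supported c, v a2 (Theta c) != 0 &
    forall a, ~ same a1 a -> ~ same a2 a -> v a (Theta c) = 0].
Proof.
move=> a1S a2S n12.
have [g1 ng1 pg1] := place_uniformizer lp algM a1.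
have [g2 ng2 pg2] := place_uniformizer lp algM a2.
pose D1 := class_sum a1 g1; pose D2 := class_sum a2 g2.
have D1p : 0 < D1 := class_sum_positive a1S ng1 pg1.
pose m b : int := if `[<same a1 b>] then D2 * v b (Theta g1)
   else if `[<same a2 b>] then - D1 * v b (Theta g2) else 0.
have excl b : same a1 b -> same a2 b -> False.
  by move=> h1 h2; apply: n12; apply: same_place_trans h1 (same_place_sym h2).
have sm : \sum_(b <- S) m b = 0.
  have -> : \sum_(b <- S) m b = \sum_(b <- S | `[<same a1 b>]) D2 * v b (Theta g1)
      + \sum_(b <- S | `[<same a2 b>]) - D1 * v b (Theta g2).
    rewrite [X in X + _]big_mkcond [X in _ + X]big_mkcond -big_split; apply: eq_bigr => b _ /=.
    rewrite /m; case: asboolP => h1; case: asboolP => h2; rewrite ?addr0 ?add0r //.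
    by case: (excl b).
  rewrite -!mulr_sumr -/(class_sum a1 g1) -/(class_sum a2 g2) -/D1 -/D2; ring.
have [f nf hf] := lp_prescribed lp uS sm.
have hm b : v b f = m b.
  rewrite hf; case: ifP => // /negP bS; rewrite /m; case: asboolP => h1.
    by case: bS; apply: S_closed h1 a1S.
  by case: asboolP => h2 //; case: bS; apply: S_closed h2 a2S.
have [c [n [n0 nc hc]]] := norm_element lp Theta_kappa algL algM nf.
have far a : ~ same a1 a -> ~ same a2 a -> v a (Theta c) = 0.
  move=> h1 h2; rewrite (hc a 1 (oner_neq0 _)); first by rewrite rmorph1 (dval1 (dv a)) mul0rn.
  move=> b sab; rewrite hm /m rmorph1 (dval1 (dv b)); case: asboolP => h1'.
    by case: h1; apply: same_place_trans h1' (same_place_sym sab).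
  by case: asboolP => h2' //; case: h2; apply: same_place_trans h2' (same_place_sym sab).
exists c; split=> //.
  split=> // a aS; apply: far => h; move/negP: aS; apply; exact: S_closed h _.
rewrite (hc a2 (g2 ^ (- D1)) (expfz_neq0 _ ng2)).
  by rewrite -/(vT _ _) vTXz // mulrn_eq0 negb_or -lt0n n0 /= mulf_neq0 // ?oppr_eq0 gt_eqF.
move=> b s2b; rewrite hm /m -[RHS]/(vT b _) vTXz //; case: asboolP => h1; first by case: (excl b).
by case: asboolP => // _; rewrite mulrC.
Qed.

Definition place_rep b := nth b S (find (fun c => `[<same c b>]) S).
Definition place_reps := undup (map place_rep S).

Lemma place_rep_same b : b \in S -> place_rep b \in S /\ same (place_rep b) b.
Proof.
move=> bS; have h : has (fun c => `[<same c b>]) S.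
  by apply/hasP; exists b => //; apply/asboolP; apply: same_place_refl.
split; first by rewrite mem_nth // -has_find.
by have /asboolP := nth_find b h.
Qed.

Lemma place_rep_eq b c : b \in S -> c \in S -> same b c -> place_rep b = place_rep c.
Proof.
move=> bS cS sbc; rewrite /place_rep.
have e : (fun d => `[<same d b>]) =1 (fun d => `[<same d c>]).
  move=> d; apply/asboolP/asboolP => h; first exact: same_place_trans h sbc.
  by apply: same_place_trans h (same_place_sym sbc).
rewrite (eq_find e); apply: set_nth_default; rewrite -has_find; apply/hasP.
by exists c => //; apply/asboolP; apply: same_place_refl.
Qed.

Lemma place_repsS a : a \in place_reps -> a \in S /\ place_rep a = a.
Proof.
rewrite mem_undup => /mapP [b bS ->]; have [h1 h2] := place_rep_same bS.
by split=> //; apply: place_rep_eq.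
Qed.

Lemma place_repsE a b : a \in place_reps -> b \in S -> (place_rep b == a) = `[<same a b>].
Proof.
move=> /place_repsS [aS ra] bS; apply/eqP/asboolP => [<-|h]; first by case: (place_rep_same bS).
by rewrite -(place_rep_eq aS bS h).
Qed.

Lemma place_reps_inj a b : a \in place_reps -> b \in place_reps -> same a b -> a = b.
Proof.
move=> /place_repsS [aS ra] /place_repsS [bS rb] sab.
by rewrite -ra -rb; apply: place_rep_eq.
Qed.

(** This is the vanishing of the degree of a principal divisor, with the points grouped by class. *)
Lemma sum_class_sum u : supported u -> \sum_(a <- place_reps) class_sum a u = 0.
Proof.
move=> [nu hu]; rewrite -[RHS](lp_sum0 lp (theta_neq0 nu) uS hu).
have -> : \sum_(a <- place_reps) class_sum a u =
   \sum_(a <- place_reps) \sum_(b <- S | place_rep b == a) v b (Theta u).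
  apply: eq_big_seq => a ar; rewrite /class_sum big_seq_cond [RHS]big_seq_cond.
  by apply: eq_bigl => b; case bS: (b \in S) => //=; rewrite place_repsE.
rewrite (exchange_big_dep xpredT) //= big_seq [RHS]big_seq; apply: eq_bigr => b bS.
rewrite (big_rem (place_rep b)) /=; last by rewrite mem_undup; apply: map_f.
rewrite eqxx big_seq_cond big_pred0 ?addr0 // => a.
rewrite mem_rem_uniq ?undup_uniq // inE; case: (eqVneq a (place_rep b)) => //= h.
by rewrite andbF.
Qed.

Hypothesis algebraic_kappa : forall u, u != 0 -> algebraicOver kappa u -> exists c, u = kappa c.
Variables (N : nat) (b : 'I_N -> E).
Hypothesis b_supported : forall i, supported (b i).
Hypothesis b_independent : forall (z : 'I_N -> int) c, \prod_i b i ^ z i = kappa c -> forall i, z i = 0.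
Hypothesis b_generate : forall u, supported u -> exists (m : nat) c (z : 'I_N -> int),
  [/\ (0 < m)%N, c != 0 & u ^+ m = kappa c * \prod_i b i ^ z i].
Hypothesis S_nonempty : exists a, a \in S.

Let t := size place_reps.
Let r (j : 'I_t) : Pl := tnth (in_tuple place_reps) j.
Let r_in j : r j \in place_reps. Proof. exact: mem_tnth. Qed.
Let r_inj i j : same (r i) (r j) -> i = j.
Proof.
move/(place_reps_inj (r_in i) (r_in j)).
exact: (elimT (tuple_uniqP (in_tuple place_reps)) (undup_uniq _)).
Qed.

Let prod_neq0 (z : 'I_N -> int) : \prod_i b i ^ z i != 0.
Proof. by apply/prodf_neq0 => i _; apply: expfz_neq0; case: (b_supported i). Qed.

Let vT_prod a (z : 'I_N -> int) : vT a (\prod_i b i ^ z i) = \sum_i z i * vT a (b i).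
Proof.
rewrite /vT rmorph_prod (dval_prod (dv a)); last first.
  by move=> i; apply: theta_neq0; apply: expfz_neq0; case: (b_supported i).
apply: eq_bigr => i _; rewrite -[LHS]/(vT a (b i ^ z i)) (vTXz a _ (proj1 (b_supported i))).
exact: mulrC.
Qed.

Let valuation_row (u : E) : 'rV[rat]_t := \row_j (vT (r j) u)%:~R.
Let V : 'M[rat]_(N, t) := \matrix_i valuation_row (b i).

Let row_of_prod (z : 'I_N -> int) :
  valuation_row (\prod_i b i ^ z i) = (\row_i (z i)%:~R) *m V.
Proof.
apply/rowP => j; rewrite !mxE vT_prod rmorph_sum; apply: eq_bigr => i _.
by rewrite !mxE rmorphM.
Qed.

(** Order 0 at the representatives means order 0 on their classes. The element then has no zeros or
    poles, so it is algebraic over k(F). *)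
Let row_zero (u : E) : supported u -> valuation_row u = 0 -> exists c, u = kappa c.
Proof.
move=> [nu hu] h0; apply: algebraic_kappa => //.
apply: (place_constant_algebraic lp Theta_kappa algL nu) => a.
case: (boolP (a \in S)) => [aS|/hu -> //]; have [repS sa] := place_rep_same aS.
have repin : place_rep a \in place_reps by rewrite mem_undup map_f.
have /tnthP [j ej] : place_rep a \in in_tuple place_reps by [].
have /rowP /(_ j) := h0; rewrite !mxE => /eqP; rewrite intr_eq0 => /eqP z.
by rewrite (same_place_zero lp nu sa) // ej.
Qed.

Let prod_supported (z : 'I_N -> int) : supported (\prod_i b i ^ z i).
Proof.
split=> // a aS; rewrite -/(vT a _) vT_prod big1 // => i _.
by case: (b_supported i) => _ h; rewrite /vT h // mulr0.
Qed.

(** A rational relation between the rows, with denominators cleared, gives a product of powers of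
    the [b i] that lies in k(F); independence makes its exponents vanish. *)
Let V_free : row_free V.
Proof.
apply: inj_row_free => x hx.
have [d nd [z hz]] : exists2 d : int, d != 0 & exists z : 'I_N -> int, forall i, d%:~R * x 0 i = (z i)%:~R.
  exists (\prod_i denq (x 0 i)); first by apply/prodf_neq0 => i _; rewrite denq_neq0.
  exists (fun i => numq (x 0 i) * \prod_(j | j != i) denq (x 0 j)) => i.
  rewrite (bigD1 i) //= !rmorphM /= numqE; ring.
have ez : \row_i (z i)%:~R = d%:~R *: x by apply/rowP => i; rewrite !mxE hz.
have [c hc] := row_zero (prod_supported z) (etrans (row_of_prod z)
  (etrans (congr1 (fun y => y *m V) ez) (etrans (esym (scalemxAl _ _ _)) (etrans (congr1 _ hx) (scaler0 _ _))))).
apply/rowP => i; rewrite mxE; have := hz i; rewrite (b_independent hc).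
by move/eqP; rewrite mulf_eq0 intr_eq0 (negPf nd) => /eqP.
Qed.

(* The weights compare the valuations at all the points of a class with the one at its
   representative; the relation is the vanishing of the degree of a principal divisor. *)
Let relation : exists2 w : 'cV[rat]_t, (forall j, 0 < w j 0) &
  forall u, supported u -> valuation_row u *m w = 0.
Proof.
have ex j : exists g : E, g != 0 /\ 0 < vT (r j) g.
  by have [g ng pg] := place_uniformizer lp algM (r j); exists g.
have /choice [g hg] := ex.
have rS j : r j \in S by case: (place_repsS (r_in j)).
exists (\col_j ((class_sum (r j) (g j))%:~R / (vT (r j) (g j))%:~R)) => [j|u su].
  have [ng pg] := hg j; rewrite mxE divr_gt0 // ltr0z //; exact: class_sum_positive.
apply/matrixP => x y; rewrite !mxE -[RHS](rmorph0 (intmul 1)) -(sum_class_sum su) (big_tnth _ _ place_reps).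
rewrite rmorph_sum; apply: eq_bigr => j _; rewrite !mxE.
have [ng pg] := hg j; have ngv : (vT (r j) (g j))%:~R != 0 :> rat by rewrite intr_eq0 gt_eqF.
apply: (mulIf ngv); rewrite -mulrA divfK // -!intrM; congr (_%:~R).
rewrite /class_sum mulr_suml mulr_sumr; apply: eq_bigr => d /asboolP sd.
by case: su => nu _; rewrite -(same_place_proportional lp nu ng sd).
Qed.

(** The rows are orthogonal to a nonzero weight vector, which leaves t - 1 dimensions. *)
Let rank_upper : (N <= t.-1)%N.
Proof.
have [w wpos hw] := relation.
move: V_free; rewrite /row_free => /eqP rV.
have hN : (N <= t)%N := leq_trans (eq_leq (esym rV)) (rank_leq_col V).
case: (posnP t) => [t0|tp]; first by move: hN; rewrite t0 leqn0 => /eqP ->.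
have hV : (V <= kermx w)%MS.
  apply/row_subP => i; rewrite rowK; apply/sub_kermxP; exact: hw.
have := mxrankS hV; rewrite rV mxrank_ker -mxrank_tr rank_rV.
suff -> : w^T != 0 by rewrite (subn1 t).
apply/eqP => /rowP /(_ (Ordinal tp)); rewrite !mxE => h.
by have := wpos (Ordinal tp); rewrite h ltxx.
Qed.

Let row_generated u : supported u -> (valuation_row u <= V)%MS.
Proof.
move=> su; have [nu _] := su; have [m [c [z [m0 nc e]]]] := b_generate su.
have nm : m%:R != 0 :> rat by rewrite pnatr_eq0 -lt0n.
have -> : valuation_row u = m%:R^-1 *: ((\row_i (z i)%:~R) *m V).
  rewrite -row_of_prod; apply/rowP => j; rewrite !mxE.
  have -> : vT (r j) (\prod_i b i ^ z i) = vT (r j) u *+ m.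
    have nk : kappa c != 0 by rewrite fmorph_eq0.
    have := congr1 (vT (r j)) e; rewrite (vTM _ nk (prod_neq0 z)) vT_kappa // add0r => <-.
    by rewrite /vT rmorphXn (dvalX (dv _) _ (theta_neq0 nu)).
  by rewrite rmorphMn /= -[X in _ * X]mulr_natr mulrC mulfK.
by apply: scalemx_sub; apply: submxMl.
Qed.

(** Every class other than a fixed one is separated from that one by a supported element. On these t
    - 1 classes the rows form a diagonal matrix with nonzero diagonal, and all of them lie in the
    span of [V]. *)
Let rank_lower : (t.-1 <= N)%N.
Proof.
case: (posnP t) => [->//|tp]; pose j0 := Ordinal tp.
have rS j : r j \in S by case: (place_repsS (r_in j)).
have ex (i : 'I_t.-1) : exists c, [/\ supported c, v (r (lift j0 i)) (Theta c) != 0 &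
    forall a, ~ same (r j0) a -> ~ same (r (lift j0 i)) a -> v a (Theta c) = 0].
  by apply: separating_unit => // /r_inj /eqP; rewrite (negPf (neq_lift _ _)).
have /choice [c hc] := ex.
pose C : 'M[rat]_(t.-1, t) := \matrix_i valuation_row (c i).
have Cfree : row_free C.
  apply: inj_row_free => x hx; apply/rowP => i; rewrite mxE.
  have /rowP /(_ (lift j0 i)) := hx; rewrite !mxE (bigD1 i) //= big1 ?addr0.
    by rewrite !mxE => /eqP; rewrite mulf_eq0 intr_eq0; case: (hc i) => _ /negPf -> _ /orP[/eqP|//].
  move=> l li; case: (hc l) => _ _ h; rewrite !mxE /vT h ?mulr0 //.
    by move=> /r_inj /eqP; rewrite (negPf (neq_lift _ _)).
  by move=> /r_inj /lift_inj e; rewrite e eqxx in li.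
have CV : (C <= V)%MS by apply/row_subP => i; rewrite rowK; apply: row_generated; case: (hc i).
move: Cfree; rewrite /row_free => /eqP <-.
exact: leq_trans (mxrankS CV) (rank_leq_row _).
Qed.

Theorem place_count : (0 < t)%N /\ t = N.+1.
Proof.
have t0 : (0 < t)%N.
  have [a aS] := S_nonempty; rewrite /t; case e : place_reps => [|//].
  by have : place_rep a \in place_reps by [rewrite mem_undup map_f|]; rewrite e.
split=> //; apply/eqP; rewrite eqn_leq -(prednK t0) !ltnS.
by rewrite rank_lower rank_upper.
Qed.

End PlaceRank.

(** * Poles of the localization *)

Section Poles.
Variables (K E L M : fieldType) (cM : {rmorphism L -> M}) (Pl : eqType) (v : Pl -> M -> int).
Hypothesis lp : line_places cM v.
Variables (iota : {rmorphism K -> L}) (Theta : {rmorphism E -> M}) (kappa : {rmorphism K -> E}).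
Hypothesis Theta_kappa : forall c, Theta (kappa c) = cM (iota c).
Hypothesis algL : forall l, algebraicOver iota l.
Hypothesis algM : forall z, algebraicOver Theta z.
Local Notation same := (same_place v Theta).
Local Notation ring_at := (place_ring v Theta).

Variables (loc : E -> Prop) (x y : E).
Hypothesis nx : x != 0.
Hypothesis ny : y != 0.
Hypothesis loc_x : loc x.
Hypothesis loc_y : loc y.
Hypothesis loc_min : forall O, valuation_ring O -> (forall c, O (kappa c)) -> O x -> O y ->
  forall z, loc z -> O z.

Definition is_pole a : Prop := exists z, loc z /\ ~ ring_at a z.

(** Where [x] and [y] are regular, so is the whole ring [loc]; and both have finitely many zeros and
    poles. *)
Lemma poles_finite : exists s : seq Pl, uniq s /\ forall a, a \in s <-> is_pole a.
Proof.
have ntx : Theta x != 0 by rewrite fmorph_eq0.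
have nty : Theta y != 0 by rewrite fmorph_eq0.
have [sx hx] := lp_support lp ntx; have [sy hy] := lp_support lp nty.
exists (undup [seq a <- sx ++ sy | `[<is_pole a>]]); split; first exact: undup_uniq.
move=> a; rewrite mem_undup mem_filter; split=> [/andP[/asboolP //]|pa].
apply/andP; split; first exact/asboolP.
apply: contrapT => /negP; rewrite mem_cat negb_or => /andP[nsx nsy].
case: pa => z [lz nz]; apply: nz.
apply: (loc_min (place_valuation_ring lp Theta a) (place_ring_base lp Theta_kappa a)) lz.
  by right; rewrite hx.
by right; rewrite hy.
Qed.

(** A function without poles on the projective line is constant, and one of the two coordinates is
    not. *)
Lemma poles_exist : (forall c, Theta x <> cM c) \/ (forall c, Theta y <> cM c) -> exists a, is_pole a.
Proof.
suff h z : z != 0 -> loc z -> (forall c, Theta z <> cM c) -> exists a, is_pole a.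
  by case; apply: h.
move=> nz lz ncz; apply: contrapT => np.
have nt : Theta z != 0 by rewrite fmorph_eq0.
have reg a : 0 <= v a (Theta z).
  apply/(place_ringE v Theta a nz); apply: contrapT => h; apply: np; exists a, z; split=> //.
by have [c _ /ncz] := lp_constant lp nt reg.
Qed.

Lemma is_pole_same a b : same a b -> is_pole a -> is_pole b.
Proof. by move=> sab [z [lz nz]]; exists z; split=> //; rewrite -sab. Qed.

Lemma card_polar_rings (s : seq Pl) (X : (E -> Prop) -> Prop) : (forall a, a \in s <-> is_pole a) ->
  (forall O, X O <-> [/\ valuation_ring O, forall c, O (kappa c), exists z, ~ O z & exists z, loc z /\ ~ O z]) ->
  card_upto (@set_eq E) X (size (place_reps v Theta s)).
Proof.
move=> hs hX; have closed a b : same a b -> a \in s -> b \in s.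
  by move=> sab /hs pa; apply/hs; apply: is_pole_same sab pa.
apply: (@card_upto_map _ _ _ _ _ ring_at); first exact: undup_uniq.
- move=> a /place_repsS [/hs pa _]; apply/hX; split.
  + exact: (place_valuation_ring lp Theta a).
  + exact: (place_ring_base lp Theta_kappa a).
  + exact: (place_ring_proper lp algM a).
  + exact: pa.
- by move=> a b ar br; apply: place_reps_inj ar br.
move=> O /hX [vO Ok nO [z [lz nz]]].
have [a ha] := valuation_ring_restricted lp Theta_kappa algL vO Ok nO.
have aS : a \in s by apply/hs; exists z; split=> //; rewrite -ha.
have [rS sr] := place_rep_same v Theta aS.
exists (place_rep v Theta s a); first by rewrite mem_undup map_f.
by move=> w; rewrite sr ha.
Qed.

End Poles.

Lemma prod_count (I : eqType) (R : comNzRingType) (f : I -> R) (s ps : seq I) : uniq s ->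
  {subset ps <= s} -> \prod_(p <- ps) f p = \prod_(p <- s) f p ^+ count_mem p ps.
Proof.
move=> us; elim: ps => [|q ps IH] sub.
  by rewrite big_nil big1 // => i _; rewrite expr0.
rewrite big_cons IH; last by move=> r rp; apply: sub; rewrite inE rp orbT.
have qs : q \in s by apply: sub; rewrite inE eqxx.
have -> : f q = \prod_(p <- s) f p ^+ (q == p).
  rewrite (big_rem q) //= eqxx expr1 big_seq big1 ?mulr1 // => p.
  by rewrite mem_rem_uniq // inE eq_sym => /andP[/negPf -> _].
by rewrite -big_split; apply: eq_bigr => p _; rewrite /= exprD.
Qed.

Lemma flatten_uniq (I J : eqType) (f : I -> seq J) (s : seq I) : uniq s -> (forall i, uniq (f i)) ->
  (forall i j x, x \in f i -> x \in f j -> i = j) -> uniq (flatten (map f s)).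
Proof.
move=> us uf dis; elim: s us => //= i s IH /andP[nis us]; rewrite cat_uniq uf IH // andbT /=.
apply/hasPn => x /flatten_mapP [j js xj]; apply/negP => xi.
by move/negP: nis; apply; rewrite (dis i j x).
Qed.

(** * Multiplicative dependence up to roots *)

Section Dependent.
Variables (K E : fieldType) (kappa : {rmorphism K -> E}) (N : nat) (b : 'I_N -> E).
Hypothesis nb : forall i, b i != 0.

(** The exponent [m] makes this the rational span of the [b i] modulo the image of [K], so that it
    is stable under roots. *)
Definition dependent u : Prop := u != 0 /\ exists m c (z : 'I_N -> int),
  [/\ (0 < m)%N, c != 0 & u ^+ m = kappa c * \prod_i b i ^ z i].

Let prod_expz (z : 'I_N -> int) n : (\prod_i b i ^ z i) ^ n = \prod_i b i ^ (z i * n).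
Proof.
apply: etrans (_ : \prod_i (b i ^ z i) ^ n = _); last by apply: eq_bigr => i _; rewrite exprz_exp.
by apply: (big_morph (fun x => x ^ n)) => [x y|]; rewrite ?exp1rz // expfzMl.
Qed.

Lemma dependent_mul u w : dependent u -> dependent w -> dependent (u * w).
Proof.
move=> [nu [m [c [z [m0 nc e]]]]] [nw [m' [c' [z' [m0' nc' e']]]]]; split; first exact: mulf_neq0.
exists (m * m')%N, (c ^+ m' * c' ^+ m), (fun i => z i * m'%:Z + z' i * m%:Z).
split; [by rewrite muln_gt0 m0|by rewrite mulf_neq0 // expf_neq0|].
have -> : \prod_i b i ^ (z i * m' + z' i * m) = (\prod_i b i ^ z i) ^+ m' * (\prod_i b i ^ z' i) ^+ m.
  rewrite !exprnP !prod_expz -big_split; apply: eq_bigr => i _; rewrite /= expfzDr //.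
rewrite exprMn exprM e mulnC exprM e' rmorphM !rmorphXn !exprMn; ring.
Qed.

Lemma dependent_inv u : dependent u -> dependent u^-1.
Proof.
move=> [nu [m [c [z [m0 nc e]]]]]; split; first by rewrite invr_eq0.
exists m, c^-1, (fun i => - z i); split; rewrite ?invr_eq0 //.
rewrite exprVn e invfM fmorphV; congr (_ * _).
by rewrite -prodfV; apply: eq_bigr => i _; rewrite invr_expz.
Qed.

Lemma dependent_base c : c != 0 -> dependent (kappa c).
Proof.
move=> nc; split; first by rewrite fmorph_eq0.
by exists 1%N, c, (fun => 0); split=> //; rewrite big1 ?mulr1 // => i _; rewrite expr0z.
Qed.

Lemma dependent_gen i : dependent (b i).
Proof.
split=> //; exists 1%N, 1, (fun j => (j == i)%:Z); split; rewrite ?oner_eq0 // rmorph1 mul1r.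
rewrite (bigD1 i) //= eqxx expr1z big1 ?mulr1 // => j /negPf ->; exact: expr0z.
Qed.

Lemma dependent_exp u n : dependent u -> dependent (u ^+ n).
Proof.
move=> du; elim: n => [|n IH]; last by rewrite exprS; apply: dependent_mul.
by rewrite expr0 -(rmorph1 kappa); apply: dependent_base; apply: oner_neq0.
Qed.

Lemma dependent_root u n : (0 < n)%N -> dependent (u ^+ n) -> dependent u.
Proof.
move=> n0 [nu [m [c [z [m0 nc e]]]]]; split; first by move: nu; rewrite expf_eq0 n0.
by exists (n * m)%N, c, z; split=> //; rewrite ?muln_gt0 ?n0 // exprM.
Qed.

Lemma dependent_prod (I : eqType) (s : seq I) (f : I -> E) : {in s, forall i, dependent (f i)} ->
  dependent (\prod_(i <- s) f i).
Proof.
elim: s => [|i s IH] h.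
  by rewrite big_nil -(rmorph1 kappa); apply: dependent_base; apply: oner_neq0.
rewrite big_cons; apply: dependent_mul; first by apply: h; rewrite inE eqxx.
by apply: IH => j js; apply: h; rewrite inE js orbT.
Qed.

End Dependent.

(** * Prime factors of the fibers *)

Section Fibers.
Variables (k : closedFieldType) (F : {poly {poly k}}) (E0 : seq k).
Local Notation A := {poly {poly k}}.
Local Notation cst x := ((x%:P)%:P).
Hypothesis irrF : forall lam : k, lam \notin E0 -> ring_irreducible (F - cst lam).

Definition fiber (lam : k) : seq A := undup (factors (F - cst lam)).

Let fiber_not_cst lam d : F - cst lam <> cst d.
Proof.
move=> e; have [mu muE] := closed_field_infinite E0; have [nG [nu _]] := irrF muE.
have e' : F - cst mu = cst (d + lam - mu) by rewrite !polyCB !polyCD -e; ring.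
move/negP: nu; apply; rewrite e'; apply/unit_bivariate; exists (d + lam - mu) => //.
by apply: contra_neq nG => h; rewrite e' h !polyC0.
Qed.

Lemma fiber_equation_neq0 lam : F - cst lam != 0.
Proof. by apply/eqP => h; apply: (@fiber_not_cst lam 0); rewrite h !polyC0. Qed.
Let nF := fiber_equation_neq0.

Lemma mem_fiber p lam : p \in fiber lam <-> normal_irreducible p /\ divides p (F - cst lam).
Proof.
rewrite mem_undup; split=> [h|[ip dp]]; last by apply/(mem_factors ip (nF lam)).
have ip := factors_normal (nF lam) h; by split=> //; apply/(mem_factors ip (nF lam)).
Qed.

Lemma fiber_nonempty lam : (0 < size (fiber lam))%N.
Proof.
have nu : F - cst lam \isn't a GRing.unit.
  by apply/negP => /unit_bivariate [d _]; apply: fiber_not_cst.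
have [p ip dp] := exists_irreducible_factor (nF lam) nu.
have [c nc np] := normalize_irreducible ip.
have : cst c * p \in fiber lam.
  apply/mem_fiber; split=> //; apply/divides_unitl => //.
  by apply/unit_bivariate; exists c.
by case: (fiber lam).
Qed.

Lemma fibers_disjoint p lam mu : p \in fiber lam -> p \in fiber mu -> lam = mu.
Proof.
move=> /mem_fiber [ip d1] /mem_fiber [_ d2]; apply/eqP; rewrite -subr_eq0; apply: contrapT => /negP nlm.
apply: (normal_not_unit ip nlm); have := dividesB d2 d1.
by rewrite !polyCB; congr divides; ring.
Qed.

Lemma irreducible_fiber lam : lam \notin E0 -> exists c, c != 0 /\ fiber lam = [:: cst c * (F - cst lam)].
Proof.
move=> lE; have [c nc ip] := normalize_irreducible (irrF lE); exists c; split=> //.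
have uc : (cst c : A) \is a GRing.unit by apply/unit_bivariate; exists c.
have all_eq q : q \in fiber lam -> q = cst c * (F - cst lam).
  move=> /mem_fiber [iq dq]; apply: normal_irreducible_divides => //; exact: divides_mull.
have := fiber_nonempty lam; have : uniq (fiber lam) by apply: undup_uniq.
case: (fiber lam) all_eq => [//|q [|r s]] all_eq; first by move=> _ _; rewrite (all_eq q (mem_head _ _)).
have hr : r \in [:: q, r & s] by rewrite inE mem_head orbT.
move=> /andP[/negP h _]; case: h; rewrite (all_eq q (mem_head _ _)) (all_eq r hr); exact: mem_head.
Qed.

Lemma evalF_neq0 s : s != 0 -> evalF F s != 0.
Proof.
elim/poly_closed_ind => [c nc|lam {}s ns IH]; first by rewrite evalF_cst !polyC_eq0.
by rewrite evalF_mul evalF_linear mulf_neq0.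
Qed.

(** Among the factors F - mu of s(F), only mu = lam meets the fiber of lam; [m] is the multiplicity
    of lam as a root of [s]. *)
Lemma ord_evalF_fiber lam s : s != 0 -> exists m : nat, forall p, p \in fiber lam ->
  ordA p (evalF F s) = (m * ordA p (F - cst lam))%N.
Proof.
elim/poly_closed_ind => [c nc|mu {}s ns [m IH]].
  by exists 0%N => p /mem_fiber [ip _]; rewrite evalF_cst ordA_cst.
exists (m + (mu == lam))%N => p pl; have [ip _] := (mem_fiber p lam).1 pl.
rewrite evalF_mul evalF_linear (ordA_mul p (evalF_neq0 ns) (nF mu)) (IH p pl) mulnDl; congr (_ + _)%N.
have [->|/eqP ne] := eqVneq mu lam; first by rewrite mul1n.
rewrite mul0n; apply/eqP; rewrite -leqn0 leqNgt; apply/negP => h; apply: ne.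
apply: (@fibers_disjoint p _ _ _ pl); apply/mem_fiber; split; [exact: ip|exact/(ordA_gt0 ip (nF mu))].
Qed.

Lemma ord_evalF_horizontal p s : normal_irreducible p -> (forall lam, p \notin fiber lam) -> s != 0 ->
  ordA p (evalF F s) = 0%N.
Proof.
move=> ip hp; elim/poly_closed_ind => [c nc|mu {}s ns IH]; first by rewrite evalF_cst ordA_cst.
rewrite evalF_mul evalF_linear (ordA_mul p (evalF_neq0 ns) (nF mu)) IH add0n; apply/eqP.
rewrite -leqn0 leqNgt; apply: contra (hp mu) => h.
by apply/mem_fiber; split; [exact: ip|exact/(ordA_gt0 ip (nF mu))].
Qed.

Lemma factor_expansion (a : A) (s : seq A) : a != 0 -> uniq s -> {subset factors a <= s} ->
  exists2 c : k, c != 0 & a = cst c * \prod_(p <- s) p ^+ ordA p a.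
Proof.
move=> na us sub; have [c [nc _ e]] := factorsP na; exists c => //.
by rewrite {1}e (prod_count _ us sub).
Qed.

(* One component of each fiber is left out: up to k(F) it is a rational combination of the others. *)
Definition fiber_basis : seq A := flatten [seq behead (fiber lam) | lam <- undup E0].

Lemma behead_uniq_fiber lam : uniq (behead (fiber lam)).
Proof. by have := undup_uniq (factors (F - cst lam)); rewrite -/(fiber lam); case: (fiber lam) => //= ? ? /andP[]. Qed.

Lemma fiber_basis_uniq : uniq fiber_basis.
Proof.
apply: flatten_uniq => [||lam mu p /mem_behead h /mem_behead]; first exact: undup_uniq.
  exact: behead_uniq_fiber.
exact: fibers_disjoint h.
Qed.

Lemma mem_fiber_basis p : p \in fiber_basis -> exists2 lam, lam \in E0 & p \in behead (fiber lam).
Proof. by move=> /flatten_mapP [lam]; rewrite mem_undup; exists lam. Qed.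

Lemma size_fiber_basis : (size fiber_basis)%:Z = \sum_(lam <- undup E0) ((size (fiber lam))%:Z - 1).
Proof.
rewrite /fiber_basis; elim: (undup E0) => [|lam s IH]; first by rewrite big_nil.
rewrite big_cons /= size_cat PoszD IH size_behead; congr (_ + _).
by have := fiber_nonempty lam; case: (size (fiber lam)) => //= n _; lia.
Qed.

Variables (K E : fieldType) (embK : {rmorphism {poly k} -> K}) (kappa : {rmorphism K -> E})
  (emb : {rmorphism A -> E}) (ordE : A -> E -> int).
Hypothesis embK_neq0 : forall s, s != 0 -> embK s != 0.
Hypothesis K_ratio : forall c, c != 0 -> exists s1 s2, [/\ s1 != 0, s2 != 0 & c = embK s1 / embK s2].
Hypothesis emb_neq0 : forall a, a != 0 -> emb a != 0.
Hypothesis E_ratio : forall u, u != 0 -> exists a1 a2, [/\ a1 != 0, a2 != 0 & u = emb a1 / emb a2].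
Hypothesis kappaE : forall s, kappa (embK s) = emb (evalF F s).
Hypothesis ordE_valuation : forall p, normal_irreducible p -> discrete_valuation (ordE p).
Hypothesis ordE_emb : forall p a, a != 0 -> ordE p (emb a) = (ordA p a)%:Z.

Definition basis_elt (i : 'I_(size fiber_basis)) : E := emb (nth 0 fiber_basis i).

Let basis_normal (i : 'I_(size fiber_basis)) : exists2 lam, lam \in E0 & nth 0 fiber_basis i \in behead (fiber lam).
Proof. exact (mem_fiber_basis (mem_nth 0 (ltn_ord i))). Qed.

Let normal_neq0 (p : A) : normal_irreducible p -> p != 0. Proof. by case=> [[]]. Qed.

Lemma basis_elt_neq0 i : basis_elt i != 0.
Proof.
have [lam _ pl] := basis_normal i; have [ip _] := (mem_fiber _ _).1 (mem_behead pl).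
exact: (emb_neq0 (normal_neq0 ip)).
Qed.

Let emb_cst (c : k) : emb (cst c) = kappa (embK c%:P).
Proof. by rewrite kappaE evalF_cst. Qed.
Let emb_fiber lam : emb (F - cst lam) = kappa (embK ('X - lam%:P)).
Proof. by rewrite kappaE evalF_linear. Qed.

Let dep := dependent kappa basis_elt.
Let nb := basis_elt_neq0.

Let dep_cst (c : k) : c != 0 -> dep (emb (cst c)).
Proof. by move=> nc; rewrite emb_cst; apply: dependent_base; apply: embK_neq0; rewrite polyC_eq0. Qed.

(** Outside [E0] the only component is F - lam up to a constant, an element of k(F). Inside, the
    component left out of the basis is recovered by dividing F - lam by the others; this yields its
    power by its multiplicity, whence a root. *)
Lemma vertical_dependent p lam : p \in fiber lam -> dep (emb p).
Proof.
move=> pl; have [ip dp] := (mem_fiber p lam).1 pl.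
have dF : dep (emb (F - cst lam)).
  by rewrite emb_fiber; apply: dependent_base; apply: embK_neq0; rewrite polyXsubC_eq0.
case: (boolP (lam \in E0)) => lE; last first.
  have [c [nc e]] := irreducible_fiber lE.
  move: pl; rewrite e inE => /eqP ->; rewrite rmorphM; apply: (dependent_mul nb) dF; exact: dep_cst.
have dB q : q \in behead (fiber lam) -> dep (emb q).
  move=> ql; have qB : q \in fiber_basis by apply/flatten_mapP; exists lam; rewrite ?mem_undup.
  have iq := qB; rewrite -index_mem in iq.
  by have := dependent_gen kappa nb (Ordinal iq); rewrite /basis_elt /= nth_index.
have sub : {subset factors (F - cst lam) <= fiber lam} by move=> q; rewrite mem_undup.
have [c nc e] := factor_expansion (nF lam) (undup_uniq _) sub.
case ef : (fiber lam) pl dB e => [//|p0 s]; rewrite inE => /orP[/eqP ep|ps] dB e; last exact: dB.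
have o0 : (0 < ordA p (F - cst lam))%N by apply/(ordA_gt0 ip (nF lam)).
apply: (dependent_root o0); pose C := emb (cst c) * \prod_(q <- s) emb q ^+ ordA q (F - cst lam).
have dC : dep C.
  apply: (dependent_mul nb); first exact: dep_cst.
  by apply: (dependent_prod nb) => q qs; apply: (dependent_exp nb); apply: dB.
have -> : emb p ^+ ordA p (F - cst lam) = emb (F - cst lam) / C; last exact: (dependent_mul nb dF (dependent_inv dC)).
have nC : C != 0 by case: dC.
apply: (mulIf nC); rewrite divfK // [RHS](congr1 emb e) -/(fiber lam) ef big_cons -ep rmorphM rmorphM rmorphXn rmorph_prod.
rewrite /C mulrCA; congr (_ * (_ * _)); apply: eq_bigr => q _; exact: esym (rmorphXn _ _ _).
Qed.

(** In the factorization of [u], the primes that lie on no fiber cancel between numerator and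
    denominator. *)
Lemma vertical_support_dependent u : u != 0 ->
  (forall p, normal_irreducible p -> (forall lam, p \notin fiber lam) -> ordE p u = 0) -> dep u.
Proof.
move=> nu hu; have [a1 [a2 [na1 na2 eu]]] := E_ratio nu.
pose s := undup (factors a1 ++ factors a2).
have sub1 : {subset factors a1 <= s} by move=> p h; rewrite mem_undup mem_cat h.
have sub2 : {subset factors a2 <= s} by move=> p h; rewrite mem_undup mem_cat h orbT.
have [c1 nc1 e1] := factor_expansion na1 (undup_uniq _) sub1.
have [c2 nc2 e2] := factor_expansion na2 (undup_uniq _) sub2.
have emb_exp (c : k) (o : A -> nat) : emb (cst c * \prod_(p <- s) p ^+ o p) = emb (cst c) * \prod_(p <- s) emb p ^+ o p.
  rewrite rmorphM rmorph_prod; congr (_ * _); apply: eq_bigr => p _; exact: rmorphXn.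
have -> : u = emb (cst c1) / emb (cst c2) * \prod_(p <- s) (emb p ^+ ordA p a1 / emb p ^+ ordA p a2).
  rewrite eu prodf_div mulf_div; congr (_ / _).
    exact: etrans (congr1 emb e1) (emb_exp c1 (fun p => ordA p a1)).
  exact: etrans (congr1 emb e2) (emb_exp c2 (fun p => ordA p a2)).
apply: (dependent_mul nb); first by apply: (dependent_mul nb); [|apply: dependent_inv]; apply: dep_cst.
apply: (dependent_prod nb) => p ps.
have ip : normal_irreducible p.
  move: ps; rewrite mem_undup mem_cat => /orP[]; exact: factors_normal.
case: (pselect (exists lam, p \in fiber lam)) => [[lam pl]|h].
  by apply: (dependent_mul nb); [|apply: dependent_inv]; apply: (dependent_exp nb); apply: vertical_dependent pl.
have hor lam : p \notin fiber lam by apply/negP => pl; apply: h; exists lam.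
have := hu p ip hor; rewrite eu (dval_div (ordE_valuation ip)) ?emb_neq0 // !ordE_emb // => /eqP.
rewrite subr_eq0 eqz_nat => /eqP ->; rewrite divff; last by rewrite expf_neq0 // emb_neq0 // normal_neq0.
by rewrite -(rmorph1 kappa); apply: dependent_base; apply: oner_neq0.
Qed.

(** Along a fiber, the orders of an element of k(F) are proportional to those of F - lam, while
    those of the product are the exponents. *)
Lemma basis_independent (z : 'I_(size fiber_basis) -> int) c :
  \prod_i basis_elt i ^ z i = kappa c -> forall i, z i = 0.
Proof.
move=> e.
have nc : c != 0.
  by rewrite -(fmorph_eq0 kappa) -e; apply/prodf_neq0 => i _; apply: expfz_neq0.
have ordc p : normal_irreducible p -> ordE p (kappa c) = \sum_i z i * (p == nth 0 fiber_basis i)%:Z.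
  move=> ip; rewrite -e (dval_prod (ordE_valuation ip)); last by move=> i; apply: expfz_neq0.
  apply: eq_bigr => i _; rewrite (dvalXz (ordE_valuation ip)) // mulrC; congr (_ * _).
  have [lam _ /mem_behead /mem_fiber [iq _]] := basis_normal i.
  by rewrite ordE_emb ?normal_neq0 // ordA_normal.
have [s1 [s2 [ns1 ns2 ec]]] := K_ratio nc.
move=> i; have [lam lE pl] := basis_normal i; set p := nth _ _ _ in pl.
have [m1 h1] := ord_evalF_fiber lam ns1; have [m2 h2] := ord_evalF_fiber lam ns2.
have ordk q : q \in fiber lam -> ordE q (kappa c) = (m1%:Z - m2%:Z) * (ordA q (F - cst lam))%:Z.
  move=> ql; have [iq _] := (mem_fiber q lam).1 ql.
  rewrite ec fmorph_div !kappaE (dval_div (ordE_valuation iq)) ?emb_neq0 ?evalF_neq0 //.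
  by rewrite !ordE_emb ?evalF_neq0 // h1 // h2 // !PoszM mulrBl.
(* The first component [p0] is not in the basis, so the product has order 0 along it; as F - lam has
   positive order there, the factor of proportionality is 0. *)
have m0 : m1%:Z - m2%:Z = 0.
  have := fiber_nonempty lam; have := undup_uniq (factors (F - cst lam)); rewrite -/(fiber lam).
  case ef : (fiber lam) => [//|p0 s] /= /andP[p0s _] _.
  have p0l : p0 \in fiber lam by rewrite ef mem_head.
  have [ip0 dp0] := (mem_fiber p0 lam).1 p0l.
  have := ordk p0 p0l; rewrite ordc // big1 => [/esym/eqP|j _]; last first.
    case: eqP => [ej|_]; rewrite ?mulr0 //.
    have [mu _ pmu] := basis_normal j; rewrite -ej in pmu.
    have em := fibers_disjoint (mem_behead pmu) p0l.
    by move: pmu; rewrite em ef /= (negPf p0s).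
  rewrite mulf_eq0 => /orP[/eqP //|]; rewrite eqz_nat => /eqP o0.
  by have := (ordA_gt0 ip0 (nF lam)).2 dp0; rewrite o0.
have pf := mem_behead pl; have [ip _] := (mem_fiber p lam).1 pf.
have := ordk p pf; rewrite m0 mul0r ordc // (bigD1 i) //= eqxx mulr1 big1 ?addr0 // => j ji.
rewrite nth_uniq ?fiber_basis_uniq // (inj_eq val_inj) eq_sym (negPf ji) mulr0 //.
Qed.

(** Basis elements are units of the localization: each divides some F - lam, which is inverted
    there. *)
Lemma basis_inverse i : exists a s, s != 0 /\ (basis_elt i)^-1 = emb a / emb (evalF F s).
Proof.
have [lam _ /mem_behead /mem_fiber [ip [d e]]] := basis_normal i.
exists d, ('X - lam%:P); split; first by rewrite polyXsubC_eq0.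
rewrite evalF_linear e rmorphM invfM mulrA divff ?mul1r //.
apply: emb_neq0; apply: contra_eq_neq e => ->; rewrite mul0r; exact: nF.
Qed.

(** Along such a prime every nonzero s(F) has order 0, so the valuation is trivial on k(F) and
    nonnegative on the localization. *)
Lemma horizontal_ring p : normal_irreducible p -> (forall lam, p \notin fiber lam) ->
  [/\ valuation_ring (valuation_ring_of (ordE p)),
    forall c, valuation_ring_of (ordE p) (kappa c),
    exists z, ~ valuation_ring_of (ordE p) z &
    forall a s, s != 0 -> valuation_ring_of (ordE p) (emb a / emb (evalF F s))].
Proof.
move=> ip hor; have dv := ordE_valuation ip.
have ord0 s : s != 0 -> ordE p (emb (evalF F s)) = 0.
  by move=> ns; rewrite ordE_emb ?evalF_neq0 // ord_evalF_horizontal.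
have np : emb p != 0 := emb_neq0 (normal_neq0 ip).
split.
- exact: dval_valuation_ring.
- move=> c; have [->|/K_ratio [s1 [s2 [n1 n2 ->]]]] := eqVneq c 0; first by left; rewrite rmorph0.
  right; rewrite fmorph_div !kappaE (dval_div dv) ?emb_neq0 ?evalF_neq0 // !ord0 //.
- exists (emb p)^-1; case=> [/eqP|]; first by rewrite invr_eq0 (negPf np).
  by rewrite (dvalV dv np) ordE_emb ?normal_neq0 // ordA_normal // eqxx.
move=> a s ns; have [->|na] := eqVneq a 0; first by left; rewrite rmorph0 mul0r.
by right; rewrite (dval_div dv) ?emb_neq0 ?evalF_neq0 // ord0 // subr0 ordE_emb.
Qed.

End Fibers.

Lemma valuation_ring_of_zero (M : fieldType) (w : M -> int) (u : M) : discrete_valuation w -> u != 0 ->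
  valuation_ring_of w u -> valuation_ring_of w u^-1 -> w u = 0.
Proof.
move=> dw nu; rewrite (valuation_ring_ofE w nu) (valuation_ring_ofE w (invr_neq0 nu)) (dvalV dw nu) oppr_ge0 => h1 h2.
by apply/eqP; rewrite eq_le h1 h2.
Qed.

(** * Comparison of the two computations of the rank *)

Section Count.
Variables (k : closedFieldType) (F : {poly {poly k}}) (E0 : seq k).
Local Notation A := {poly {poly k}}.
Local Notation cst x := ((x%:P)%:P).
Hypothesis irrF : forall lam : k, lam \notin E0 -> ring_irreducible (F - cst lam).

Variables (K E : fieldType) (embK : {rmorphism {poly k} -> K}) (kappa : {rmorphism K -> E})
  (emb : {rmorphism A -> E}) (ordE : A -> E -> int).
Hypothesis embK_neq0 : forall s, s != 0 -> embK s != 0.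
Hypothesis K_ratio : forall c, c != 0 -> exists s1 s2, [/\ s1 != 0, s2 != 0 & c = embK s1 / embK s2].
Hypothesis emb_neq0 : forall a, a != 0 -> emb a != 0.
Hypothesis E_ratio : forall u, u != 0 -> exists a1 a2, [/\ a1 != 0, a2 != 0 & u = emb a1 / emb a2].
Hypothesis kappaE : forall s, kappa (embK s) = emb (evalF F s).
Hypothesis ordE_valuation : forall p, normal_irreducible p -> discrete_valuation (ordE p).
Hypothesis ordE_emb : forall p a, a != 0 -> ordE p (emb a) = (ordA p a)%:Z.
Hypothesis algebraic_kappa : forall u, u != 0 -> algebraicOver kappa u -> exists c, u = kappa c.

Variables (L M : fieldType) (cM : {rmorphism L -> M}) (Pl : eqType) (v : Pl -> M -> int).
Hypothesis lp : line_places cM v.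
Variables (iota : {rmorphism K -> L}) (Theta : {rmorphism E -> M}).
Hypothesis Theta_kappa : forall c, Theta (kappa c) = cM (iota c).
Hypothesis algL : forall l, algebraicOver iota l.
Hypothesis algM : forall z, algebraicOver Theta z.
Hypothesis nonconstant : (forall c, Theta (emb 'X%:P) <> cM c) \/ (forall c, Theta (emb 'X) <> cM c).

Definition localized (z : E) : Prop := exists a s, s != 0 /\ z = emb a / emb (evalF F s).

Let localized_emb a : localized (emb a).
Proof.
exists a, 1; split; first exact: oner_neq0.
by rewrite evalFE !rmorph1 divr1.
Qed.

(** The localization is generated over k(F) by the two coordinates, since k(F) already contains the
    constants and the inverses of the s(F). *)
Let localized_min O : valuation_ring O -> (forall c, O (kappa c)) -> O (emb 'X%:P) -> O (emb 'X) ->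
  forall z, localized z -> O z.
Proof.
move=> vO Ok Ox Oy z [a [s [ns ->]]]; have sO := valuation_subring vO.
have OC (c : {poly k}) : O (emb c%:P).
  elim/poly_ind: c => [|c d IH]; first by rewrite polyC0 rmorph0; apply: subring0 sO.
  rewrite polyCD polyCM rmorphD rmorphM; apply: (subringD sO); first exact: (subringM sO).
  by have := Ok (embK d%:P); rewrite kappaE evalF_cst.
apply: (subringM sO); last by rewrite -kappaE -fmorphV.
elim/poly_ind: a => [|a c IH]; first by rewrite rmorph0; apply: subring0 sO.
by rewrite rmorphD rmorphM; apply: (subringD sO) => //; apply: (subringM sO).
Qed.

Let zero_outside a u : u != 0 -> place_ring v Theta a u -> place_ring v Theta a u^-1 -> v a (Theta u) = 0.
Proof.
move=> nu h1 h2; apply: (valuation_ring_of_zero (lp_dval lp a)) => //; first by rewrite fmorph_eq0.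
by rewrite -fmorphV.
Qed.

Theorem polar_ring_count (X : (E -> Prop) -> Prop) :
  (forall O, X O <-> [/\ valuation_ring O, forall c, O (kappa c), exists z, ~ O z &
     exists z, localized z /\ ~ O z]) ->
  card_upto (@set_eq E) X (size (fiber_basis F E0)).+1.
Proof.
move=> hX.
have nx : emb 'X%:P != 0 by apply: emb_neq0; rewrite polyC_eq0 polyX_eq0.
have ny : emb 'X != 0 by apply: emb_neq0; rewrite polyX_eq0.
have [s [us hs]] := poles_finite lp Theta_kappa nx ny localized_min.
have closed a b : same_place v Theta a b -> a \in s -> b \in s.
  by move=> sab /hs pa; apply/hs; apply: is_pole_same sab pa.
have regular a z : a \notin s -> localized z -> place_ring v Theta a z.
  by move=> /negP na lz; apply: contrapT => nz; apply: na; apply/hs; exists z.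
have nonempty : exists a, a \in s.
  have [a pa] := poles_exist lp nx ny (localized_emb _) (localized_emb _) nonconstant.
  by exists a; apply/hs.
have nb := basis_elt_neq0 irrF emb_neq0.
have supp (i : 'I_(size (fiber_basis F E0))) : supported v Theta s (basis_elt emb i).
  split=> [|a na]; first exact (nb i).
  apply: zero_outside; [exact (nb i)|exact: (regular _ _ na (localized_emb _))|apply: (regular _ _ na)].
  by have [d [r [nr e]]] := basis_inverse irrF emb_neq0 i; exists d, r.
have gen u : supported v Theta s u -> exists (m : nat) c (z : 'I_(size (fiber_basis F E0)) -> int),
  [/\ (0 < m)%N, c != 0 & u ^+ m = kappa c * \prod_i basis_elt emb i ^ z i].
  move=> [nu hu]; apply: (proj2 (A := u != 0)).
  apply: (vertical_support_dependent irrF embK_neq0 emb_neq0 E_ratio kappaE ordE_valuation ordE_emb nu).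
  move=> p ip hor.
  (* The valuation ring of a prime on no fiber contains the localization, so it is the restriction
     at a point that is not a pole; there [u] has order 0. *)
  have [vO Ok nO lO] := horizontal_ring irrF K_ratio emb_neq0 kappaE ordE_valuation ordE_emb ip hor.
  have [a ha] := valuation_ring_restricted lp Theta_kappa algL vO Ok nO.
  have na : a \notin s.
    by apply/negP => /hs [z [[d [r [nr ez]]] nz]]; apply: nz; rewrite -ha ez; apply: lO.
  have va := hu a na; apply: (valuation_ring_of_zero (ordE_valuation ip) nu).
    by apply/ha/place_ringE => //; rewrite va.
  apply/ha/(place_ringE v Theta a (invr_neq0 nu)).
  by rewrite fmorphV (dvalV (lp_dval lp a)) ?fmorph_eq0 // va oppr0.
have [_ <-] := place_count lp Theta_kappa algL algM us closed algebraic_kappa supp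
  (basis_independent irrF K_ratio emb_neq0 kappaE ordE_valuation ordE_emb) gen nonempty.
exact: (card_polar_rings lp Theta_kappa algL algM hs hX).
Qed.

End Count.

Lemma line_places_projective (L : closedFieldType) : line_places (const_morph L) (@place_val L).
Proof.
split.
- exact: place_dval.
- exact: place_const.
- move=> a; case: a => [x|]; last first.
    exists (FracField.tofrac ('X - (0 : L)%:P)); split; first by rewrite tofrac_eq0 polyXsubC_eq0.
    by rewrite place_linear.
  exists (FracField.tofrac ('X - x%:P))^-1.
  have nz : FracField.tofrac ('X - x%:P) != 0 by rewrite tofrac_eq0 polyXsubC_eq0.
  split; first by rewrite invr_eq0.
  by rewrite (dvalV (place_dval (Some x)) nz) place_linear eqxx.
- exact: place_support.
- exact: place_residue.
- exact: valuation_ring_place.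
- exact: place_sum0.
- exact: place_prescribed.
- exact: place_regular_constant.
Qed.

Lemma order_valuation (k : closedFieldType) (p : {poly {poly k}}) : normal_irreducible p ->
  discrete_valuation (fracval (ordA p)).
Proof.
by move=> ip; apply: fracvalD => [a b na nb|a b na nb nab]; [exact: ordA_mul|exact: ordA_add].
Qed.

Theorem mainTheorem4 (k : closedFieldType) (F : poly2 k) :
  generally_rational F ->
  exists (t : nat) (n : k -> nat) (L : seq k),
    card_upto (@set_eq (fracA k)) (dicritical F) t /\
    (forall lam : k,
       card_upto (@set_eq (Spec (poly2 k)))
                 (irr_component (zV (F - cst2 lam))) (n lam)) /\
    uniq L /\ (forall lam : k, lam \notin L -> n lam = 1%N) /\
    (t%:Z - 1 = \sum_(lam <- L) ((n lam)%:Z - 1))%R.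
Proof.
move=> gr; have [L [iota [Theta [kappa [algL Theta_kappa algM kappaE ncst]]]]] := geometric_embedding gr.
have [E0 hE0] := gr.
have irrF (lam : k) : lam \notin E0 -> ring_irreducible (F - (lam%:P)%:P) by move=> /hE0 [].
have fr_neq0 (R : idomainType) (a : R) : a != 0 -> @FracField.tofrac R a != 0 by rewrite tofrac_eq0.
have ordE_emb (p a : {poly {poly k}}) : a != 0 -> fracval (ordA p) (FracField.tofrac a) = (ordA p a)%:Z.
  by move=> na; apply: fracval_embed => // c d nc nd; apply: ordA_mul.
have algk (u : fracA k) : u != 0 -> algebraicOver kappa u -> exists c, u = kappa c.
  move=> /fraction_nonzero_ratio [a [b [na nb ->]]] alg.
  exact: (algebraic_over_pencil irrF kappaE na nb alg).
have dicE (O : fracA k -> Prop) : dicritical F O <-> [/\ valuation_ring O, forall c, O (kappa c), exists z, ~ O z &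
     exists z, localized F (@FracField.tofrac (poly2 k)) z /\ ~ O z].
  have kFE x : kF F x <-> exists c, x = kappa c.
    split=> [[p [q [nq ->]]]|[c ->]].
      exists (FracField.tofrac p / FracField.tofrac q); apply: esym.
      exact: etrans (fmorph_div kappa _ _) (congr2 (fun u w : fracA k => u / w) (kappaE p) (kappaE q)).
    have [p [q [nq ->]]] := fraction_ratio c; exists p, q; split=> //.
    exact: etrans (fmorph_div kappa _ _) (congr2 (fun u w : fracA k => u / w) (kappaE p) (kappaE q)).
  split=> [[vO [Ok [nO lO]]]|[vO Ok nO lO]].
    by split=> // c; apply: Ok; apply/kFE; exists c.
  by split=> //; split=> [x /kFE [c ->]|//]; apply: Ok.
(* Values outside [E0] have an irreducible fiber and contribute nothing, so [E0] without repetitions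
   serves as the list of summation. *)
exists (size (fiber_basis F E0)).+1, (fun lam => size (fiber F lam)), (undup E0); split.
  exact: (polar_ring_count irrF (fr_neq0 _) (@fraction_nonzero_ratio _) (fr_neq0 _) (@fraction_nonzero_ratio _) kappaE (@order_valuation k) ordE_emb algk (line_places_projective L) Theta_kappa algL algM ncst dicE).
split; first by move=> lam; apply: card_components; apply: (fiber_equation_neq0 irrF).
split; first exact: undup_uniq.
split; first by move=> lam; rewrite mem_undup => /(irreducible_fiber irrF) [c [_ ->]].
by rewrite -(size_fiber_basis irrF) -addn1 PoszD addrK.
Qed.
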